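(* Let $M$ be a Klein geometry with transitively acting Lie group $G$, let $\omega\colon A\to\mathfrak g$ be an infinitesimal immersion of a connected manifold $\Sigma$ into $M$, and let $A=A^1\supset A^2\supset A^3\supset\cdots$ be the associated invariant filtration. Suppose $A^{k+1}=A^k$ for some $k\ge1$. Then the canonical flat connection $\nabla$ on $E=\mathfrak g\times\Sigma$ restricts to a flat Cartan connection on $A^k$, i.e. defines a twisted Lie algebra action on $\Sigma$, which is, in fact, an ordinary infinitesimal action on $\Sigma$ by a subalgebra $\mathfrak s\subset\mathfrak g$ (namely the $\nabla$-parallel sections of $A^k$, with $\xi\in\mathfrak s$ acting as the vector field $x\mapsto\#(\xi(x))$). In the case that $\omega$ is the logarithmic derivative of a smooth immersion $f\colon\Sigma\to M$, elements of the corresponding pseudogroup of transformations on $\Sigma$ correspond to restrictions to open subsets of $f(\Sigma)\subset M$ of left translations $m\mapsto g\cdot m$ in $M$, $g\in G$; that is, for each transformation $\varphi$ in the pseudogroup generated by the local flows of the vector fields of the $\mathfrak s$-action, each point of the domain of $\varphi$ has a neighbourhood on which $f\circ\varphi=L_g\circ f$ for some $g\in G$, where $L_g(m)=g\cdot m$.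
   Context: A Klein geometry is a smooth manifold $M$ with a smooth transitive action of a Lie group $G$. The bracket on the Lie algebra $\mathfrak g$ of $G$ is defined by right-invariant vector fields; $\xi^\dagger$ is the infinitesimal generator of $\xi\in\mathfrak g$ on $M$ and $\mathfrak g_m=\{\xi:\xi^\dagger(m)=0\}$. A Lie algebroid morphism $\omega\colon A\to\mathfrak g$, with $A$ a Lie algebroid over the connected manifold $\Sigma$ with anchor $\#$, is an infinitesimal immersion of $\Sigma$ into $M$ if: (I1) $A$ is transitive; (I2) $\omega$ is injective on fibres; (I3) for some (equivalently any) $x_0\in\Sigma$ there is $m_0\in M$ with $\omega(\ker\#|_{x_0})\subset\mathfrak g_{m_0}$; (I4) $\dim\mathfrak g-\operatorname{rank}A=\dim M-\dim\Sigma$. Using $\omega$, $A$ is identified with a subbundle of $E=\mathfrak g\times\Sigma$, on which $\nabla$ is the canonical flat connection and $\{X,Y\}(x)=[X(x),Y(x)]_{\mathfrak g}$; then $[X,Y]=\nabla_{\#X}Y-\nabla_{\#Y}X+\{X,Y\}$ for sections $X,Y$ of $A$. Invariant filtration: $A^1=A$ and, for $j\ge2$, $A^j|_x=\{X(x): X\in\Gamma(A^{j-1}),\ \nabla_uX\in A^{j-1}\text{ for all }u\in T_x\Sigma\}$; it is tacitly assumed throughout that each $A^j$ has constant rank, and each $A^j$ is then a subalgebroid of $A$. A connection $\nabla$ on a Lie algebroid $A$ is a Cartan connection if its cocurvature vanishes: for all $X,Y\in\Gamma(A)$ and vector fields $U$, $\nabla_U[X,Y]-[\nabla_UX,Y]-[X,\nabla_UY]+\nabla_{\bar\nabla_XU}Y-\nabla_{\bar\nabla_YU}X=0$,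 where $\bar\nabla_XU=\#\nabla_UX+[\#X,U]$. A twisted Lie algebra action is a Lie algebroid equipped with a flat Cartan connection; its infinitesimal generators are the vector fields $\#X$ for locally defined parallel sections $X$. The logarithmic derivative of an immersion $f\colon\Sigma\to M$ is $\delta f\colon A(f)\to\mathfrak g$, $(\xi,x)\mapsto\xi$, where $A(f)=\{(\xi,x)\in E:\xi^\dagger(f(x))\in T_xf(T_x\Sigma)\}$ with anchor sending $(\xi,x)$ to the $u\in T_x\Sigma$ with $Tf(u)=\xi^\dagger(f(x))$ and bracket given by the formula $[X,Y]=\nabla_{\#X}Y-\nabla_{\#Y}X+\{X,Y\}$. *)

(* Defs.v *)
From HB Require Import structures.
From mathcomp Require Import all_boot all_order all_algebra.
From mathcomp Require Import all_classical all_reals all_analysis.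

Set Implicit Arguments.
Unset Strict Implicit.
Unset Printing Implicit Defensive.

Import Order.TTheory GRing.Theory Num.Theory.
Import numFieldNormedType.Exports.

Local Open Scope classical_set_scope.
Local Open Scope ring_scope.

Section Smooth.
Context {R : realType} {V W : normedModType R}.

(* Only meant for [A] open and [V] finite-dimensional: C^k is then the same as
   continuity of the iterated directional derivatives of order at most k. *)
Fixpoint Ck (k : nat) (A : set V) (f : V -> W) : Prop :=
  match k with
  | 0%N => forall x, A x -> {for x, continuous f}
  | k'.+1 => (forall x, A x -> differentiable f x) /\
             (forall v, Ck k' A (fun x => 'D_v f x))
  end.

Definition smooth_on (A : set V) (f : V -> W) := forall k, Ck k A f.
End Smooth.

Record chart (R : realType) (T : topologicalType) (n : nat) := Chart {
  cdom : set T;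
  cfun :> T -> 'rV[R]_n;
  cinv : 'rV[R]_n -> T;
  cdom_open : open cdom;
  ccod_open : open (cfun @` cdom);
  cfunK : forall x, cdom x -> cinv (cfun x) = x;
  cfun_cont : forall x, cdom x -> {for x, continuous cfun};
  cinv_cont : forall y, (cfun @` cdom) y -> {for y, continuous cinv}
}.

Record manifold (R : realType) (n : nat) := Manifold {
  mcar :> topologicalType;
  mfd_hausdorff : hausdorff_space mcar;
  mfd_second_countable : @second_countable mcar;
  atlas : set (chart R mcar n);
  atlas_cover : forall x, exists c, atlas c /\ cdom c x;
  atlas_compat : forall c c', atlas c -> atlas c' ->
    smooth_on (c @` (cdom c `&` cdom c')) (c' \o cinv c)
}.

Arguments atlas {R n} m _.

Section Maps.
Context {R : realType}.

Section OneManifold.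
Context {n : nat} (M : manifold R n).

(* The tangent space T_x M is 'rV[R]_n, a tangent vector at x being given by
   its components in the chart [pchart x], chosen once and for all. *)
Definition pchart (x : M) : chart R M n := projT1 (cid (atlas_cover x)).

Definition smooth_fun_on {W : normedModType R} (D : set M) (h : M -> W) :=
  forall c, atlas M c -> smooth_on (c @` (cdom c `&` D)) (h \o cinv c).

Definition smooth_fun {W : normedModType R} (h : M -> W) :=
  smooth_fun_on setT h.

(* The derivative u(h) of a vector-valued function h along u in T_x M. *)
Definition dfun {W : normedModType R} (h : M -> W) (x : M) (u : 'rV[R]_n) : W :=
  'D_u (h \o cinv (pchart x)) (pchart x x).

Definition vfield := M -> 'rV[R]_n.

(* The local representative in the chart c of the vector field X. *)
Definition vrep (c : chart R M n) (X : vfield) : 'rV[R]_n -> 'rV[R]_n :=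
  fun y => dfun c (cinv c y) (X (cinv c y)).

Definition smooth_vfield_on (D : set M) (X : vfield) :=
  forall c, atlas M c -> smooth_on (c @` (cdom c `&` D)) (vrep c X).

Definition smooth_vfield (X : vfield) := smooth_vfield_on setT X.

(* Sign convention: [X, Y] h = X (Y h) - Y (X h) on functions. *)
Definition vbr (X Y : vfield) : vfield := fun x =>
  'D_(X x) (vrep (pchart x) Y) (pchart x x) -
  'D_(Y x) (vrep (pchart x) X) (pchart x x).

Definition integral_curve (X : vfield) (I : set R) (gam : R -> M) :=
  forall s : R^o, I s -> {for s, continuous gam} /\
    is_derive s 1 (pchart (gam s) \o gam : R^o -> 'rV[R]_n) (X (gam s)).

End OneManifold.

Section TwoManifolds.
Context {m n : nat} {M : manifold R m} {N : manifold R n}.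

Definition smooth_map_on (D : set M) (f : M -> N) :=
  (forall x, D x -> {for x, continuous f}) /\
  forall c c', atlas M c -> atlas N c' ->
    smooth_on (c @` (cdom c `&` D `&` f @^-1` cdom c')) (c' \o f \o cinv c).

Definition smooth_map (f : M -> N) := smooth_map_on setT f.

Definition tmap (f : M -> N) (x : M) (u : 'rV[R]_m) : 'rV[R]_n :=
  dfun (pchart (f x) \o f) x u.

Definition immersion (f : M -> N) :=
  smooth_map f /\ forall x, injective (tmap f x).

End TwoManifolds.

(* Smoothness of F as a map on the product manifold M1 x M2. *)
Definition smooth_map2 {m1 m2 n : nat} {M1 : manifold R m1}
    {M2 : manifold R m2} {N : manifold R n} (F : M1 -> M2 -> N) :=
  continuous (fun z : M1 * M2 => F z.1 z.2) /\
  forall c1 c2 c, atlas M1 c1 -> atlas M2 c2 -> atlas N c ->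
    smooth_on
      [set z : 'rV[R]_m1 * 'rV[R]_m2 |
         [/\ (c1 @` cdom c1) z.1, (c2 @` cdom c2) z.2
           & cdom c (F (cinv c1 z.1) (cinv c2 z.2))]]
      (fun z => c (F (cinv c1 z.1) (cinv c2 z.2))).

End Maps.

Section Pseudogroup.
Context {R : realType} {p : nat} {S : manifold R p}.

(* phi, a total function, matters on D only, and maps D diffeomorphically onto
   an open set. *)
Definition local_transf (D : set S) (phi : S -> S) :=
  [/\ open D, open (phi @` D), smooth_map_on D phi &
    exists psi : S -> S, (forall x, D x -> psi (phi x) = x) /\
      smooth_map_on (phi @` D) psi].

Definition local_flow (X : vfield S) (D : set S) (phi : S -> S) :=
  local_transf D phi /\
  exists t : R, forall x, D x -> exists (a b : R) (gam : R -> S),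
    [/\ a < 0 < b, a < t < b, integral_curve X [set s | a < s < b] gam,
        gam 0 = x & gam t = phi x].

(* The last clause gives closure under restriction, under gluing and under
   changing phi outside of D. *)
Inductive pseudogroup (gen : set S -> (S -> S) -> Prop) :
    set S -> (S -> S) -> Prop :=
| pg_gen D phi : gen D phi -> pseudogroup gen D phi
| pg_id : pseudogroup gen setT id
| pg_comp D phi D' psi :
    pseudogroup gen D phi -> pseudogroup gen D' psi ->
    pseudogroup gen (D `&` phi @^-1` D') (psi \o phi)
| pg_inv D phi psi :
    pseudogroup gen D phi -> (forall x, D x -> psi (phi x) = x) ->
    pseudogroup gen (phi @` D) psi
| pg_local D phi :
    local_transf D phi ->
    (forall x, D x -> exists (D' W : set S) (phi' : S -> S),
       [/\ pseudogroup gen D' phi', open W, W x, W `<=` D `&` D'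
         & forall y, W y -> phi y = phi' y]) ->
    pseudogroup gen D phi.

End Pseudogroup.

Record lie_group (R : realType) (d : nat) := LieGroup {
  lmfd :> manifold R d;
  lone : lmfd;
  lmul : lmfd -> lmfd -> lmfd;
  linv : lmfd -> lmfd;
  lmulA : associative lmul;
  lmul1 : left_id lone lmul;
  lmulV : left_inverse lone linv lmul;
  lmul_smooth : smooth_map2 lmul;
  linv_smooth : smooth_map linv
}.

Section Klein.
Context {R : realType} {d n : nat} (G : lie_group R d) {M : manifold R n}.

(* The Lie algebra of G is T_e G = 'rV[R]_d, with bracket [lbr]. *)
Definition right_invariant (xi : 'rV[R]_d) : vfield G :=
  fun g => tmap (fun h : G => lmul h g) (lone G) xi.

Definition lbr (xi eta : 'rV[R]_d) : 'rV[R]_d :=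
  vbr (right_invariant xi) (right_invariant eta) (lone G).

Definition klein_geometry (act : G -> M -> M) :=
  [/\ forall m, act (lone G) m = m,
      forall g h m, act (lmul g h) m = act g (act h m),
      smooth_map2 act
    & forall m m', exists g, act g m = m'].

(* xi^dagger, the value at m being d/dt (exp (t xi) . m) at t = 0. *)
Definition dagger (act : G -> M -> M) (xi : 'rV[R]_d) : vfield M :=
  fun m => tmap (fun g : G => act g m) (lone G) xi.

Definition isotropy (act : G -> M -> M) (m : M) : set 'rV[R]_d :=
  [set xi | dagger act xi m = 0].

Definition lie_subalgebra (s : {vspace 'rV[R]_d}) :=
  forall xi eta, xi \in s -> eta \in s -> lbr xi eta \in s.

(* The Lie bracket of g being defined by right-invariant vector fields, actions
   correspond to morphisms, rather than antimorphisms, into vector fields. *)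
Definition infinitesimal_action (s : {vspace 'rV[R]_d})
    (a : 'rV[R]_d -> vfield M) :=
  [/\ lie_subalgebra s,
      forall xi, xi \in s -> smooth_vfield (a xi),
      forall (t : R) xi eta, xi \in s -> eta \in s ->
        forall x, a (t *: xi + eta) x = t *: a xi x + a eta x
    & forall xi eta, xi \in s -> eta \in s ->
        forall x, a (lbr xi eta) x = vbr (a xi) (a eta) x].

End Klein.

Section Bundles.
Context {R : realType} {p : nat} (S : manifold R p).

Record frame (r : nat) (F : S -> vectType R) := Frame {
  fdom : set S;
  fvec : forall x, r.-tuple (F x);
  fdom_open : open fdom;
  fbasis : forall x, fdom x -> basis_of fullv (fvec x)
}.

(* A smooth vector bundle is presented by its fibres and a smooth atlas of local
   frames, that is, of local trivializations. *)
Record vbundle (r : nat) := VBundle {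
  fib :> S -> vectType R;
  frames : set (frame r fib);
  frames_cover : forall x, exists e, frames e /\ fdom e x;
  frames_compat : forall e e', frames e -> frames e' -> forall i j : 'I_r,
    smooth_fun_on (W := R^o) (fdom e `&` fdom e')
      (fun x => coord (fvec e x) i (tnth (fvec e' x) j))
}.

Arguments frames {r} v _.

Definition section {r} (A : vbundle r) := forall x, A x.

Definition smooth_sec_on {r} (A : vbundle r) (D : set S) (X : section A) :=
  forall e, frames A e -> forall i : 'I_r,
    smooth_fun_on (W := R^o) (fdom e `&` D)
      (fun x => coord (fvec e x) i (X x)).

Definition smooth_sec {r} (A : vbundle r) (X : section A) :=
  smooth_sec_on setT X.

Record lie_algebroid (r : nat) := LieAlgebroid {
  abun :> vbundle r;
  anchor : forall x, 'Hom(abun x, 'rV[R]_p);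
  anchor_smooth : forall e, frames abun e -> forall i : 'I_r,
    smooth_vfield_on (fdom e) (fun x => anchor x (tnth (fvec e x) i));
  abr : section abun -> section abun -> section abun;
  abr_smooth : forall X Y, smooth_sec X -> smooth_sec Y -> smooth_sec (abr X Y);
  abr_linear : forall (t : R) X Y Z,
    smooth_sec X -> smooth_sec Y -> smooth_sec Z -> forall x,
    abr (fun y => t *: X y + Y y) Z x = t *: abr X Z x + abr Y Z x;
  abr_anti : forall X Y, smooth_sec X -> smooth_sec Y -> forall x,
    abr X Y x = - abr Y X x;
  abr_jacobi : forall X Y Z, smooth_sec X -> smooth_sec Y -> smooth_sec Z ->
    forall x, abr X (abr Y Z) x + abr Y (abr Z X) x + abr Z (abr X Y) x = 0;
  abr_leibniz : forall (h : S -> R^o) X Y,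
    smooth_fun h -> smooth_sec X -> smooth_sec Y -> forall x,
    abr X (fun y => h y *: Y y) x =
      h x *: abr X Y x + dfun h x (anchor x (X x)) *: Y x;
  anchor_abr : forall X Y, smooth_sec X -> smooth_sec Y -> forall x,
    anchor x (abr X Y x) =
      vbr (fun y => anchor y (X y)) (fun y => anchor y (Y y)) x
}.

Definition asharp {r} (A : lie_algebroid r) (X : section A) : vfield S :=
  fun x => anchor A x (X x).

(* B is a subalgebroid of A through j, a morphism over the identity of S. *)
Definition subalgebroid {rB rA} (B : lie_algebroid rB) (A : lie_algebroid rA)
    (j : forall x, 'Hom(B x, A x)) :=
  [/\ forall x, injective (j x),
      forall e, frames B e -> forall i : 'I_rB,
        smooth_sec_on (A := A) (fdom e) (fun x => j x (tnth (fvec e x) i)),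
      forall x b, anchor A x (j x b) = anchor B x b
    & forall X Y, smooth_sec X -> smooth_sec Y -> forall x,
        j x (abr X Y x) =
          abr (l := A) (fun y => j y (X y)) (fun y => j y (Y y)) x].

Definition is_connection {r} (A : vbundle r)
    (nab : vfield S -> section A -> section A) :=
  [/\ forall U X, smooth_vfield U -> smooth_sec X -> smooth_sec (nab U X),
      forall (h : S -> R^o) U V X, smooth_fun h ->
        smooth_vfield U -> smooth_vfield V -> smooth_sec X -> forall x,
        nab (fun y => h y *: U y + V y) X x = h x *: nab U X x + nab V X x,
      forall U X Y, smooth_vfield U -> smooth_sec X -> smooth_sec Y ->
        forall x, nab U (fun y => X y + Y y) x = nab U X x + nab U Y x
    & forall (h : S -> R^o) U X,
        smooth_fun h -> smooth_vfield U -> smooth_sec X -> forall x,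
        nab U (fun y => h y *: X y) x =
          h x *: nab U X x + dfun h x (U x) *: X x].

Definition is_flat {r} (A : vbundle r)
    (nab : vfield S -> section A -> section A) :=
  forall U V X, smooth_vfield U -> smooth_vfield V -> smooth_sec X ->
    forall x, nab U (nab V X) x - nab V (nab U X) x - nab (vbr U V) X x = 0.

Definition nab_bar {r} (A : lie_algebroid r)
    (nab : vfield S -> section A -> section A)
    (X : section A) (U : vfield S) : vfield S :=
  fun x => asharp (nab U X) x + vbr (asharp X) U x.

Definition is_cartan {r} (A : lie_algebroid r)
    (nab : vfield S -> section A -> section A) :=
  forall X Y U, smooth_sec X -> smooth_sec Y -> smooth_vfield U -> forall x,
    nab U (abr X Y) x - abr (nab U X) Y x - abr X (nab U Y) x
    + nab (nab_bar nab X U) Y x - nab (nab_bar nab Y U) X x = 0.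

Definition twisted_action {r} (A : lie_algebroid r)
    (nab : vfield S -> section A -> section A) :=
  [/\ is_connection nab, is_flat nab & is_cartan nab].

End Bundles.

Arguments frames {R p S r} v _.

Section Immersions.
Context {R : realType} {d n p r : nat}.
Context (G : lie_group R d) {M : manifold R n} {S : manifold R p}.
Implicit Types (A : lie_algebroid S r).

(* A Lie algebroid morphism from A to the Lie algebra of G, viewed as a Lie
   algebroid over a point; sections of E = g x S are functions from S to g, on
   which the canonical flat connection is [dfun]. *)
Definition algebroid_form A (om : forall x, 'Hom(A x, 'rV[R]_d)) :=
  (forall e, frames A e -> forall i : 'I_r,
     smooth_fun_on (fdom e) (fun x => om x (tnth (fvec e x) i))) /\
  (forall X Y : section A, smooth_sec X -> smooth_sec Y -> forall x,
     om x (abr X Y x) =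
       dfun (fun y => om y (Y y)) x (asharp X x) -
       dfun (fun y => om y (X y)) x (asharp Y x) +
       lbr G (om x (X x)) (om x (Y x))).

Definition infinitesimal_immersion (act : G -> M -> M)
    A (om : forall x, 'Hom(A x, 'rV[R]_d)) :=
  [/\ algebroid_form om,
      (forall x (u : 'rV[R]_p), exists a : A x, anchor A x a = u),
      (forall x, injective (om x)),
      (exists (x0 : S) (m0 : M), forall a : A x0,
         anchor A x0 a = 0 -> isotropy act m0 (om x0 a))
    & d%:Z - r%:Z = n%:Z - p%:Z].

(* [filtration om j] is A^j, as a family of subsets of g, for j >= 1. *)
Definition next_filtration (F : S -> set 'rV[R]_d) : S -> set 'rV[R]_d :=
  fun x => [set v | exists X : S -> 'rV[R]_d,
    [/\ smooth_fun X, forall y, F y (X y),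
        forall u : 'rV[R]_p, F x (dfun X x u) & v = X x]].

Definition filtration A (om : forall x, 'Hom(A x, 'rV[R]_d)) (j : nat) :=
  iter j.-1 next_filtration (fun x => range (om x)).

Definition constant_rank (F : S -> set 'rV[R]_d) :=
  exists q, forall x, exists W : {vspace 'rV[R]_d},
    \dim W = q /\ F x = [set v | v \in W].

Definition parallel_section_on (D : set S) (F : S -> set 'rV[R]_d)
    (X : S -> 'rV[R]_d) :=
  [/\ smooth_fun_on D X, forall x, D x -> F x (X x)
    & forall x, D x -> forall u : 'rV[R]_p, dfun X x u = 0].

(* The vector field x |-> #(xi (x)) of an element xi of g that lies, as a
   constant section of E, in A; om being injective on fibres, the linear
   function (om x)^-1 inverts om x on its image. *)
Definition const_sharp A (om : forall x, 'Hom(A x, 'rV[R]_d))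
    (xi : 'rV[R]_d) : vfield S :=
  fun x => anchor A x ((om x)^-1%VF xi).

(* The injection om identifies A with A(f), together with its anchor; then om
   is the projection of A(f) onto g, and the bracket of A is the one of A(f) as
   soon as om is a Lie algebroid morphism. *)
Definition log_derivative (act : G -> M -> M) (f : S -> M)
    A (om : forall x, 'Hom(A x, 'rV[R]_d)) :=
  (forall x, range (om x) =
     [set xi | exists u : 'rV[R]_p, tmap f x u = dagger act xi (f x)]) /\
  (forall x a, tmap f x (anchor A x a) = dagger act (om x a) (f x)).

End Immersions.

(* Main.v *)
(* If A^(k+1) = A^k =: F, every vector of F x extends to a section of F whose
   derivative at x is again in F x. This makes F parallel for the flat connection,
   hence locally constant, hence equal to a constant subspace W of g, the base being
   connected. As constant sections with values in A^1 lie in every A^j, W consists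
   of all vectors of g lying in A x for every x. For xi, eta in W, the bracket
   [xi, eta] of constant sections is the constant [xi, eta]_g, which therefore lies
   in W too: W is a subalgebra s, F = s x S is an action algebroid, and its Cartan
   connection is the flat one, flatness being the symmetry of second derivatives.

   If A is the algebroid A(f) of an immersion f, then f carries the integral curves
   of the vector field #xi to those of xi^dagger. The latter are m -> g(t).m with g
   the one-parameter subgroup of G generated by xi: if m(t) is an integral curve,
   g(t)^-1.m(t) has zero velocity. So local flows of the s-action correspond to left
   translations, and this property is inherited by the generated pseudogroup. *)
Require Import Defs.
From HB Require Import structures.
From mathcomp Require Import all_boot all_order all_algebra.
From mathcomp Require Import all_classical all_reals all_analysis.
From mathcomp Require Import ring lra.

Set Implicit Arguments.
Unset Strict Implicit.
Unset Printing Implicit Defensive.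

Import Order.TTheory GRing.Theory Num.Theory.
Import numFieldNormedType.Exports.

Local Open Scope classical_set_scope.
Local Open Scope ring_scope.

(** * Calculus in normed modules *)

(** Tangent vectors at x are components in the chart [pchart x], and these charts vary with x
    without any continuity. A vector field or a velocity can be differentiated only through its
    representative in one fixed chart, so local constancy, flatness and velocities of curves all
    involve a change of chart. The description of W as the intersection of the fibres of A is free
    of the index k; closure under the bracket, the algebroid with fibre W and its connection are
    derived from it and from the properties of [om]. The laws of the bracket of g are obtained on W
    from those of A, through constant sections. For the pseudogroup, one g has to serve all points
    of the domain of a local flow, although their integral curves have different intervals of
    definition. Hence g may depend on xi and on the time only: the one-parameter curve is built
    once, near the unit, and compared with each integral curve separately. *)

Section CkTheory.
Context {R : realType} {V : normedModType R}.
Implicit Types (A B : set V) (k : nat).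

Section Gen.
Context {W : normedModType R}.
Implicit Types f g : V -> W.

Lemma Ck_sub k A B f : B `<=` A -> Ck k A f -> Ck k B f.
Proof.
move=> BA; elim: k f => [|k IH] f /=; first by move=> h x /BA /h.
by move=> [h1 h2]; split=> [x /BA /h1|v] //; apply: IH.
Qed.

(** Differentiability is the expansion of f (y + x) up to o(y), which depends on the germ of f at x
    only; uniqueness of the differential then identifies ['d f x] with ['d g x]. *)
Lemma near_eq_differentiable f g x :
  (\near x, f x = g x) -> differentiable f x -> differentiable g x.
Proof.
move=> fg df; apply/diff_locallyP.
have fgx : f x = g x by exact: nbhs_singleton fg.
have fg0 : \forall y \near 0, f (y + x) = g (y + x).
  have yx : (y + x @[y --> (0:V)]) --> x.
    by rewrite -[X in _ --> X]add0r; apply: cvgD => //; exact: cvg_cst.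
  exact: (yx [set z | f z = g z] fg).
have [c e] : continuous ('d f x) /\ f \o shift x = cst (f x) + 'd f x +o_ 0 id.
  exact/diff_locallyP.
have key : continuous ('d f x) /\ g \o shift x = cst (g x) + 'd f x +o_ 0 id.
  split=> //; apply/eqaddoP => eps eps0.
  move/eqaddoP : e => /(_ eps eps0) e.
  near=> y.
  have <- : (f \o shift x - (cst (f x) + 'd f x)) y =
    (g \o shift x - (cst (g x) + 'd f x)) y.
    have fgy : f (y + x) = g (y + x) by near: y.
    by rewrite /= !fctE /= /shift fgy fgx.
  by near: y.
have <- : 'd f x = 'd g x :> (V -> W).
  by apply/esym; apply: diff_unique; case: key.
exact: key.
Unshelve. all: by end_near. Qed.

Lemma Ck_ext k A f g :
  (forall x, A x -> \near x, f x = g x) -> Ck k A f -> Ck k A g.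
Proof.
elim: k f g => [|k IH] f g fg /=.
  move=> cf x Ax; have fgx := nbhs_singleton (fg _ Ax).
  rewrite /prop_for /continuous_at -fgx; apply: cvg_trans (cf _ Ax).
  by apply: near_eq_cvg; apply: filterS (fg _ Ax) => y ->.
move=> [df Df]; split=> [x Ax|v]; first exact: near_eq_differentiable (fg _ Ax) (df _ Ax).
apply: IH (Df v) => x Ax; have := near_join (fg _ Ax).
by apply: filterS => y; exact: near_eq_derive.
Qed.

Lemma Ck_open_ext k A f g : open A ->
  (forall x, A x -> f x = g x) -> Ck k A f -> Ck k A g.
Proof.
move=> oA fg; apply: Ck_ext => x Ax.
by apply: filterS (open_nbhs_nbhs (conj oA Ax)) => y /fg.
Qed.

Lemma Ck_local k A f :
  (forall x, A x -> exists2 B, B x & Ck k B f) -> Ck k A f.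
Proof.
elim: k f => [|k IH] f /= h; first by move=> x /h [B Bx]; apply.
split=> [x /h [B Bx [+ _]]|v]; first exact.
by apply: IH => x /h [B Bx [_ /(_ v)]]; exists B.
Qed.

Lemma Ck_diff k A f x : Ck k.+1 A f -> A x -> differentiable f x.
Proof. by move=> [+ _]; apply. Qed.

Lemma CkW k A f : Ck k.+1 A f -> Ck k A f.
Proof.
elim: k f => [|k IH] f /=.
  by move=> [h _] x Ax; apply/differentiable_continuous/h.
by move=> [h1 h2]; split => // v; apply: IH; exact: h2.
Qed.

Lemma Ck_cst k A (w : W) : Ck k A (fun=> w).
Proof.
elim: k w => [|k IH] w /=; first by move=> x _; exact: cst_continuous.
split=> [x _|v]; first exact: differentiable_cst.
by rewrite (_ : (fun x => 'D_v (fun=> w) x) = fun=> 0) //; apply/funext => x;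
  exact: derive_cst.
Qed.

Lemma CkD k A f g : open A ->
  Ck k A f -> Ck k A g -> Ck k A (fun x => f x + g x).
Proof.
move=> oA; elim: k f g => [|k IH] f g /=.
  by move=> cf cg x Ax; apply: continuousD; [exact: cf|exact: cg].
move=> [df Df] [dg Dg]; split=> [x Ax|v].
  exact: differentiableD (df _ Ax) (dg _ Ax).
apply: Ck_open_ext (IH _ _ (Df v) (Dg v)) => // x Ax.
by rewrite -deriveD //; apply: diff_derivable; [exact: df|exact: dg].
Qed.

End Gen.

Lemma Ck_lin {W W' : normedModType R} k A (f : V -> W) (L : {linear W -> W'}) :
  continuous L -> open A -> Ck k A f -> Ck k A (L \o f).
Proof.
move=> cL oA; elim: k f => [|k IH] f /=.
  move=> cf x Ax; apply: continuous_comp; [exact: cf|exact: cL].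
move=> [df Df]; split=> [x Ax|v].
  by apply: differentiable_comp; [exact: df|exact: linear_differentiable].
apply: Ck_open_ext (IH _ (Df v)) => // x Ax /=.
have dLx : differentiable L (f x) by exact: linear_differentiable.
have dc : differentiable (L \o f) x by exact: differentiable_comp (df _ Ax) _.
rewrite (deriveE v (df _ Ax)) (deriveE v dc) (diff_comp (df _ Ax) dLx) /=.
by rewrite diff_lin.
Qed.

End CkTheory.

Section ScaleDiff.
Context {R : realType} {V W : normedModType R}.

(** Makes scaling available as a bilinear map, so that the product rule for a scalar function times
    a vector function is the chain rule for a bilinear map after a pair. *)
Lemma scaler_is_bilinear :
  bilinear_for
    (GRing.Scale.Law.clone _ _ *:%R _) (GRing.Scale.Law.clone _ _ *:%R _)
    (@GRing.scale R W : R^o -> W -> W).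
Proof.
split=> [u'|u] a x y /=.
- by rewrite scalerDl scalerA.
- by rewrite scalerDr !scalerA mulrC.
Qed.
HB.instance Definition _ := bilinear_isBilinear.Build R R^o W W _ _
  (@GRing.scale R W : R^o -> W -> W) scaler_is_bilinear.

Lemma is_diff_scaler_fun (a : V -> R^o) (f : V -> W) x :
  differentiable a x -> differentiable f x ->
  is_diff x (fun y => a y *: f y) (fun v => a x *: 'd f x v + 'd a x v *: f x).
Proof.
move=> da df.
pose B := (@GRing.scale R W : R^o -> W -> W) : {bilinear R^o -> W -> W}.
have cB : continuous (fun p : R^o * W => B p.1 p.2).
  by move=> z; exact: scale_continuous.
have dB := differentiable_bilin (a x, f x) cB.
have dp := differentiable_pair da df.
apply: DiffDef; first exact: (differentiable_comp dp dB).
rewrite [LHS](diff_comp dp dB) (diff_bilin _ cB) diff_pair //=.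
Qed.
End ScaleDiff.

Section CkAlgebra.
Context {R : realType} {V : normedModType R}.
Implicit Types (A : set V) (k : nat).

Lemma derive_scaler_fun {W : normedModType R} (a : V -> R^o) (f : V -> W) x v :
  differentiable a x -> differentiable f x ->
  'D_v (fun y => a y *: f y) x = a x *: 'D_v f x + 'D_v a x *: f x.
Proof.
move=> da df; have := is_diff_scaler_fun da df => ds.
by rewrite !deriveE // diff_val.
Qed.

Lemma CkZ {W : normedModType R} k A (a : V -> R^o) (f : V -> W) : open A ->
  Ck k A a -> Ck k A f -> Ck k A (fun x => a x *: f x).
Proof.
move=> oA; elim: k a f => [|k IH] a f.
  by move=> ca cf x Ax; apply: continuousZ; [exact: ca|exact: cf].
move=> ha hf; split=> [x Ax|v].
  by have [] := is_diff_scaler_fun (Ck_diff ha Ax) (Ck_diff hf Ax).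
have h : Ck k A (fun x => a x *: 'D_v f x + 'D_v a x *: f x).
  by apply: CkD => //; apply: IH;
    [exact: CkW ha|exact: hf.2|exact: ha.2|exact: CkW hf].
apply: Ck_open_ext h => // x Ax.
by rewrite derive_scaler_fun //; [exact: Ck_diff ha Ax|exact: Ck_diff hf Ax].
Qed.

Lemma CkZc {W : normedModType R} k A (a : R) (f : V -> W) : open A ->
  Ck k A f -> Ck k A (fun x => a *: f x).
Proof. by move=> oA; apply: CkZ => //; exact: (@Ck_cst _ _ R^o). Qed.

Lemma CkN {W : normedModType R} k A (f : V -> W) : open A ->
  Ck k A f -> Ck k A (fun x => - f x).
Proof.
move=> oA hf; rewrite (_ : (fun x => - f x) = fun x => (-1) *: f x).
  exact: CkZc.
by apply/funext => x; rewrite scaleN1r.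
Qed.

Lemma CkM k A (a b : V -> R^o) : open A ->
  Ck k A a -> Ck k A b -> Ck k A (fun x => a x * b x : R^o).
Proof. exact: (@CkZ R^o). Qed.

Lemma CkV k A (a : V -> R^o) : open A -> (forall x, A x -> a x != 0) ->
  Ck k A a -> Ck k A (fun x => (a x)^-1 : R^o).
Proof.
move=> oA a0; elim: k => [|k IH] ha.
  by move=> x Ax; apply: continuousV; [exact: a0|exact: ha].
have da x : A x -> differentiable a x by move=> Ax; exact: Ck_diff ha Ax.
split=> [x Ax|v]; first exact: differentiableV (da _ Ax) (a0 _ Ax).
(* The inverse is of class C^k by induction, hence so is its derivative, the product of -1/a^2 and
   ['D_v a]. *)
have hi := IH (CkW ha).
have h : Ck k A (fun x => - ((a x)^-1 * (a x)^-1 * 'D_v a x) : R^o).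
  apply: (@CkN R^o) => //; apply: CkM => //; last exact: ha.2.
  exact: CkM.
apply: Ck_open_ext h => // x Ax.
rewrite [RHS](@deriveV _ _ a x v (a0 _ Ax)); last exact/diff_derivable/da.
by rewrite -[RHS]/(_ * _) expr2 invfM mulNr.
Qed.

Lemma Ck_sum {W : normedModType R} k A (I : Type) (r : seq I) (P : pred I)
    (F : I -> V -> W) : open A ->
  (forall i, P i -> Ck k A (F i)) -> Ck k A (fun x => \sum_(i <- r | P i) F i x).
Proof.
move=> oA hF; elim: r => [|i r IH].
  by apply: (Ck_open_ext (f := fun=> 0)) (Ck_cst _ _ _) => // x _; rewrite big_nil.
have [Pi|nPi] := boolP (P i).
  apply: Ck_open_ext (CkD oA (hF i Pi) IH) => // x _.
  by rewrite big_cons Pi.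
by apply: Ck_open_ext IH => // x _; rewrite big_cons (negbTE nPi).
Qed.

Lemma Ck_prod k A (I : Type) (r : seq I) (P : pred I)
    (F : I -> V -> R^o) : open A ->
  (forall i, P i -> Ck k A (F i)) ->
  Ck k A (fun x => \prod_(i <- r | P i) F i x : R^o).
Proof.
move=> oA hF; elim: r => [|i r IH].
  apply: (Ck_open_ext (f := fun=> 1 : R^o)) (Ck_cst _ _ _) => // x _.
  by rewrite big_nil.
have [Pi|nPi] := boolP (P i).
  apply: Ck_open_ext (CkM oA (hF i Pi) IH) => // x _.
  by rewrite big_cons Pi.
by apply: Ck_open_ext IH => // x _; rewrite big_cons (negbTE nPi).
Qed.

Lemma coord_is_linear m n i j :
  linear (fun M : 'M[R]_(m, n) => M i j : R^o).
Proof. by move=> a M N; rewrite !mxE. Qed.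

Lemma Ck_coord k A m n (f : V -> 'M[R]_(m, n)) i j : open A ->
  Ck k A f -> Ck k A (fun x => f x i j : R^o).
Proof.
move=> oA hf.
pose cM := GRing.isLinear.Build R 'M[R]_(m, n) R^o _ _ (@coord_is_linear m n i j).
pose L : {linear 'M[R]_(m, n) -> R^o} :=
  HB.pack (fun M : 'M[R]_(m, n) => M i j : R^o) cM.
by apply: (@Ck_lin _ _ _ _ _ _ f L) => //; exact: coord_continuous.
Qed.

Lemma Ck_mx k A m n (f : V -> 'M[R]_(m, n)) : open A ->
  (forall i j, Ck k A (fun x => f x i j : R^o)) -> Ck k A f.
Proof.
move=> oA hf.
have h : Ck k A (fun x => \sum_i \sum_j f x i j *: delta_mx i j : 'M[R]_(m, n)).
  do 2 (apply: Ck_sum => // ? _).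
  by apply: CkZ => //; exact: Ck_cst.
by apply: Ck_open_ext h => // x _; rewrite -matrix_sum_delta.
Qed.

Lemma Ck_mulmx k A m n p (f : V -> 'M[R]_(m, n)) (g : V -> 'M[R]_(n, p)) :
  open A -> Ck k A f -> Ck k A g -> Ck k A (fun x => f x *m g x).
Proof.
move=> oA hf hg; apply: Ck_mx => // i j.
have h : Ck k A (fun x => \sum_l f x i l * g x l j : R^o).
  by apply: (@Ck_sum R^o) => // l _; apply: CkM => //; exact: Ck_coord.
by apply: Ck_open_ext h => // x _; rewrite mxE.
Qed.

Lemma Ck_det k A n (f : V -> 'M[R]_n) : open A ->
  Ck k A f -> Ck k A (fun x => \det (f x) : R^o).
Proof.
move=> oA hf; rewrite /determinant.
apply: (@Ck_sum R^o) => // s _; apply: CkM => //; first exact: (@Ck_cst _ _ R^o).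
by apply: Ck_prod => // i _; exact: Ck_coord.
Qed.

(** Cramer's formula: the adjugate divided by the determinant, the minors being polynomials in the
    entries. *)
Lemma Ck_invmx k A n (f : V -> 'M[R]_n) : open A ->
  (forall x, A x -> f x \in unitmx) -> Ck k A f -> Ck k A (fun x => invmx (f x)).
Proof.
move=> oA uf hf.
have h : Ck k A (fun x => (\det (f x))^-1 *: \adj (f x)).
  apply: CkZ => //.
    apply: CkV => //; last exact: Ck_det.
    by move=> x /uf; rewrite unitmxE unitfE.
  apply: Ck_mx => // i j.
  have h : Ck k A (fun x => (-1) ^+ (j + i) * \det (row' j (col' i (f x))) : R^o).
    apply: CkM => //; first exact: (@Ck_cst _ _ R^o).
    apply: Ck_det => //; apply: Ck_mx => // i' j'.
    apply: Ck_open_ext (Ck_coord (lift j i') (lift i j') oA hf) => // x _.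
    by rewrite !mxE.
  by apply: Ck_open_ext h => // x _; rewrite mxE.
by apply: Ck_open_ext h => // x Ax; rewrite /invmx uf.
Qed.

End CkAlgebra.

(** * Directional derivatives and the mean value theorem *)

Section DirectionalDerivative.
Context {R : realType}.
Implicit Types V W : normedModType R.

Lemma derive_chain {U V W : normedModType R} (f : U -> V) (g : V -> W) x v :
  differentiable f x -> differentiable g (f x) ->
  'D_v (g \o f) x = 'D_('D_v f x) g (f x).
Proof.
move=> df dg; have dc := differentiable_comp df dg.
by rewrite (deriveE v dc) (diff_comp df dg) (deriveE v df) (deriveE _ dg).
Qed.

Lemma is_derive_curve {V W : normedModType R} (c : R^o -> V) (g : V -> W)
    (s : R^o) (v : V) :
  is_derive s 1 c v -> differentiable g (c s) ->
  is_derive s 1 (g \o c : R^o -> W) ('D_v g (c s)).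
Proof.
move=> [dc cv] dg; have dfc : differentiable c s by exact/derivable1_diffP.
have dgc := differentiable_comp dfc dg.
split; first exact: diff_derivable.
by rewrite derive_chain // cv.
Qed.

Lemma derive_dirD {V W : normedModType R} (f : V -> W) x u v :
  differentiable f x -> 'D_(u + v) f x = 'D_u f x + 'D_v f x.
Proof. by move=> df; rewrite !(deriveE _ df) linearD. Qed.

Lemma derive_dirZ {V W : normedModType R} (f : V -> W) x a v :
  differentiable f x -> 'D_(a *: v) f x = a *: 'D_v f x.
Proof. by move=> df; rewrite !(deriveE _ df) linearZ. Qed.

Lemma derive_dirN {V W : normedModType R} (f : V -> W) x v :
  differentiable f x -> 'D_(- v) f x = - 'D_v f x.
Proof. by move=> df; rewrite !(deriveE _ df) linearN. Qed.

Lemma derive_dir_sum {n} {W : normedModType R} (f : 'rV[R]_n -> W) x v :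
  differentiable f x ->
  'D_v f x = \sum_i v 0 i *: 'D_(delta_mx 0 i) f x.
Proof.
move=> df; rewrite [in LHS](row_sum_delta v) (deriveE _ df) linear_sum.
by apply: eq_bigr => i _; rewrite linearZ (deriveE _ df).
Qed.

Lemma derive_mxE {V : normedModType R} m n (f : V -> 'M[R]_(m, n)) x v i j :
  derivable f x v -> 'D_v f x i j = 'D_v (fun y => f y i j : R^o) x.
Proof. by move=> df; rewrite (derive_mx df) mxE. Qed.

Lemma differentiable_bigsum {V W : normedModType R} k (F : 'I_k -> V -> W) x :
  (forall i, differentiable (F i) x) -> differentiable (fun y => \sum_i F i y) x.
Proof.
move=> dF; rewrite (_ : (fun y => _) = \sum_i F i).
  exact: differentiable_sum.
by apply/funext => y; rewrite fct_sumE.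
Qed.

Lemma differentiable_mx {V : normedModType R} m n (f : V -> 'M[R]_(m, n)) x :
  (forall i j, differentiable (fun y => f y i j : R^o) x) -> differentiable f x.
Proof.
move=> h; rewrite (_ : f = fun y => \sum_i \sum_j f y i j *: delta_mx i j).
  do 2 (apply: differentiable_bigsum => ?).
  exact: differentiableZl.
by apply/funext => y; exact: matrix_sum_delta.
Qed.

Lemma differentiable_mx_coord {V : normedModType R} m n
    (f : V -> 'M[R]_(m, n)) x i j :
  differentiable f x -> differentiable (fun y => f y i j : R^o) x.
Proof.
by move=> df; exact: (differentiable_comp df (differentiable_coord (f x) i j)).
Qed.

Lemma differentiable_linmx {W : normedModType R} m n
    (L : {linear 'M[R]_(m, n) -> W}) x : differentiable L x.
Proof.
rewrite (_ : (L : _ -> _) =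
    fun y => \sum_i \sum_j y i j *: L (delta_mx i j)).
  do 2 (apply: differentiable_bigsum => ?).
  by apply: differentiableZl; exact: differentiable_coord.
apply/funext => y; rewrite [in LHS](matrix_sum_delta y) linear_sum.
apply: eq_bigr => i _; rewrite linear_sum.
by apply: eq_bigr => j _; rewrite linearZ.
Qed.

Lemma derive_lin {V W : normedModType R} (L : {linear V -> W}) x v :
  differentiable L x -> 'D_v L x = L v.
Proof.
move=> dL; apply: cvg_lim => //.
have h : (fun=> L v) @ (0 : R)^' --> L v by exact: cvg_cst.
apply: cvg_trans h; apply: near_eq_cvg.
near=> h; have h0 : h != 0 by near: h; exact: nbhs_dnbhs_neq.
have -> : (L \o shift x) (h *: v) = h *: L v + L x.
  by rewrite /= /shift linearD linearZ.
by rewrite addrK scalerA mulVf // scale1r.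
Unshelve. all: by end_near. Qed.

Lemma derive_linmx {V W : normedModType R} m n (f : V -> 'M[R]_(m, n))
    (L : {linear 'M[R]_(m, n) -> W}) x v :
  differentiable f x -> 'D_v (fun y => L (f y)) x = L ('D_v f x).
Proof.
move=> df; have dL := differentiable_linmx L (f x).
by rewrite -[fun _ => _]/(L \o f) derive_chain // derive_lin.
Qed.

Lemma derive_affine {V W : normedModType R} (f : V -> W) x0 u (t : R^o) :
  differentiable f (x0 + t *: u) ->
  is_derive t 1 (fun s : R^o => f (x0 + s *: u)) ('D_u f (x0 + t *: u)).
Proof.
move=> df.
have dt : is_derive t 1 (fun s : R^o => x0 + s *: u) u.
  have h1 : is_derive t 1 (fun s : R^o => s *: u) u.
    have := is_diff_scalel t u.
    move=> ds; split; first exact/diff_derivable.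
    by rewrite deriveE // diff_val scale1r.
  have h0 := is_derive_cst x0 t 1.
  by have := is_deriveD h0 h1; rewrite add0r.
exact: (is_derive_curve dt df).
Qed.

Lemma MVT_dir {V : normedModType R} (f : V -> R^o) x u :
  (forall t : R, 0 <= t <= 1 -> differentiable f (x + t *: u)) ->
  exists2 t, 0 < t < 1 & f (x + u) - f x = 'D_u f (x + t *: u).
Proof.
move=> df.
have [| |t] := @MVT R (fun t => f (x + t *: u))
    (fun t => 'D_u f (x + t *: u)) 0 1 ltr01.
- move=> t; rewrite in_itv /= => /andP[t0 t1]; apply: derive_affine.
  by apply: df; rewrite !ltW.
- apply: derivable_within_continuous => t; rewrite in_itv /= => t01.
  by have [] := derive_affine (df _ t01).
rewrite in_itv /= => t01; rewrite scale0r addr0 scale1r subr0 mulr1 => e.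
by exists t.
Qed.

(** The mean value theorem, applied entry by entry along the segment from x to y, which stays in the
    ball. *)
Lemma derive0_const {V : normedModType R} m n (f : V -> 'M[R]_(m, n)) x r :
  (forall y, ball x r y -> differentiable f y) ->
  (forall y v, ball x r y -> 'D_v f y = 0) ->
  forall y, ball x r y -> f y = f x.
Proof.
move=> df Df y xy.
have inball t : 0 <= t <= 1 -> ball x r (x + t *: (y - x)).
  move=> /andP[t0 t1]; move: xy; rewrite -!ball_normE /= opprD addNKr normrN.
  rewrite normrZ ger0_norm // distrC => xy; apply: le_lt_trans xy.
  by rewrite ler_piMl.
apply/matrixP => i j.
have [|t t01] := @MVT_dir _ (fun y => f y i j) x (y - x).
  by move=> t /inball /df; exact: differentiable_mx_coord.
have {}t01 : 0 <= t <= 1 by case/andP: t01 => a b; rewrite !ltW.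
rewrite -derive_mxE; last exact/diff_derivable/df/inball.
rewrite Df; last exact: inball.
by rewrite mxE [x + _]addrC subrK => /eqP; rewrite subr_eq0 => /eqP.
Qed.

End DirectionalDerivative.

(** * Symmetry of second derivatives *)

Section Schwarz.
Context {R : realType} {V : normedModType R}.

(* Both mixed derivatives are limits of second_difference / h^2, by the mean
   value theorem applied twice. *)
Let second_difference (f : V -> R^o) (x : V) (u v : V) (r h : R) :
  (forall y, ball x r y -> differentiable f y) ->
  (forall y w, ball x r y -> differentiable (fun z => 'D_w f z) y) ->
  0 < h -> h * (`|u| + `|v|) < r ->
  exists2 z, `|x - z| <= h * (`|u| + `|v|) &
    f (x + h *: u + h *: v) - f (x + h *: u) - (f (x + h *: v) - f x) =
    h ^+ 2 * 'D_v (fun y => 'D_u f y) z.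
Proof.
move=> df ddf h0 hr.
have inb s t : 0 <= s <= 1 -> 0 <= t <= 1 ->
    `|x - (x + s *: (h *: u) + t *: (h *: v))| <= h * (`|u| + `|v|).
  move=> /andP[s0 s1] /andP[t0 t1].
  rewrite -addrA opprD addNKr normrN (le_trans (ler_normD _ _)) //.
  rewrite !normrZ !ger0_norm ?(ltW h0) // mulrDr.
  by apply: lerD; rewrite ler_piMl // mulr_ge0 // ltW.
have inbr s t : 0 <= s <= 1 -> 0 <= t <= 1 ->
    ball x r (x + s *: (h *: u) + t *: (h *: v)).
  by move=> s1 t1; rewrite -ball_normE /=; apply: le_lt_trans hr; exact: inb.
have i0 : 0 <= (0 : R) <= 1 by rewrite lexx ler01.
have i1 : 0 <= (1 : R) <= 1 by rewrite ler01 lexx.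
have dsh s : 0 <= s <= 1 ->
    is_derive (s : R^o) 1 (fun s : R^o =>
       f (x + h *: v + s *: (h *: u)) - f (x + s *: (h *: u)))
     ('D_(h *: u) f (x + h *: v + s *: (h *: u)) - 'D_(h *: u) f (x + s *: (h *: u))).
  move=> s01; apply: is_deriveB; apply: derive_affine; apply: df.
    by have := inbr s 1 s01 i1; rewrite scale1r addrAC.
  by have := inbr s 0 s01 i0; rewrite scale0r addr0.
(* The first mean value theorem concerns the difference of f along the two parallel sides of
   direction u; the second one moves ['D_(h *: u) f] from one side to the other, by h v. *)
have [| |s] := @MVT R (fun s => f (x + h *: v + s *: (h *: u)) - f (x + s *: (h *: u)))
    (fun s => 'D_(h *: u) f (x + h *: v + s *: (h *: u)) -
       'D_(h *: u) f (x + s *: (h *: u))) 0 1 ltr01.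
- move=> t; rewrite in_itv /= => /andP[t0 t1]; apply: dsh.
  by rewrite !ltW.
- apply: derivable_within_continuous => t; rewrite in_itv /= => t01.
  by have [] := dsh _ t01.
rewrite in_itv /= => /andP[s0 s1].
have s01 : 0 <= s <= 1 by rewrite !ltW.
rewrite !scale1r !scale0r !addr0 subr0 mulr1 => e1.
have [|t t01] := @MVT_dir _ _ (fun y => 'D_(h *: u) f y) (x + s *: (h *: u)) (h *: v).
  by move=> t t01; apply: ddf; exact: inbr.
have {}t01 : 0 <= t <= 1 by case/andP: t01 => a b; rewrite !ltW.
move=> e2; exists (x + s *: (h *: u) + t *: (h *: v)); first exact: inb.
rewrite [x + h *: u + h *: v]addrAC e1 [x + h *: v + _]addrAC e2.
have dz := inbr _ _ s01 t01.
rewrite (derive_dirZ _ _ (ddf _ _ dz)).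
have -> : 'D_v (fun y => 'D_(h *: u) f y) (x + s *: (h *: u) + t *: (h *: v)) =
   h *: 'D_v (fun y => 'D_u f y) (x + s *: (h *: u) + t *: (h *: v)).
  rewrite -deriveZ; last exact/diff_derivable/ddf.
  apply: near_eq_derive.
  have : nbhs (x + s *: (h *: u) + t *: (h *: v)) (ball x r).
    apply: open_nbhs_nbhs; split=> //; exact: ball_open.
  by apply: filterS => y /df dy; rewrite (derive_dirZ _ _ dy).
by rewrite -[_ *: (_ *: _)]/(_ * (_ * _)) mulrA expr2.
Qed.

Lemma derive_comm_scalar (f : V -> R^o) A x u v : open A -> Ck 2 A f -> A x ->
  'D_u (fun y => 'D_v f y) x = 'D_v (fun y => 'D_u f y) x.
Proof.
move=> oA hf Ax.
have df y : A y -> differentiable f y by exact: hf.1.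
have ddf y w : A y -> differentiable (fun z => 'D_w f z) y.
  exact: (hf.2 w).1.
have cc w w' : {for x, continuous (fun z => 'D_w (fun y => 'D_w' f y) z)}.
  by have := (hf.2 w').2 w; apply.
apply/eqP; rewrite -subr_eq0 -normr_le0; apply/ler_addgt0Pr => e e0.
rewrite add0r.
have e20 : 0 < e / 2 by rewrite divr_gt0.
have close w w' : exists2 r : R, 0 < r & ball x r `<=` [set z |
    `|'D_w (fun y => 'D_w' f y) x - 'D_w (fun y => 'D_w' f y) z| < e / 2].
  apply/nbhs_ballP; have /cvgrPdist_lt := cc w w'; exact.
have [r1 r10 b1] := close u v.
have [r2 r20 b2] := close v u.
have [r3 r30 b3] : exists2 r : R, 0 < r & ball x r `<=` A.
  by apply/nbhs_ballP; exact: open_nbhs_nbhs.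
pose r := Num.min r1 (Num.min r2 r3).
have r0 : 0 < r by rewrite !lt_min r10 r20 r30.
have n0 : 0 < `|u| + `|v| + 1 by rewrite ltr_wpDl // addr_ge0.
(* The summand 1 in the denominator covers the case where u and v both vanish. *)
pose h := r / 2 / (`|u| + `|v| + 1).
have h0 : 0 < h by rewrite !divr_gt0.
have hr : h * (`|u| + `|v|) < r.
  rewrite /h -mulrA; apply: (@lt_le_trans _ _ (r / 2 * 2)); last by rewrite divfK.
  rewrite ltr_pM2l ?divr_gt0 // ltr_pdivrMl //.
  apply: (@lt_le_trans _ _ (`|u| + `|v| + 1)); first by rewrite ltrDl.
  by rewrite ler_peMr ?(ltW n0) // ler1n.
have dfr y : ball x r y -> differentiable f y.
  by move=> xy; apply/df/b3; apply: le_ball xy; rewrite !ge_min lexx !orbT.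
have ddfr y w : ball x r y -> differentiable (fun z => 'D_w f z) y.
  by move=> xy; apply/ddf/b3; apply: le_ball xy; rewrite !ge_min lexx !orbT.
have [z1 xz1 e1] := second_difference dfr ddfr h0 hr.
have hr' : h * (`|v| + `|u|) < r by rewrite addrC.
have [z2 xz2 e2] := second_difference dfr ddfr h0 hr'.
(* The second difference is symmetric in u and v: exchanging them exchanges the two middle values of
   f. *)
have alg (a b c d : R) : a - b - (c - d) = a - c - (b - d).
  by rewrite !opprB addrACA [RHS]addrACA [X in _ = _ + X]addrC.
have xE : x + h *: v + h *: u = x + h *: u + h *: v by rewrite addrAC.
rewrite xE in e2.
have h20 : h ^+ 2 != 0 by rewrite expf_neq0 // gt_eqF.
have key (a b c d p q : R) : a - b - (c - d) = h ^+ 2 * p ->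
    a - c - (b - d) = h ^+ 2 * q -> p = q.
  by move=> ep eq; apply: (mulfI h20); rewrite -ep -eq; exact: alg.
have zz := key _ _ _ _ _ _ e1 e2.
have z2b : ball x r1 z2.
  rewrite -ball_normE /=; apply: le_lt_trans xz2 (lt_le_trans hr' _).
  by rewrite !ge_min lexx.
have z1b : ball x r2 z1.
  rewrite -ball_normE /=; apply: le_lt_trans xz1 (lt_le_trans hr _).
  by rewrite !ge_min lexx !orbT.
have /= B1 := b1 _ z2b; have /= B2 := b2 _ z1b.
have fin (a b c d : R) :
    `|a - b| < e / 2 -> `|c - d| < e / 2 -> d = b -> `|a - c| <= e.
  move=> ab cd db; apply: (le_trans (ler_distD b a c)).
  by rewrite (splitr e) -[b in X in _ + X]db [`|d - c|]distrC; apply/ltW/ltrD.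
exact: (fin _ _ _ _ B1 B2 zz).
Qed.

Lemma derive_comm m n (f : V -> 'M[R]_(m, n)) A x u v : open A -> Ck 2 A f ->
  A x -> 'D_u (fun y => 'D_v f y) x = 'D_v (fun y => 'D_u f y) x.
Proof.
move=> oA hf Ax; apply/matrixP => i j.
have dd w : differentiable (fun z => 'D_w f z) x by exact: (hf.2 w).1.
have comp w w' : ('D_w (fun y => 'D_w' f y) x) i j =
    'D_w (fun y => 'D_w' (fun z => f z i j : R^o) y) x.
  rewrite derive_mxE; last exact/diff_derivable.
  apply: near_eq_derive; apply: filterS (open_nbhs_nbhs (conj oA Ax)) => y Ay.
  by rewrite -derive_mxE //; exact/diff_derivable/hf.1.
have hs : Ck 2 A (fun z => f z i j : R^o) by exact: Ck_coord.
exact: etrans (comp u v)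
  (etrans (derive_comm_scalar u v oA hs Ax) (esym (comp v u))).
Qed.

End Schwarz.

(** * Calculus on manifolds *)

Section ManifoldCalculus.
Context {R : realType} {n : nat} {M : manifold R n}.
Implicit Types (c : chart R M n) (D : set M) (x : M).

Lemma pchart_atlas x : atlas M (pchart x).
Proof. by rewrite /pchart; case: (cid _) => c []. Qed.

Lemma pchart_dom x : cdom (pchart x) x.
Proof. by rewrite /pchart; case: (cid _) => c []. Qed.
Hint Resolve pchart_atlas pchart_dom : core.

Lemma cdom_nbhs c x : cdom c x -> nbhs x (cdom c).
Proof. by move=> cx; apply: open_nbhs_nbhs; split=> //; exact: cdom_open. Qed.

Lemma cinv_cvg c x : cdom c x -> cinv c @ c x --> x.
Proof.
move=> cx; have := cinv_cont (c := c) (y := c x); rewrite /prop_for /continuous_at cfunK //.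
by apply; exists x.
Qed.

Lemma near_cinv c x (P : set M) : cdom c x -> nbhs x P ->
  \forall y \near c x, P (cinv c y).
Proof. by move=> cx Px; exact: (cinv_cvg cx Px). Qed.

Lemma near_cod c x : cdom c x -> \forall y \near c x, c (cinv c y) = y.
Proof.
move=> cx; have : nbhs (c x) (c @` cdom c).
  by apply: open_nbhs_nbhs; split; [exact: ccod_open|exists x].
by apply: filterS => _ [z cz <-]; rewrite cfunK.
Qed.

Lemma chart_img_open c D : open D -> open (c @` (cdom c `&` D)).
Proof.
move=> oD; rewrite openE => _ [x [cx Dx] <-]; rewrite /interior.
have h1 := near_cod cx.
have h2 : \forall y \near c x, (cdom c `&` D) (cinv c y).
  apply: near_cinv => //; apply: open_nbhs_nbhs; split=> //.
  by apply: openI => //; exact: cdom_open.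
by apply: filterS2 h1 h2 => y yE yD; exists (cinv c y).
Qed.

Section Functions.
Context {W : normedModType R}.
Implicit Types (h : M -> W).

Definition mdiff h x := differentiable (h \o cinv (pchart x)) (pchart x x).

Lemma smooth_fun_on_chart_diff D h c x : atlas M c -> smooth_fun_on D h ->
  cdom c x -> D x -> differentiable (h \o cinv c) (c x).
Proof. by move=> ac sh cx Dx; apply: (sh c ac 1%N).1; exists x. Qed.

Lemma transition_diff c c' x : atlas M c -> atlas M c' -> cdom c x -> cdom c' x ->
  differentiable (c' \o cinv c) (c x).
Proof. by move=> ac ac' cx c'x; apply: (atlas_compat ac ac' 1%N).1; exists x. Qed.

Lemma near_chart_comp h c c' x : cdom c x -> cdom c' x ->
  \forall y \near c' x, ((h \o cinv c) \o (c \o cinv c')) y = (h \o cinv c') y.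
Proof.
move=> cx c'x; have := near_cinv c'x (cdom_nbhs cx).
by apply: filterS => y cy /=; rewrite cfunK.
Qed.

Lemma chart_diff h c c' x : atlas M c -> atlas M c' -> cdom c x -> cdom c' x ->
  differentiable (h \o cinv c) (c x) -> differentiable (h \o cinv c') (c' x).
Proof.
move=> ac ac' cx c'x dh.
apply: near_eq_differentiable (near_chart_comp h cx c'x) _.
apply: differentiable_comp; first exact: transition_diff.
by rewrite /= cfunK.
Qed.

Lemma mdiff_chart h c x : atlas M c -> cdom c x ->
  mdiff h x <-> differentiable (h \o cinv c) (c x).
Proof. by move=> ac cx; split; apply: chart_diff. Qed.

Lemma smooth_mdiff D h x : smooth_fun_on D h -> D x -> mdiff h x.
Proof. by move=> sh Dx; apply: smooth_fun_on_chart_diff sh _ _. Qed.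

(** Chain rule for the transition map [c \o cinv (pchart x)]: the vector with components u in
    [pchart x] has components [dfun c x u] in the chart c. *)
Lemma dfun_chart h c x u : atlas M c -> cdom c x -> mdiff h x ->
  dfun h x u = 'D_(dfun c x u) (h \o cinv c) (c x).
Proof.
move=> ac cx dh; rewrite /dfun.
have dc : differentiable (c \o cinv (pchart x)) (pchart x x).
  exact: transition_diff.
have dhc : differentiable (h \o cinv c) ((c \o cinv (pchart x)) (pchart x x)).
  by rewrite /= cfunK //; apply/mdiff_chart.
have := derive_chain u dc dhc; rewrite [X in _ = 'D__ _ X -> _]/= cfunK // => <-.
by apply/esym/near_eq_derive/near_chart_comp.
Qed.

Lemma dfun_near h g x u : (\near x, h x = g x) -> dfun h x u = dfun g x u.
Proof.
by move=> hg; apply: near_eq_derive; exact: (near_cinv (pchart_dom x) hg).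
Qed.

Lemma dfun_dirD h x u v : mdiff h x -> dfun h x (u + v) = dfun h x u + dfun h x v.
Proof. exact: derive_dirD. Qed.

Lemma dfun_dirZ h x a v : mdiff h x -> dfun h x (a *: v) = a *: dfun h x v.
Proof. exact: derive_dirZ. Qed.

Lemma dfun_dirN h x v : mdiff h x -> dfun h x (- v) = - dfun h x v.
Proof. exact: derive_dirN. Qed.

Lemma dfunD h g x u : mdiff h x -> mdiff g x ->
  dfun (fun y => h y + g y) x u = dfun h x u + dfun g x u.
Proof.
by move=> dh dg; rewrite /dfun -deriveD //; exact: diff_derivable.
Qed.

Lemma mdiffD h g x : mdiff h x -> mdiff g x -> mdiff (fun y => h y + g y) x.
Proof. exact: differentiableD. Qed.

Lemma dfunZ (a : M -> R^o) h x u :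
  differentiable (a \o cinv (pchart x)) (pchart x x) -> mdiff h x ->
  dfun (fun y => a y *: h y) x u =
    a x *: dfun h x u + 'D_u (a \o cinv (pchart x)) (pchart x x) *: h x.
Proof.
move=> da dh; have := derive_scaler_fun u da dh.
by rewrite [X in _ = X]/= cfunK.
Qed.

Lemma dfun_cst (w : W) x u : dfun (fun=> w) x u = 0.
Proof. exact: derive_cst. Qed.

Lemma mdiff_continuous h x : mdiff h x -> {for x, continuous h}.
Proof.
move=> dh; have cc := cfun_cont (pchart_dom x).
have := differentiable_continuous dh => ch.
have hc : h @ x --> h (cinv (pchart x) (pchart x x)).
  have hcc : (h \o cinv (pchart x) \o pchart x) @ x --> h (cinv (pchart x) (pchart x x)).
    exact: (@continuous_comp _ _ _ (pchart x) (h \o cinv (pchart x)) x cc ch).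
  apply: cvg_trans hcc; apply: near_eq_cvg.
  by apply: filterS (cdom_nbhs (pchart_dom x)) => y cy /=; rewrite cfunK.
by rewrite cfunK // in hc.
Qed.

End Functions.

Lemma dfun_pchart x u : dfun (pchart x) x u = u.
Proof.
rewrite /dfun (near_eq_derive (g := id)) ?derive_id //.
by apply: filterS (near_cod (pchart_dom x)) => y.
Qed.

Lemma dfun_lin m q (W : normedModType R) (h : M -> 'M[R]_(m, q))
    (L : {linear 'M[R]_(m, q) -> W}) x u : mdiff h x ->
  dfun (fun y => L (h y)) x u = L (dfun h x u).
Proof. by move=> dh; exact: (derive_linmx L u dh). Qed.

Lemma mdiff_cfun c x : atlas M c -> cdom c x -> mdiff c x.
Proof. by move=> ac cx; exact: transition_diff. Qed.

Section SmoothFunctions.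
Context {W : normedModType R}.
Implicit Types (h g : M -> W).

Lemma smooth_fun_on_sub D D' h : D' `<=` D -> smooth_fun_on D h ->
  smooth_fun_on D' h.
Proof.
move=> D'D sh c ac k; apply: Ck_sub (sh c ac k).
by move=> _ [x [cx /D'D Dx] <-]; exists x.
Qed.

Lemma smooth_fun_on_local D h :
  (forall x, D x -> exists2 D', D' x & smooth_fun_on D' h) -> smooth_fun_on D h.
Proof.
move=> hl c ac k; apply: Ck_local => _ [x [cx Dx] <-].
have [D' D'x sh] := hl x Dx.
by exists (c @` (cdom c `&` D')); [exists x|exact: sh].
Qed.

Lemma smooth_fun_on_near D h g : (forall x, D x -> \near x, h x = g x) ->
  smooth_fun_on D h -> smooth_fun_on D g.
Proof.
move=> hg sh c ac k; apply: Ck_ext (sh c ac k) => _ [x [cx Dx] <-].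
exact: (near_cinv cx (hg _ Dx)).
Qed.

Lemma smooth_fun_on_ext D h g : open D -> (forall x, D x -> h x = g x) ->
  smooth_fun_on D h -> smooth_fun_on D g.
Proof.
move=> oD hg; apply: smooth_fun_on_near => x Dx.
by apply: filterS (open_nbhs_nbhs (conj oD Dx)).
Qed.

Lemma smooth_cst D (w : W) : smooth_fun_on D (fun=> w).
Proof. by move=> c ac k; exact: (@Ck_cst R _ W). Qed.

Lemma smoothD D h g : open D -> smooth_fun_on D h -> smooth_fun_on D g ->
  smooth_fun_on D (fun x => h x + g x).
Proof.
by move=> oD sh sg c ac k; apply: CkD (sh c ac k) (sg c ac k); exact: chart_img_open.
Qed.

Lemma smoothZ D (a : M -> R^o) h : open D -> smooth_fun_on D a ->
  smooth_fun_on D h -> smooth_fun_on D (fun x => a x *: h x).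
Proof.
by move=> oD sh sg c ac k; apply: CkZ (sh c ac k) (sg c ac k); exact: chart_img_open.
Qed.

Lemma smooth_sum D (I : Type) (r : seq I) (P : pred I) (F : I -> M -> W) :
  open D -> (forall i, P i -> smooth_fun_on D (F i)) ->
  smooth_fun_on D (fun x => \sum_(i <- r | P i) F i x).
Proof.
move=> oD sF c ac k; apply: Ck_sum => [|i Pi]; first exact: chart_img_open.
exact: sF.
Qed.

End SmoothFunctions.

Section SmoothMatrices.

Lemma smooth_mxE D m q (h : M -> 'M[R]_(m, q)) i j : open D ->
  smooth_fun_on D h -> smooth_fun_on (W := R^o) D (fun x => h x i j).
Proof.
by move=> oD sh c ac k; apply: Ck_coord (sh c ac k); exact: chart_img_open.
Qed.

Lemma smooth_mx D m q (h : M -> 'M[R]_(m, q)) : open D ->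
  (forall i j, smooth_fun_on (W := R^o) D (fun x => h x i j)) ->
  smooth_fun_on D h.
Proof.
move=> oD sh c ac k; apply: Ck_mx => [|i j]; first exact: chart_img_open.
exact: (sh i j c ac k).
Qed.

Lemma smooth_mulmx D m q l (h : M -> 'M[R]_(m, q)) (g : M -> 'M[R]_(q, l)) :
  open D -> smooth_fun_on D h -> smooth_fun_on D g ->
  smooth_fun_on D (fun x => h x *m g x).
Proof.
by move=> oD sh sg c ac k; apply: Ck_mulmx (sh c ac k) (sg c ac k); exact: chart_img_open.
Qed.

Lemma smooth_det D q (h : M -> 'M[R]_q) : open D -> smooth_fun_on D h ->
  smooth_fun_on (W := R^o) D (fun x => \det (h x)).
Proof.
by move=> oD sh c ac k; apply: Ck_det (sh c ac k); exact: chart_img_open.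
Qed.

Lemma smooth_invmx D q (h : M -> 'M[R]_q) : open D ->
  (forall x, D x -> h x \in unitmx) -> smooth_fun_on D h ->
  smooth_fun_on D (fun x => invmx (h x)).
Proof.
move=> oD uh sh c ac k; apply: Ck_invmx (sh c ac k); first exact: chart_img_open.
by move=> _ [x [cx Dx] <-] /=; rewrite cfunK //; exact: uh.
Qed.

Lemma near_unitmx D q (h : M -> 'M[R]_q) x : open D -> smooth_fun_on D h ->
  D x -> h x \in unitmx -> \forall y \near x, h y \in unitmx.
Proof.
move=> oD sh Dx; rewrite unitmxE unitfE => h0.
have sd := smooth_det oD sh.
have cd : {for x, continuous (fun y => \det (h y) : R^o)}.
  exact: mdiff_continuous (smooth_mdiff sd Dx).
have : \forall y \near x, \det (h y) != 0.
  have : nbhs (\det (h x) : R^o) [set t | t != 0].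
    by apply: open_nbhs_nbhs; split=> //; exact: open_neq.
  by apply: cd.
by apply: filterS => y; rewrite unitmxE unitfE.
Qed.

End SmoothMatrices.
End ManifoldCalculus.
#[global] Hint Resolve pchart_atlas pchart_dom : core.

(** * Derivatives in directions that vary with the point *)

Section VaryingDirections.
Context {R : realType}.

Lemma derive_varying_dir {V : normedModType R} m q (h : V -> 'M[R]_(m, q))
    l (X : V -> 'rV[R]_l) (e : 'I_l -> V) A x u :
  open A -> Ck 2 A h -> A x -> differentiable X x ->
  'D_u (fun y => \sum_i X y 0 i *: 'D_(e i) h y) x =
  \sum_i (X x 0 i *: 'D_u (fun y => 'D_(e i) h y) x + 'D_u X x 0 i *: 'D_(e i) h x).
Proof.
move=> oA hh Ax dX.
have d1 i : differentiable (fun y => X y 0 i : R^o) x.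
  exact: differentiable_mx_coord.
have d2 i : differentiable (fun y => 'D_(e i) h y) x by exact: (hh.2 (e i)).1.
have d3 i : derivable (fun y => X y 0 i *: 'D_(e i) h y) x u.
  by apply: diff_derivable; have [] := is_diff_scaler_fun (d1 i) (d2 i).
have -> : (fun y => \sum_i X y 0 i *: 'D_(e i) h y) =
    \sum_i (fun y => X y 0 i *: 'D_(e i) h y).
  by apply/funext => y; rewrite fct_sumE.
rewrite derive_sum //; apply: eq_bigr => i _.
rewrite derive_scaler_fun // [in RHS]derive_mxE //; exact: diff_derivable.
Qed.

(** Expanding X in the constant directions [delta_mx 0 i] reduces this to the product rule; the last
    term collects the derivatives of the coefficients of X. *)
Lemma derive_derive_vfield l m q (h : 'rV[R]_l -> 'M[R]_(m, q))
    (X : 'rV[R]_l -> 'rV[R]_l) A x u :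
  open A -> Ck 2 A h -> A x -> differentiable X x ->
  'D_u (fun y => 'D_(X y) h y) x =
  'D_u (fun y => 'D_(X x) h y) x + 'D_('D_u X x) h x.
Proof.
move=> oA hh Ax dX.
have nA := open_nbhs_nbhs (conj oA Ax).
have dh y : A y -> differentiable h y by exact: hh.1.
rewrite (near_eq_derive (g := fun y => \sum_i X y 0 i *: 'D_(delta_mx 0 i) h y)).
  rewrite (derive_varying_dir _ _ oA hh Ax dX).
  rewrite (near_eq_derive (f := fun y => 'D_(X x) h y)
    (g := fun y => \sum_i X x 0 i *: 'D_(delta_mx 0 i) h y)).
    rewrite (derive_varying_dir _ _ oA hh Ax (differentiable_cst (X x) x)).
    rewrite derive_cst [X in _ = _ + X]derive_dir_sum; last exact: dh.
    rewrite -big_split; apply: eq_bigr => i _ /=.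
    by rewrite mxE scale0r addr0.
  by apply: filterS nA => y /dh dy; exact: derive_dir_sum.
by apply: filterS nA => y /dh dy; exact: derive_dir_sum.
Qed.

End VaryingDirections.

Section VectorFields.
Context {R : realType} {n : nat} {M : manifold R n}.
Implicit Types (c : chart R M n) (D : set M) (x : M) (X Y U V : vfield M).

Lemma vrep_pchart X x : vrep (pchart x) X (pchart x x) = X x.
Proof. by rewrite /vrep cfunK // dfun_pchart. Qed.

Lemma smooth_vfield_ext D X Y : open D -> (forall x, D x -> X x = Y x) ->
  smooth_vfield_on D X -> smooth_vfield_on D Y.
Proof.
move=> oD XY sX c ac k; apply: Ck_open_ext (sX c ac k); first exact: chart_img_open.
by move=> _ [x [cx Dx] <-]; rewrite /vrep (cfunK cx) (XY x Dx).
Qed.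

Lemma smooth_vfield_local D X :
  (forall x, D x -> exists2 D', D' x & smooth_vfield_on D' X) ->
  smooth_vfield_on D X.
Proof.
move=> hl c ac k; apply: Ck_local => _ [x [cx Dx] <-].
have [D' D'x sh] := hl x Dx.
by exists (c @` (cdom c `&` D')); [exists x|exact: sh].
Qed.

Lemma smooth_vfieldD D X Y : open D -> smooth_vfield_on D X ->
  smooth_vfield_on D Y -> smooth_vfield_on D (fun x => X x + Y x).
Proof.
move=> oD sX sY c ac k; have oA : open (c @` (cdom c `&` D)) by exact: chart_img_open.
apply: Ck_open_ext (CkD oA (sX c ac k) (sY c ac k)) => // _ [x [cx Dx] <-].
by rewrite /vrep cfunK // dfun_dirD //; exact: mdiff_cfun.
Qed.

Lemma smooth_vfieldZ D (a : M -> R^o) X : open D -> smooth_fun_on D a ->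
  smooth_vfield_on D X -> smooth_vfield_on D (fun x => a x *: X x).
Proof.
move=> oD sa sX c ac k; have oA : open (c @` (cdom c `&` D)) by exact: chart_img_open.
apply: Ck_open_ext (CkZ oA (sa c ac k) (sX c ac k)) => // _ [x [cx Dx] <-].
by rewrite /vrep /= cfunK // dfun_dirZ //; exact: mdiff_cfun.
Qed.

Lemma smooth_vfield0 D : smooth_vfield_on (M := M) D (fun=> 0).
Proof.
move=> c ac k; rewrite (_ : vrep c _ = fun=> 0); first exact: Ck_cst.
by apply/funext => y; rewrite /vrep /dfun derive0.
Qed.

Lemma smooth_vfield_sum D (I : Type) (r : seq I) (F : I -> vfield M) :
  open D -> (forall i, smooth_vfield_on D (F i)) ->
  smooth_vfield_on D (fun x => \sum_(i <- r) F i x).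
Proof.
move=> oD sF; elim: r => [|i r IH].
  by apply: smooth_vfield_ext (smooth_vfield0 _) => // x _; rewrite big_nil.
apply: smooth_vfield_ext (smooth_vfieldD oD (sF i) IH) => // x _.
by rewrite big_cons.
Qed.

Lemma dfun_vrep (W : normedModType R) (h : M -> W) X c x : atlas M c -> cdom c x ->
  mdiff h x -> dfun h x (X x) = 'D_(vrep c X (c x)) (h \o cinv c) (c x).
Proof. by move=> ac cx dh; rewrite /vrep cfunK //; exact: dfun_chart. Qed.

Lemma smooth_dfun (W : normedModType R) D (h : M -> W) X : open D ->
  smooth_fun_on D h -> smooth_vfield_on D X ->
  smooth_fun_on D (fun x => dfun h x (X x)).
Proof.
move=> oD sh sX c ac k; have oA : open (c @` (cdom c `&` D)) by exact: chart_img_open.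
have s : Ck k (c @` (cdom c `&` D)) (fun y =>
    \sum_i vrep c X y 0 i *: 'D_(delta_mx 0 i) (h \o cinv c) y).
  apply: Ck_sum => // i _; apply: CkZ => //; first exact: Ck_coord (sX c ac k).
  exact: (sh c ac k.+1).2.
apply: Ck_open_ext s => // _ [x [cx Dx] <-] /=; rewrite cfunK //.
rewrite (dfun_vrep X ac cx (smooth_mdiff sh Dx)) [RHS]derive_dir_sum //.
exact: smooth_fun_on_chart_diff sh _ _.
Qed.

(** In the chart at x, each iterated derivative is a second derivative in fixed directions plus a
    derivative of h along the derivative of one field in the direction of the other. The former
    cancel by symmetry, and the difference of the latter is the derivative along [vbr U V], by the
    very formula defining [vbr]. *)
Lemma dfun_flat m q (h : M -> 'M[R]_(m, q)) U V x :
  smooth_fun h -> smooth_vfield U -> smooth_vfield V ->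
  dfun (fun y => dfun h y (V y)) x (U x) - dfun (fun y => dfun h y (U y)) x (V x)
  = dfun h x (vbr U V x).
Proof.
move=> sh sU sV; pose c := pchart x.
have ac : atlas M c by exact: pchart_atlas.
have cx : cdom c x by exact: pchart_dom.
pose A := c @` (cdom c `&` setT).
have oA : open A by apply: chart_img_open; exact: openT.
have Ac : A (c x) by exists x.
have hh : Ck 2 A (h \o cinv c) by exact: (sh c ac 2%N).
have dd X Y : smooth_vfield X -> smooth_vfield Y ->
    dfun (fun y => dfun h y (X y)) x (Y x) =
    'D_(Y x) (fun y => 'D_(X x) (h \o cinv c) y) (c x) +
    'D_('D_(Y x) (vrep c X) (c x)) (h \o cinv c) (c x).
  move=> sX sY; have dX : differentiable (vrep c X) (c x).
    exact: (sX c ac 1%N).1.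
  have := derive_derive_vfield (Y x) oA hh Ac dX.
  rewrite [vrep c X (c x)]vrep_pchart => <-.
  apply: near_eq_derive; apply: filterS (open_nbhs_nbhs (conj oA Ac)) => _ [z [cz _] <-].
  by rewrite /= (cfunK cz) (dfun_vrep X ac cz (smooth_mdiff sh I)).
have dhc : differentiable (h \o cinv c) (c x) by exact: hh.1.
rewrite (dd V U) // (dd U V) // (derive_comm (V x) (U x) oA hh Ac).
rewrite opprD addrACA subrr add0r /vbr /dfun -/c.
by rewrite (derive_dirD _ _ dhc) (derive_dirN _ dhc).
Qed.

End VectorFields.

(** * Tangent maps, velocities of curves and maps of two variables *)

Section MapCalculus.
Context {R : realType}.

Section OneMap.
Context {m n : nat} {M : manifold R m} {N : manifold R n}.
Implicit Types (F : M -> N) (x : M).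

Definition map_diff F x :=
  {for x, continuous F} /\ mdiff (pchart (F x) \o F) x.

Lemma smooth_map_on_diff D F x : smooth_map_on D F -> D x -> map_diff F x.
Proof.
move=> [cF sF] Dx; split; first exact: cF.
apply: (sF (pchart x) (pchart (F x)) (pchart_atlas _) (pchart_atlas _) 1%N).1.
exists x => //; split; last exact: pchart_dom.
by split; [exact: pchart_dom|].
Qed.

Lemma comp_dfun (W : normedModType R) (h : N -> W) F x u :
  map_diff F x -> mdiff h (F x) ->
  mdiff (h \o F) x /\ dfun (h \o F) x u = dfun h (F x) (tmap F x u).
Proof.
move=> [cF dF] dh.
have dh' : differentiable (h \o cinv (pchart (F x)))
    ((pchart (F x) \o F \o cinv (pchart x)) (pchart x x)).
  by rewrite /= cfunK.
have e : \forall y \near pchart x x,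
    ((h \o cinv (pchart (F x))) \o (pchart (F x) \o F \o cinv (pchart x))) y =
    (h \o F \o cinv (pchart x)) y.
  have : nbhs x (F @^-1` cdom (pchart (F x))).
    by apply: cF; exact: cdom_nbhs.
  move=> /(near_cinv (pchart_dom x)); apply: filterS => y Fy /=.
  by rewrite cfunK.
split; first exact: near_eq_differentiable e (differentiable_comp dF dh').
apply: etrans (esym (near_eq_derive u e)) _; rewrite (derive_chain u dF dh').
by rewrite /dfun /= cfunK.
Qed.

End OneMap.

Lemma tmap_id {m} {M : manifold R m} (x : M) u : tmap id x u = u.
Proof. exact: dfun_pchart. Qed.

Lemma comp_tmap {m n l} {M : manifold R m} {N : manifold R n} {K : manifold R l}
    (F : M -> N) (G : N -> K) x u : map_diff F x -> map_diff G (F x) ->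
  map_diff (G \o F) x /\ tmap (G \o F) x u = tmap G (F x) (tmap F x u).
Proof.
move=> dF [cG dG]; have [d e] := comp_dfun u dF dG.
split; last exact: e.
by split; [apply: continuous_comp; [case: dF|]|].
Qed.

Section Curves.
Context {m : nat} {M : manifold R m}.
Implicit Types (gam : R^o -> M) (s : R^o).

(** The velocity v at time s in the components of [pchart (gam s)]: [integral_curve] is, by
    conversion, this condition at every time of the interval. *)
Definition cderiv (gam : R^o -> M) (s : R^o) (v : 'rV[R]_m) :=
  {for s, continuous gam} /\
  is_derive s 1 (pchart (gam s) \o gam : R^o -> 'rV[R]_m) v.

Lemma cderiv_dfun (W : normedModType R) (h : M -> W) gam s v :
  cderiv gam s v -> mdiff h (gam s) ->
  is_derive s 1 (h \o gam : R^o -> W) (dfun h (gam s) v).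
Proof.
move=> [cg dg] dh; have := is_derive_curve dg dh.
apply: near_eq_is_derive.
have : nbhs s (gam @^-1` cdom (pchart (gam s))).
  by apply: cg; exact: cdom_nbhs.
by apply: filterS => t gt /=; rewrite cfunK.
Qed.

Lemma cderiv_of_chart c gam s w : atlas M c -> cdom c (gam s) ->
  {for s, continuous gam} -> is_derive s 1 (c \o gam : R^o -> 'rV[R]_m) w ->
  cderiv gam s ('D_w (pchart (gam s) \o cinv c) (c (gam s))).
Proof.
move=> ac cg cont dg; split=> //.
have dt : differentiable (pchart (gam s) \o cinv c) (c (gam s)).
  exact: transition_diff.
have := is_derive_curve dg dt; apply: near_eq_is_derive.
have : nbhs s (gam @^-1` cdom c) by apply: cont; exact: cdom_nbhs.
by apply: filterS => t gt /=; rewrite cfunK.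
Qed.

Lemma cderiv_unique gam s v w : cderiv gam s v -> cderiv gam s w -> v = w.
Proof. by move=> [_ [_ <-]] [_ [_ <-]]. Qed.

End Curves.

Lemma cderiv_map {m n} {M : manifold R m} {N : manifold R n} (F : M -> N)
    (gam : R^o -> M) (s : R^o) v :
  cderiv gam s v -> map_diff F (gam s) ->
  cderiv (F \o gam) s (tmap F (gam s) v).
Proof.
move=> dg [cF dF]; split; last exact: (cderiv_dfun dg dF).
by apply: continuous_comp => //; case: dg.
Qed.

Section TwoVariables.
Context {m1 m2 n : nat} {M1 : manifold R m1} {M2 : manifold R m2}.
Context {N : manifold R n}.
Variables (F : M1 -> M2 -> N) (sF : smooth_map2 F).

Let rep (x1 : M1) (x2 : M2) (z : 'rV[R]_m1 * 'rV[R]_m2) :=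
  pchart (F x1 x2) (F (cinv (pchart x1) z.1) (cinv (pchart x2) z.2)).

Lemma smooth_map2_rep_diff x1 x2 :
  differentiable (rep x1 x2) (pchart x1 x1, pchart x2 x2).
Proof.
apply: (sF.2 _ _ _ (pchart_atlas x1) (pchart_atlas x2) (pchart_atlas (F x1 x2)) 1%N).1.
split=> /=; [by exists x1 => //; exact: pchart_dom
            |by exists x2 => //; exact: pchart_dom|].
by rewrite !cfunK; do ?exact: pchart_dom.
Qed.

Lemma continuous_pairr {T1 T2 : topologicalType} (a : T1) :
  continuous (fun y : T2 => (a, y)).
Proof. by move=> y; apply: cvg_pair => //; exact: cvg_cst. Qed.

Lemma continuous_pairl {T1 T2 : topologicalType} (b : T2) :
  continuous (fun y : T1 => (y, b)).
Proof. by move=> y; apply: cvg_pair => //; exact: cvg_cst. Qed.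

Let dpairl (z : 'rV[R]_m1 * 'rV[R]_m2) : differentiable (fun y => (y, z.2)) z.1.
Proof. by apply: differentiable_pair => //; exact: differentiable_cst. Qed.

Let dpairr (z : 'rV[R]_m1 * 'rV[R]_m2) : differentiable (fun y => (z.1, y)) z.2.
Proof. by apply: differentiable_pair => //; exact: differentiable_cst. Qed.

Let rep_left x1 x2 : rep x1 x2 \o (fun y => (y, pchart x2 x2)) =
  (pchart (F x1 x2) \o (F ^~ x2)) \o cinv (pchart x1).
Proof. by apply/funext => y; rewrite /rep /= cfunK //; exact: pchart_dom. Qed.

Let rep_right x1 x2 : rep x1 x2 \o (fun y => (pchart x1 x1, y)) =
  (pchart (F x1 x2) \o F x1) \o cinv (pchart x2).
Proof. by apply/funext => y; rewrite /rep /= cfunK //; exact: pchart_dom. Qed.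

Lemma smooth_map2_diffl x1 x2 : map_diff (F ^~ x2) x1.
Proof.
split.
  apply: (@continuous_comp _ _ _ (fun y => (y, x2)) (fun z => F z.1 z.2)).
    exact: continuous_pairl.
  exact: sF.1.
have := differentiable_comp (dpairl (pchart x1 x1, pchart x2 x2))
  (smooth_map2_rep_diff x1 x2).
by rewrite rep_left.
Qed.

Lemma smooth_map2_diffr x1 x2 : map_diff (F x1) x2.
Proof.
split.
  apply: (@continuous_comp _ _ _ (fun y => (x1, y)) (fun z => F z.1 z.2)).
    exact: continuous_pairr.
  exact: sF.1.
have := differentiable_comp (dpairr (pchart x1 x1, pchart x2 x2))
  (smooth_map2_rep_diff x1 x2).
by rewrite rep_right.
Qed.

(** The direction (u, v) is (u, 0) + (0, v), and freezing one variable turns each partial derivative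
    into a [tmap]. *)
Lemma derive_rep x1 x2 u v :
  'D_(u, v) (rep x1 x2) (pchart x1 x1, pchart x2 x2) =
  tmap (F ^~ x2) x1 u + tmap (F x1) x2 v.
Proof.
have dr := smooth_map2_rep_diff x1 x2.
have -> : (u, v) = (u, 0) + (0, v) :> 'rV[R]_m1 * 'rV[R]_m2.
  by rewrite -[RHS]/(_, _) addr0 add0r.
rewrite (derive_dirD _ _ dr); congr (_ + _).
  have := derive_chain u (dpairl (pchart x1 x1, pchart x2 x2)) dr.
  have -> : 'D_u (fun y => (y, pchart x2 x2)) (pchart x1 x1) = (u, 0).
    have ip := is_diff_pair (is_diff_id (pchart x1 x1))
      (is_diff_cst (pchart x2 x2) (pchart x1 x1)).
    by rewrite deriveE; [rewrite diff_val|case: ip].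
  by rewrite rep_left => /esym.
have := derive_chain v (dpairr (pchart x1 x1, pchart x2 x2)) dr.
have -> : 'D_v (fun y => (pchart x1 x1, y)) (pchart x2 x2) = (0, v).
  have ip := is_diff_pair (is_diff_cst (pchart x1 x1) (pchart x2 x2))
    (is_diff_id (pchart x2 x2)).
  by rewrite deriveE; [rewrite diff_val|case: ip].
by rewrite rep_right => /esym.
Qed.

(** Leibniz rule for curves. With F an action, it separates the velocity due to the group element
    from the velocity due to the moving point. *)
Lemma cderiv_map2 (g1 : R^o -> M1) (g2 : R^o -> M2) (s : R^o) u v : cderiv g1 s u -> cderiv g2 s v ->
  cderiv (fun t => F (g1 t) (g2 t)) s
    (tmap (F ^~ (g2 s)) (g1 s) u + tmap (F (g1 s)) (g2 s) v).
Proof.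
move=> [c1 d1] [c2 d2]; split.
  apply: (@continuous_comp _ _ _ (fun t => (g1 t, g2 t)) (fun z => F z.1 z.2)).
    exact: cvg_pair.
  exact: sF.1.
have dp : is_derive s 1
    (fun t : R^o => ((pchart (g1 s) \o g1) t, (pchart (g2 s) \o g2) t)) (u, v).
  have df1 : differentiable (pchart (g1 s) \o g1 : R^o -> _) s.
    by apply/derivable1_diffP; case: d1.
  have df2 : differentiable (pchart (g2 s) \o g2 : R^o -> _) s.
    by apply/derivable1_diffP; case: d2.
  have dp := differentiable_pair df1 df2.
  split; first exact: diff_derivable.
  rewrite deriveE // diff_pair //= -!deriveE //.
  by case: d1 => _ ->; case: d2 => _ ->.
have := is_derive_curve dp (smooth_map2_rep_diff (g1 s) (g2 s)).
rewrite derive_rep; apply: near_eq_is_derive.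
have n1 : \forall t \near s, cdom (pchart (g1 s)) (g1 t).
  by apply: c1; exact: cdom_nbhs.
have n2 : \forall t \near s, cdom (pchart (g2 s)) (g2 t).
  by apply: c2; exact: cdom_nbhs.
by apply: filterS2 n1 n2 => t t1 t2; rewrite /rep /= !cfunK.
Qed.

End TwoVariables.
End MapCalculus.

(** * Ordinary differential equations *)

Section PicardTools.
Context {R : realType}.

Lemma le_mx_norm m n (A : 'M[R]_(m, n)) i j : `|A i j| <= `|A|.
Proof.
rewrite [leRHS]/Num.Def.normr/= mx_normrE.
exact: (le_bigmax _ (fun ij => `|A ij.1 ij.2|) (i, j)).
Qed.

Lemma mx_norm_le m n (A : 'M[R]_(m, n)) C : 0 <= C ->
  (forall i j, `|A i j| <= C) -> `|A| <= C.
Proof.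
move=> C0 h; rewrite [leLHS]/Num.Def.normr/= mx_normrE.
by apply: bigmax_le => // -[i j] _; exact: h.
Qed.

(** Archimedean form of passing to the limit: estimates for the limit of the Picard iterates follow
    from estimates for the iterates with an error of order 2^-k. *)
Lemma le_of_geometric (a b y : R) : (forall k : nat, a <= b + y / 2 ^+ k) -> a <= b.
Proof.
move=> h; apply/ler_addgt0Pr => e e0.
have [y0|y0] := leP y 0.
  apply: le_trans (h 0%N) _; rewrite expr0 divr1; lra.
have [k hk] : exists k : nat, y / e < k%:R.
  by exists (Num.trunc (y / e)).+1; rewrite truncnS_gt.
apply: le_trans (h k) _; rewrite lerD2l ler_pdivrMr ?exprn_gt0 //.
rewrite mulrC -ler_pdivrMr //; apply: (le_trans (ltW hk)).
by rewrite -natrX ler_nat ltnW // ltn_expl.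
Qed.

(** The norm of a matrix is its largest entry, so the scalar mean value theorem, entry by entry,
    keeps the constant C. Measuring s by its distance to a allows b on either side of a. *)
Lemma mvt_bound m n (g g' : R -> 'M[R]_(m, n)) (a b : R) C : 0 <= C ->
  (forall s : R^o, `|s - a| <= `|b - a| ->
     is_derive s 1 (g : R^o -> 'M[R]_(m, n)) (g' s) /\ `|g' s| <= C) ->
  `|g b - g a| <= C * `|b - a|.
Proof.
move=> C0 h; apply: mx_norm_le => [|i j]; first by rewrite mulr_ge0.
have [|t t01] := @MVT_dir R R^o (fun s => g s i j) a (b - a).
  move=> t /andP[t0 t1]; apply/derivable1_diffP.
  have [|[dg _] _] := h (a + t *: (b - a)).
    by rewrite [a + _]addrC addrK normrZ ger0_norm // ler_piMl.
  by have /derivable_mxP := dg; apply.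
have /h[[dg dgE] gC] : `|a + t *: (b - a) - a| <= `|b - a|.
  have /andP[t0 t1] := t01.
  by rewrite [a + _]addrC addrK normrZ ger0_norm ?(ltW t0) // ler_piMl ?(ltW t1).
have -> : a + (b - a) = b by rewrite addrC subrK.
rewrite !mxE => ->.
have dgd : differentiable (fun s : R^o => g s i j : R^o) (a + t *: (b - a)).
  by apply: differentiable_mx_coord; exact/derivable1_diffP.
have := derive_dirZ (b - a) (1 : R^o) dgd.
have -> : (b - a) *: (1 : R^o) = b - a by exact: mulr1.
move=> ->; rewrite normrZ mulrC ler_wpM2r //.
have := derive_mxE i j dg; rewrite dgE => <-.
exact: le_trans (le_mx_norm _ _ _) gC.
Qed.

(** Fundamental theorem of calculus for the integral with base point -1. The window ]-1, 1[ is fixed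
    once and for all, existence of solutions being local in time. *)
Lemma primitive_exists (f : R -> R) : continuous f ->
  exists F : R -> R, forall s : R^o, -1 < s < 1 ->
    is_derive s 1 (F : R^o -> R^o) (f s).
Proof.
move=> cf.
exists (fun s => (\int[lebesgue_measure]_(t in [set` `[-1, s]]) f t)%R) => s /andP[s1 s2].
have [|dF FE] := @continuous_FTC1_closed R f (-1) s 1 s2 _ s1 (cf s).
  apply: continuous_compact_integrable; first exact: segment_compact.
  exact: continuous_subspaceT.
by split; [exact: dF|rewrite -derive1E].
Qed.

Lemma primitive_exists_row n (f : R -> 'rV[R]_n) : continuous f ->
  exists F : R -> 'rV[R]_n, F 0 = 0 /\ forall s : R^o, -1 < s < 1 ->
    is_derive s 1 (F : R^o -> 'rV[R]_n) (f s).
Proof.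
move=> cf.
have ci i : continuous (fun s => f s 0 i).
  by move=> s; apply: (@continuous_comp _ _ _ f (fun A : 'rV[R]_n => A 0 i));
    [exact: cf|exact: coord_continuous].
have [F hF] := choice (fun i => primitive_exists (ci i)).
exists (fun s => \row_i (F i s - F i 0)); split.
  by apply/rowP => i; rewrite !mxE subrr.
move=> s s1; have dF i : is_derive s 1 (fun s : R^o => F i s - F i 0 : R^o) (f s 0 i).
  have := is_deriveB (hF i s s1) (is_derive_cst (F i 0 : R^o) s 1).
  by rewrite subr0.
have dd : derivable (fun s : R^o => \row_i (F i s - F i 0)) s 1.
  apply/derivable_mxP => i j.
  rewrite (_ : (fun x => _) = fun s : R^o => F j s - F j 0 : R^o).
    by have [] := dF j.
  by apply/funext => t; rewrite mxE.
split=> //; apply/rowP => i; rewrite derive_mxE //.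
rewrite (_ : (fun y => _) = fun s : R^o => F i s - F i 0 : R^o).
  by have [] := dF i.
by apply/funext => t; rewrite mxE.
Qed.

(** For a <= b, the 1-Lipschitz retraction of the line onto [a, b]. It cuts off the time in the
    Picard iteration and, coordinatewise, the space variable of a locally Lipschitz field. *)
Definition clamp (a b s : R) := Num.max a (Num.min b s).

Lemma clamp_lipschitz a b s t : `|clamp a b s - clamp a b t| <= `|s - t|.
Proof.
have maxL (x y : R) : `|Num.max a x - Num.max a y| <= `|x - y|.
  have h1 := ler_norm (x - y); have h2 := ler_norm (y - x).
  rewrite distrC in h2; rewrite ler_norml.
  by case: (lerP a x) => ?; case: (lerP a y) => ?; apply/andP; split; lra.
have minL (x y : R) : `|Num.min b x - Num.min b y| <= `|x - y|.
  have h1 := ler_norm (x - y); have h2 := ler_norm (y - x).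
  rewrite distrC in h2; rewrite ler_norml.
  by case: (lerP b x) => ?; case: (lerP b y) => ?; apply/andP; split; lra.
exact: le_trans (maxL _ _) (minL _ _).
Qed.

Lemma clamp_id a b s : a <= s <= b -> clamp a b s = s.
Proof.
by move=> /andP[as_ sb]; rewrite /clamp (min_idPr sb) (max_idPr as_).
Qed.

Lemma clamp_in a b s : a <= b -> a <= clamp a b s <= b.
Proof. by move=> ab; rewrite /clamp le_max lexx ge_max ge_min lexx ab. Qed.

End PicardTools.

Section Picard.
Context {R : realType} {d : nat}.

Lemma geometric_cauchy_limit (x : nat -> 'rV[R]_d) (C : R) : 0 <= C ->
  (forall k, `|x k.+1 - x k| <= C / 2 ^+ k) ->
  exists l, forall k, `|x k - l| <= 2 * C / 2 ^+ k.
Proof.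
move=> C0 xC.
have half k : 2 * C / 2 ^+ k.+1 = C / 2 ^+ k.
  by rewrite exprS invfM mulrACA divff ?mul1r.
(* With the remaining tail added on the left the inequality passes from j to j + 1: the tail shrinks
   by exactly the bound on the next increment. *)
have tele k j : `|x k - x (k + j)%N| + 2 * C / 2 ^+ (k + j) <= 2 * C / 2 ^+ k.
  elim: j => [|j IH]; first by rewrite addn0 subrr normr0 add0r.
  rewrite addnS half; apply: le_trans IH.
  have -> : 2 * C / 2 ^+ (k + j) = C / 2 ^+ (k + j) + C / 2 ^+ (k + j).
    by rewrite -mulrA -mulr2n mulr_natl.
  rewrite addrA lerD2r; apply: le_trans (ler_distD (x (k + j)%N) _ _) _.
  by rewrite lerD2l distrC.
have {}tele k j : `|x k - x (k + j)%N| <= 2 * C / 2 ^+ k.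
  apply: le_trans (tele k j); rewrite lerDl.
  by rewrite divr_ge0 ?mulr_ge0.
have small e : 0 < e -> exists k : nat, 2 * C / 2 ^+ k < e.
  move=> e0; apply: contrapT => hn.
  have : e <= 0.
    apply: (@le_of_geometric _ _ _ (2 * C)) => k; rewrite add0r leNgt.
    by apply/negP => h; apply: hn; exists k.
  by rewrite leNgt e0.
have : cauchy (x @ \oo).
  apply: cauchy_exP => e e0; have [k hk] := small e e0.
  exists (x k); exists k => // j /= kj; rewrite -ball_normE /=.
  by apply: le_lt_trans hk; rewrite -(subnKC kj).
move=> /cauchy_cvgP /cvg_ex [l xl]; exists l => k.
apply/ler_addgt0Pr => e e0.
have [N _ hN] := (cvgrPdist_lt _ _).1 xl e e0.
have := hN (k + N)%N; rewrite /= leq_addl => /(_ isT) hl.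
apply: le_trans (ler_distD (x (k + N)%N) _ _) _.
by apply: lerD => //; rewrite distrC ltW.
Qed.

Lemma lipschitz_continuous (V W : normedModType R) (w : V -> W) K : 0 <= K ->
  (forall y z, `|w y - w z| <= K * `|y - z|) -> continuous w.
Proof.
move=> K0 wK y; apply/cvgrPdist_lt => e e0.
have e'0 : 0 < e / (K + 1) by rewrite divr_gt0 // ltr_wpDl.
apply/nbhs_ballP; exists (e / (K + 1)) => // z; rewrite -ball_normE /= => yz.
apply: le_lt_trans (wK y z) _.
have : (K + 1) * `|y - z| < e by rewrite -ltr_pdivlMl ?ltr_wpDl // mulrC.
apply: le_lt_trans; rewrite ler_wpM2r // lerDl //.
Qed.

(** Picard iteration with explicit errors: the iterates u_k converge geometrically.
    Differentiability of the limit comes from a first-order expansion whose remainder is quadratic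
    in t - s, obtained for the iterates and carried over to the limit. *)
Lemma picard_global (w : 'rV[R]_d -> 'rV[R]_d) x0 r K B : 0 < r -> 0 <= K -> 0 < B ->
  (forall y z, `|w y - w z| <= K * `|y - z|) -> (forall y, `|w y| <= B) ->
  exists (e : R) (u : R -> 'rV[R]_d), [/\ 0 < e, u 0 = x0 &
    forall s : R^o, `|s| < e -> `|u s - x0| <= r /\
      is_derive s 1 (u : R^o -> 'rV[R]_d) (w (u s))].
Proof.
move=> r0 K0 B0 wK wB.
have cw := lipschitz_continuous K0 wK.
have /choice[P hP] : forall u : R -> 'rV[R]_d, exists F : R -> 'rV[R]_d,
    continuous u -> F 0 = 0 /\ forall s : R^o, -1 < s < 1 ->
      is_derive s 1 (F : R^o -> 'rV[R]_d) (w (u s)).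
  move=> u; have [cu|ncu] := pselect (continuous u); last by exists (fun=> 0).
  have [|F hF] := @primitive_exists_row R d (w \o u).
    by move=> s; apply: continuous_comp; [exact: cu|exact: cw].
  by exists F.
(* Primitives are only available on ]-1, 1[: clamping the time makes every
   Picard iterate a continuous function on the whole line. *)
pose ct : R -> R := clamp (- 2^-1) 2^-1.
have h12 : - 2^-1 <= 2^-1 :> R by lra.
have cct : continuous ct.
  apply: (@lipschitz_continuous R^o R^o ct 1) => // y z.
  by rewrite mul1r; exact: clamp_lipschitz.
pose step (u : R -> 'rV[R]_d) := fun s => x0 + P u (ct s).
have ct1 s : -1 < ct s < 1.
  by have /andP[a b] := clamp_in s h12; rewrite /ct; apply/andP; split; lra.
have cstep u : continuous u -> continuous (step u).
  move=> cu s; have [_ dP] := hP u cu.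
  have cP : {for ct s, continuous (P u)}.
    apply: differentiable_continuous; apply/derivable1_diffP.
    by have [] := dP (ct s) (ct1 s).
  apply: continuousD; first exact: cst_continuous.
  by apply: continuous_comp; [exact: cct|exact: cP].
pose u_ k := iter k step (fun=> x0).
have cu k : continuous (u_ k).
  elim: k => [|k IH]; first exact: cst_continuous.
  exact: cstep.
have ct_id s : `|s| < 2^-1 -> ct s = s.
  by rewrite ltr_norml => /andP[a b]; rewrite /ct clamp_id // !ltW.
have u0 k : u_ k 0 = x0.
  case: k => [|k] //=; rewrite /step ct_id ?normr0 //.
  by have [-> _] := hP _ (cu k); rewrite addr0.
have du k (s : R^o) : `|s| < 2^-1 ->
    is_derive s 1 (u_ k.+1 : R^o -> 'rV[R]_d) (w (u_ k s)).
  move=> s12; have [_ dP] := hP _ (cu k).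
  have s1 : -1 < s < 1.
    by move: s12; rewrite ltr_norml => /andP[a b]; apply/andP; split; lra.
  have := is_deriveD (is_derive_cst x0 s 1) (dP s s1); rewrite add0r.
  apply: near_eq_is_derive.
  have : nbhs s (ball (0 : R^o) 2^-1).
    apply: open_nbhs_nbhs; split; first exact: ball_open.
    by rewrite -ball_normE /= sub0r normrN.
  apply: filterS => t; rewrite -ball_normE /= sub0r normrN => t12.
  by rewrite -[LHS]/(x0 + P (u_ k) t) /step ct_id.
(* For times below 1/2 the clamp is inactive; K e <= 1/2 makes each iteration halve the distance
   between successive iterates; B e <= r keeps all iterates within r of x0. Writing K + 1 admits K =
   0. *)
pose e := Num.min 2^-1 (Num.min (2 * (K + 1))^-1 (r / B)).
have K10 : 0 < 2 * (K + 1) by rewrite mulr_gt0 // ltr_wpDl.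
have e0 : 0 < e by rewrite !lt_min invr_gt0 ltr0n invr_gt0 K10 divr_gt0.
have e12 : e <= 2^-1 by rewrite ge_min lexx.
have eK : K * e <= 2^-1.
  have : e <= (2 * (K + 1))^-1 by rewrite !ge_min lexx !orbT.
  rewrite -(ler_pM2l K10) divff ?gt_eqF // => h.
  have : 0 <= e by exact: ltW.
  nra.
have eB : B * e <= r.
  rewrite mulrC -ler_pdivlMr //.
  by rewrite !ge_min lexx !orbT.
have lt12 s : `|s| < e -> `|s| < 2^-1 by move=> /lt_le_trans; apply.
have ubound k s : `|s| < e -> `|u_ k s - x0| <= r.
  move=> se; case: k => [|k]; first by rewrite subrr normr0 ltW.
  rewrite -(u0 k.+1); apply: le_trans (_ : B * `|s - 0| <= _).
    apply: (mvt_bound (g' := fun s => w (u_ k s))); first exact: ltW.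
    by rewrite !subr0 => t; rewrite !subr0 => ts; split => //;
      apply: du; apply: lt12; exact: le_lt_trans ts se.
  by rewrite subr0; apply: le_trans eB; rewrite ler_pM2l // ltW.
have ucauchy k s : `|s| < e -> `|u_ k.+1 s - u_ k s| <= r / 2 ^+ k.
  elim: k s => [|k IH] s se; first by rewrite expr0 divr1; exact: (ubound 1%N).
  have -> : u_ k.+2 s - u_ k.+1 s =
     (u_ k.+2 s - u_ k.+1 s) - (u_ k.+2 0 - u_ k.+1 0).
    by rewrite !u0 subrr subr0.
  apply: le_trans (_ : K * (r / 2 ^+ k) * `|s - 0| <= _).
    apply: (mvt_bound (g := fun s => u_ k.+2 s - u_ k.+1 s)
      (g' := fun s => w (u_ k.+1 s) - w (u_ k s))).
      by rewrite mulr_ge0 // divr_ge0 ?(ltW r0).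
    rewrite !subr0 => t; rewrite !subr0 => ts.
    have te : `|t| < e by exact: le_lt_trans ts se.
    split; first by apply: is_deriveB; apply: du; exact: lt12.
    by apply: le_trans (wK _ _) _; rewrite ler_wpM2l // IH.
  have -> : r / 2 ^+ k.+1 = 2^-1 * (r / 2 ^+ k) by rewrite exprS invfM mulrCA.
  rewrite subr0 mulrAC ler_wpM2r ?divr_ge0 ?(ltW r0) //.
  by apply: le_trans eK; rewrite ler_wpM2l // ltW.
have /choice[u hu] : forall s, exists l, `|s| < e ->
    forall k, `|u_ k s - l| <= 2 * r / 2 ^+ k.
  move=> s; have [se|nse] := boolP (`|s| < e); last by exists 0.
  have [l hl] := geometric_cauchy_limit (ltW r0) (fun k => ucauchy k s se).
  by exists l.
exists e, u; split=> //.
  apply/eqP; rewrite -subr_eq0 -normr_le0.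
  apply: (@le_of_geometric _ _ _ (2 * r)) => k; rewrite add0r -(u0 k) distrC.
  by apply: hu; rewrite normr0.
move=> s se; split.
  apply: (@le_of_geometric _ _ _ (2 * r)) => k.
  apply: le_trans (ler_distD (u_ k s) _ _) _; rewrite addrC; apply: lerD.
    exact: ubound.
  by rewrite distrC; exact: hu.
have inside t : `|s| + `|t - s| < e -> `|t| < e.
  by apply: le_lt_trans; rewrite -[t in `|t|](subrK s) addrC ler_normD.
have ulip t : `|s| + `|t - s| < e -> `|u t - u s| <= B * `|t - s|.
  move=> ts; have te := inside t ts.
  apply: (@le_of_geometric _ _ _ (4 * r)) => k.
  have h : `|u_ k t - u_ k s| <= B * `|t - s|.
    case: k => [|k]; first by rewrite subrr normr0 mulr_ge0 ?(ltW B0).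
    apply: (mvt_bound (g' := fun s => w (u_ k s))); first exact: ltW.
    move=> z zs; split=> //; apply: du; apply: lt12; apply: inside.
    by apply: le_lt_trans ts; rewrite lerD2l.
  have h1 := hu t te k; have h2 := hu s se k; rewrite distrC in h1.
  apply: le_trans (ler_distD (u_ k t) _ _) _.
  have := ler_distD (u_ k s) (u_ k t) (u s).
  have -> : 4 * r / 2 ^+ k = 2 * r / 2 ^+ k + 2 * r / 2 ^+ k.
    by rewrite -mulrDl -mulrDl -natrD.
  lra.
(* Between s and t the derivative of u_(k+1) differs from w (u s) by at most K (2 r / 2^k + B |t -
   s|); the term in 2^-k disappears as k grows. The hypothesis keeps every time between s and t
   inside the interval of radius e. *)
have quad t : `|s| + `|t - s| < e ->
    `|u t - u s - (t - s) *: w (u s)| <= K * B * `|t - s| ^+ 2.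
  move=> ts; have te := inside t ts.
  apply: (@le_of_geometric _ _ _ (K * (2 * r) * `|t - s| + 2 * r)) => k.
  pose g z := u_ k.+1 z - z *: w (u s).
  have hg : `|g t - g s| <= K * (2 * r / 2 ^+ k + B * `|t - s|) * `|t - s|.
    apply: (mvt_bound (g' := fun z => w (u_ k z) - w (u s))).
      rewrite mulr_ge0 // addr_ge0 // ?divr_ge0 ?mulr_ge0 ?(ltW r0) ?(ltW B0) //.
    move=> z zs; have sz : `|s| + `|z - s| < e.
      by apply: le_lt_trans ts; rewrite lerD2l.
    have ze := inside z sz; split.
      apply: is_deriveB; first by apply: du; exact: lt12.
      have := is_diff_scalel z (w (u s)) => ds.
      split; first exact/diff_derivable.
      by rewrite deriveE // diff_val scale1r.
    apply: le_trans (wK _ _) _; rewrite ler_wpM2l //.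
    apply: le_trans (ler_distD (u z) _ _) _; apply: lerD; first exact: hu.
    by apply: le_trans (ulip z sz) _; rewrite ler_pM2l.
  have h1 := hu t te k.+1; have h2 := hu s se k.+1; rewrite distrC in h1.
  have half : 2 * r / 2 ^+ k.+1 = r / 2 ^+ k.
    by rewrite exprS invfM mulrACA divff ?mul1r.
  rewrite half in h1 h2.
  have -> : u t - u s - (t - s) *: w (u s) =
      (u t - u_ k.+1 t) + ((u_ k.+1 s - u s) + (g t - g s)).
    rewrite /g scalerBl; move: (u_ k.+1 t) (u_ k.+1 s) (u t) (u s) (w (u s)).
    move=> a b a' b' c; apply/matrixP => i j; rewrite !mxE; ring.
  apply: le_trans (ler_normD _ _) _.
  have := ler_normD (u_ k.+1 s - u s) (g t - g s).
  have -> : K * B * `|t - s| ^+ 2 + (K * (2 * r) * `|t - s| + 2 * r) / 2 ^+ k =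
     K * (2 * r / 2 ^+ k + B * `|t - s|) * `|t - s| + r / 2 ^+ k + r / 2 ^+ k.
    by rewrite expr2; ring.
  lra.
have es0 : 0 < e - `|s| by rewrite subr_gt0.
have KB0 : 0 < K * B + 1 by rewrite ltr_wpDl // mulr_ge0 // ltW.
have dcvg : (fun h : R => h^-1 *: (u (h *: 1 + s) - u s)) @ 0^' --> w (u s).
  apply/cvgrPdist_lt => eps eps0; near=> h.
  have h0 : h != 0 by near: h; exact: nbhs_dnbhs_neq.
  have h1 : `|h| < e - `|s| by near: h; apply: dnbhs0_lt.
  have h2 : `|h| < eps / (K * B + 1) by near: h; apply: dnbhs0_lt; rewrite divr_gt0.
  have hs : h *: 1 + s - s = h by rewrite addrK; exact: mulr1.
  have := quad (h *: 1 + s); rewrite hs => /(_ _)/wrap[|q].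
    by rewrite addrC -ltrBrDr.
  have aux (a b : 'rV[R]_d) : b - h^-1 *: a = - (h^-1 *: (a - h *: b)).
    by rewrite scalerBr scalerA mulVf // scale1r opprB.
  rewrite aux normrN normrZ normfV ltr_pdivrMl ?normr_gt0 //.
  apply: le_lt_trans q _; rewrite expr2 mulrCA ltr_pM2l ?normr_gt0 //.
  apply: (@le_lt_trans _ _ ((K * B + 1) * `|h|)).
    by rewrite ler_wpM2r // lerDl.
  by rewrite -ltr_pdivlMl // mulrC.
split; first by apply/cvg_ex; exists (w (u s)).
exact: cvg_lim dcvg.
Unshelve. all: by end_near. Qed.
End Picard.

(** * Lipschitz bounds and local constancy *)

Section LocalFlow.
Context {R : realType}.

Lemma near_forall_ord (T : topologicalType) (x : T) n (P : 'I_n -> T -> Prop) :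
  (forall i, \forall y \near x, P i y) -> \forall y \near x, forall i, P i y.
Proof. by move=> h; apply: filter_forall. Qed.

Lemma C1_locally_lipschitz d (F : 'rV[R]_d -> 'rV[R]_d) A x :
  open A -> A x -> Ck 1 A F ->
  exists r K : R, [/\ 0 < r, 0 <= K,
    (forall y, `|y - x| <= r -> A y) &
    forall y z, `|y - x| <= r -> `|z - x| <= r -> `|F y - F z| <= K * `|y - z|].
Proof.
move=> oA Ax [dF cF].
have nb (i : 'I_d) : \forall y \near x,
    `|'D_(delta_mx 0 i) F y| < `|'D_(delta_mx 0 i) F x| + 1.
  have c1 : {for x, continuous (fun y => 'D_(delta_mx 0 i) F y)} by exact: cF.
  have /cvgrPdist_lt/(_ 1 ltr01) := c1; apply: filterS => y xy.
  have tri (p q : 'rV[R]_d) : `|p - q| < 1 -> `|q| < `|p| + 1.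
    rewrite distrC => pq; rewrite -[q in `|q|](subrK p) addrC.
    by apply: le_lt_trans (ler_normD _ _) _; rewrite ltrD2l.
  exact: tri xy.
have : \forall y \near x, A y /\ forall i,
    `|'D_(delta_mx 0 i) F y| < `|'D_(delta_mx 0 i) F x| + 1.
  have n2 : \forall y \near x, forall i,
      `|'D_(delta_mx 0 i) F y| < `|'D_(delta_mx 0 i) F x| + 1.
    exact: (near_forall_ord nb).
  by apply: filterS2 (open_nbhs_nbhs (conj oA Ax)) n2 => y.
move=> /nbhs_ballP [rho /= rho0 hb].
(* Near x each partial derivative is bounded by its size at x plus 1; since the coordinates of w are
   at most |w|, the sum of these bounds controls ['D_w F]. *)
pose K := \sum_i (`|'D_(delta_mx 0 i) F x| + 1).
have K0 : 0 <= K by apply: sumr_ge0 => i _; rewrite addr_ge0.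
have Kb y w : ball x rho y -> `|'D_w F y| <= K * `|w|.
  move=> /hb [Ay hy]; rewrite derive_dir_sum; last exact: dF.
  apply: le_trans (ler_norm_sum _ _ _) _; rewrite mulr_suml.
  apply: ler_sum => i _; rewrite normrZ mulrC ler_pM //; first exact: ltW.
  exact: le_mx_norm.
(* [mvt_bound] asks for all t with |t| <= 1, negative ones included; for y and z within rho / 4 of
   x, the point z + t (y - z) is within 3 rho / 4. *)
exists (rho / 4), K; split=> //; first by rewrite divr_gt0.
  move=> y yx; have [] := hb y; last by [].
  by rewrite -ball_normE /= distrC; apply: le_lt_trans yx _; lra.
move=> y z yx zx.
have inb t : `|t| <= 1 -> ball x rho (z + t *: (y - z)).
  move=> t1; rewrite -ball_normE /= distrC addrAC.
  apply: le_lt_trans (ler_normD _ _) _; rewrite normrZ.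
  have h1 := ler_distD x y z; rewrite [`|x - z|]distrC in h1.
  have h2 : `|t| * `|y - z| <= `|y - z| by rewrite ler_piMl.
  lra.
have := mvt_bound (g := fun t => F (z + t *: (y - z))) (a := 0) (b := 1)
  (g' := fun t => 'D_(y - z) F (z + t *: (y - z))) (C := K * `|y - z|).
rewrite scale0r addr0 scale1r [z + _]addrC subrK subr0 normr1 mulr1.
apply; first by rewrite mulr_ge0.
move=> s; rewrite subr0 => s1; split; last exact/Kb/inb.
by apply: derive_affine; apply: dF; have [] := hb _ (inb s s1).
Qed.

(** The level set of f through x is open and closed in D. The target is a bare type, so that f may
    also be a family of subsets of g. *)
Lemma locally_constant_connected (T : topologicalType) (X : Type) (D : set T)
    (f : T -> X) : open D -> connected D ->
  (forall x, D x -> \forall y \near x, f y = f x) ->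
  forall x y, D x -> D y -> f x = f y.
Proof.
move=> oD cD lc x y Dx Dy.
have e : [set z | D z /\ f z = f x] = D.
  apply: cD.
  - by exists x.
  - exists [set z | D z /\ f z = f x].
      rewrite openE => z [Dz fz]; rewrite /interior.
      apply: filterS2 (open_nbhs_nbhs (conj oD Dz)) (lc z Dz) => w Dw fw.
      by split=> //; rewrite fw.
    by apply/seteqP; split=> [z [Dz fz]|z [_ []]].
  - exists (~` [set z | D z /\ f z <> f x]).
      apply: open_closedC; rewrite openE => z [Dz fz]; rewrite /interior.
      apply: filterS2 (open_nbhs_nbhs (conj oD Dz)) (lc z Dz) => w Dw fw.
      by split=> //; rewrite fw.
    apply/seteqP; split=> [z [Dz fz]|z [Dz nz]].
      by split=> // -[].
    by split=> //; apply: contrapT => fz; apply: nz.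
by have [_ ->] : [set z | D z /\ f z = f x] y by rewrite e.
Qed.

Lemma cderiv0_const {n} {M : manifold R n} (gam : R^o -> M) (a b : R) :
  (forall s : R^o, a < s < b -> cderiv gam s 0) ->
  forall s t, a < s < b -> a < t < b -> gam s = gam t.
Proof.
move=> dg; apply: (locally_constant_connected (D := [set s : R^o | a < s < b])).
- rewrite (_ : [set _ | _] = [set` `]a, b[]); first exact: interval_open.
  by apply/seteqP; split=> s /=; rewrite in_itv.
- apply/connected_intervalP; apply/is_intervalPlt => s t /andP[as_ sb] /andP[at_ tb] z /andP[sz zt].
  by rewrite /= (lt_trans as_ sz) (lt_trans zt tb).
move=> s sab; pose k := pchart (gam s).
have : \forall t \near s, a < t < b /\ cdom k (gam t).
  have n1 : \forall t \near s, a < t < b.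
    have hs : (s : R) \in `]a, b[ by rewrite in_itv.
    by apply: filterS (near_in_itvoo hs) => t; rewrite in_itv.
  have n2 : \forall t \near s, cdom k (gam t).
    have [cg _] := dg s sab; apply: cg; apply: cdom_nbhs; exact: pchart_dom.
  exact: filterS2 n1 n2.
move=> /nbhs_ballP [r /= r0 hr].
have dk t : ball s r t -> is_derive t 1 (k \o gam : R^o -> _) 0.
  move=> /hr [tab kt]; have := cderiv_dfun (dg t tab) (mdiff_cfun (pchart_atlas _) kt).
  by rewrite /dfun derive0.
have dfk t : ball s r t -> differentiable (k \o gam : R^o -> _) t.
  by move=> /dk [d _]; exact/derivable1_diffP.
apply/nbhs_ballP; exists r => // t st.
have := derive0_const dfk _ st; rewrite /= => e.
rewrite -(cfunK (c := k) (x := gam t)); last by have [] := hr t st.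
rewrite e ?cfunK //; first exact: pchart_dom.
move=> t' v st'; have [_ dz] := dk t' st'.
have -> : v = v *: (1 : R^o) by exact/esym/mulr1.
by rewrite (derive_dirZ _ _ (dfk _ st')) dz scaler0.
Qed.

End LocalFlow.

(** * One-parameter subgroups and flows on Klein geometries *)

Section OneParameter.
Context {R : realType} {d : nat} (G : lie_group R d).

Lemma right_mul_diff (g h : G) : map_diff (fun k : G => lmul k g) h.
Proof. exact: smooth_map2_diffl (lmul_smooth G) h g. Qed.

(** The field at y is the partial derivative of the multiplication at (1, y) in the direction (xi,
    0), and the multiplication is jointly smooth. Class C^1 provides the Lipschitz bound for the
    Picard iteration. *)
Lemma right_invariant_chart_C1 (xi : 'rV[R]_d) (c := pchart (lone G)) :
  Ck 1 (c @` cdom c) (vrep c (right_invariant xi)).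
Proof.
have ac : atlas G c by exact: pchart_atlas.
have c1 : cdom c (lone G) by exact: pchart_dom.
pose e0 := c (lone G).
pose rep (z : 'rV[R]_d * 'rV[R]_d) := c (lmul (cinv c z.1) (cinv c z.2)).
pose Om := [set z : 'rV[R]_d * 'rV[R]_d |
  [/\ (c @` cdom c) z.1, (c @` cdom c) z.2 & cdom c (lmul (cinv c z.1) (cinv c z.2))]].
have srep k : Ck k Om rep by exact: (lmul_smooth G).2.
have Ome y : (c @` cdom c) y -> Om (e0, y).
  move=> [g cg <-]; split=> /=; [by exists (lone G)|by exists g|].
  by rewrite !cfunK // lmul1.
have dpr (y : 'rV[R]_d) : is_diff y (fun y : 'rV[R]_d => (e0, y)) (fun v => (0, v)).
  exact: is_diff_pair.
pose V y := 'D_(xi, 0) rep (e0, y).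
have VE y : (c @` cdom c) y -> V y = vrep c (right_invariant xi) y.
  move=> [g cg <-]; rewrite /vrep cfunK // /right_invariant.
  have dR := right_mul_diff g (lone G).
  have dc : mdiff c (lmul (lone G) g) by rewrite lmul1; exact: mdiff_cfun.
  have [_] := comp_dfun xi dR dc; rewrite lmul1 => <-.
  have dl : is_diff e0 (fun y : 'rV[R]_d => (y, c g)) (fun v => (v, 0)).
    exact: is_diff_pair.
  have dl1 : differentiable (fun y : 'rV[R]_d => (y, c g)) e0 by case: dl.
  have drep : differentiable rep (e0, c g) by apply: (srep 1%N).1; apply: Ome; exists g.
  have := derive_chain xi dl1 drep; rewrite (deriveE _ dl1) diff_val => e.
  rewrite /V -e /dfun -/c -/e0.
  have -> : rep \o (fun y => (y, c g)) = (c \o (fun k : G => lmul k g)) \o cinv c.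
    by apply/funext => z; rewrite /rep /= cfunK.
  by [].
have oA : open (c @` cdom c) by exact: ccod_open.
have D1 : Ck 1 Om (fun z => 'D_(xi, 0) rep z) by exact: (srep 2%N).2.
have dV y w : (c @` cdom c) y -> differentiable V y /\
    'D_w V y = 'D_(0, w) (fun z => 'D_(xi, 0) rep z) (e0, y).
  move=> /Ome Oy; have dy1 : differentiable (fun y : 'rV[R]_d => (e0, y)) y.
    by case: (dpr y).
  have dz : differentiable (fun z => 'D_(xi, 0) rep z) (e0, y) by exact: D1.1.
  split; first exact: (differentiable_comp dy1 dz).
  have := derive_chain w dy1 dz; rewrite (deriveE _ dy1) => ->.
  by have := dpr y => dp; rewrite diff_val.
have : Ck 1 (c @` cdom c) V.
  split=> [y cy|w]; first by have [] := dV y 0 cy.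
  apply: (Ck_open_ext (f := fun y => 'D_(0, w) (fun z => 'D_(xi, 0) rep z) (e0, y)) oA).
    by move=> y cy; have [_ ->] := dV y w cy.
  move=> y cy; apply: (@continuous_comp _ _ _ (fun y => (e0, y))
      (fun z => 'D_(0, w) (fun z => 'D_(xi, 0) rep z) z)).
    exact: continuous_pairr.
  by apply: (D1.2 (0, w)); exact: Ome.
exact: Ck_open_ext.
Qed.

Lemma local_one_parameter (xi : 'rV[R]_d) :
  exists (e : R) (g : R^o -> G), [/\ 0 < e, g 0 = lone G &
    forall s : R^o, `|s| < e -> cderiv g s (right_invariant xi (g s))].
Proof.
pose c := pchart (lone G).
have ac : atlas G c by exact: pchart_atlas.
have c1 : cdom c (lone G) by exact: pchart_dom.
have oA : open (c @` cdom c) by exact: ccod_open.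
have Ae : (c @` cdom c) (c (lone G)) by exists (lone G).
pose v := vrep c (right_invariant xi); pose e0 := c (lone G).
have [r [K [r0 K0 rA vK]]] :=
  C1_locally_lipschitz oA Ae (right_invariant_chart_C1 xi).
(* Composing with the retraction [cl] onto a small box turns the field into a
   globally Lipschitz one. *)
pose cl (y : 'rV[R]_d) : 'rV[R]_d :=
  \row_i clamp (e0 0 i - r) (e0 0 i + r) (y 0 i).
have clr y : `|cl y - e0| <= r.
  apply: mx_norm_le => [|i j]; first exact: ltW.
  rewrite (ord1 i) !mxE; have /andP[h1 h2] := clamp_in (a := e0 0 j - r)
    (b := e0 0 j + r) (y 0 j) ltac:(lra).
  by rewrite ler_norml; apply/andP; split; lra.
have cll y z : `|cl y - cl z| <= `|y - z|.
  apply: mx_norm_le => [//|i j]; rewrite (ord1 i) !mxE.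
  apply: le_trans (clamp_lipschitz _ _ _ _) _.
  by have := le_mx_norm (y - z) 0 j; rewrite !mxE.
have cl_id y : `|y - e0| <= r -> cl y = y.
  move=> yr; apply/rowP => i; rewrite mxE clamp_id //.
  have := le_trans (le_mx_norm (y - e0) 0 i) yr; rewrite !mxE ler_norml.
  by move=> /andP[h1 h2]; apply/andP; split; lra.
have wK y z : `|v (cl y) - v (cl z)| <= K * `|y - z|.
  by apply: le_trans (vK _ _ (clr y) (clr z)) _; rewrite ler_wpM2l.
(* The summand 1 makes the bound strictly positive, as [picard_global] requires. *)
have wB y : `|v (cl y)| <= `|v e0| + K * r + 1.
  have := vK _ _ (clr y) (_ : `|e0 - e0| <= r).
  rewrite subrr normr0 => /(_ (ltW r0)) h.
  have h1 : K * `|cl y - e0| <= K * r by rewrite ler_wpM2l.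
  have := ler_normD (v (cl y) - v e0) (v e0); rewrite subrK => h2.
  by move: h h1 h2; clear; lra.
have B0 : 0 < `|v e0| + K * r + 1 by rewrite ltr_wpDl // addr_ge0 // mulr_ge0 // ltW.
have [e [u [ep u0 hu]]] := picard_global e0 r0 K0 B0 wK wB.
exists e, (fun s => cinv c (u s)); split=> //; first by rewrite u0 cfunK.
move=> s se; have [ur du] := hu s se.
have [g cg gE] : (c @` cdom c) (u s) by exact: rA.
have gsE : cinv c (u s) = g by rewrite -gE cfunK.
have cu : {for s, continuous (u : R^o -> 'rV[R]_d)}.
  apply: differentiable_continuous; apply/derivable1_diffP; by case: du.
have cgs : {for s, continuous (fun s : R^o => cinv c (u s))}.
  apply: continuous_comp; first exact: cu.
  by apply: cinv_cont; exists g.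
have dcu : is_derive s 1 (c \o (fun s => cinv c (u s)) : R^o -> 'rV[R]_d) (v (u s)).
  rewrite (cl_id _ ur) in du; apply: near_eq_is_derive du.
  have : nbhs s ((u : R^o -> 'rV[R]_d) @^-1` (c @` cdom c)).
    by apply: cu; apply: open_nbhs_nbhs; split=> //; exists g.
  by apply: filterS => t /= [k ck <-]; rewrite cfunK.
have := cderiv_of_chart ac _ cgs dcu; rewrite gsE => /(_ cg).
suff -> : right_invariant xi g = 'D_(v (u s)) (pchart g \o cinv c) (c g) by [].
rewrite -[LHS](dfun_pchart g).
rewrite (dfun_chart _ ac cg); last exact/mdiff_cfun/pchart_dom/pchart_atlas.
by rewrite /v /vrep gsE.
Qed.

(** * Integral curves of the generators of an action *)

Section Action.
Context {n : nat} {M : manifold R n} (act : G -> M -> M).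
Hypothesis hact : klein_geometry act.

Let act1 m : act (lone G) m = m. Proof. by case: hact. Qed.
Let actM g h m : act (lmul g h) m = act g (act h m). Proof. by case: hact. Qed.
Let actS : smooth_map2 act. Proof. by case: hact. Qed.

Lemma actVK g m : act (linv g) (act g m) = m.
Proof. by rewrite -actM lmulV act1. Qed.

(** The group axioms are one-sided. They give [r1], that is (h^-1)^-1 . 1 = h, and writing 1 as 1 .
    1 removes the trailing unit. *)
Lemma linv_inv (g : G) : linv (linv g) = g.
Proof.
have r1 (h : G) : lmul (linv (linv h)) (lone G) = h.
  by rewrite -(lmulV h) lmulA lmulV lmul1.
rewrite -[RHS](r1 g) -{1}(r1 (linv (linv g))) -{1}(lmul1 (lone G)) lmulA.
by rewrite r1.
Qed.

Lemma actKV g m : act g (act (linv g) m) = m.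
Proof. by rewrite -{1}(linv_inv g) actVK. Qed.

(** Differentiates (h g) . m = h . (g . m) at h = 1: the orbit map of m carries the right-invariant
    field of xi to its generator on M. *)
Lemma dagger_translate xi (g : G) m :
  tmap (fun h : G => act h m) g (right_invariant xi g) = dagger act xi (act g m).
Proof.
have dR := right_mul_diff g (lone G).
have dA h : map_diff (fun h : G => act h m) h by exact: smooth_map2_diffl.
have [_] := comp_tmap xi dR (dA _).
have -> : (fun h : G => act h m) \o (fun h : G => lmul h g) =
    fun h => act h (act g m) by apply/funext => h /=; rewrite actM.
by rewrite /= lmul1 => <-.
Qed.

Lemma tmap_act_inj g m u : tmap (act g) m u = 0 -> u = 0.
Proof.
move=> e0; have dA h x : map_diff (act h) x by exact: smooth_map2_diffr.
have [_] := comp_tmap u (dA g m) (dA (linv g) (act g m)).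
rewrite e0 (_ : act (linv g) \o act g = id); last first.
  by apply/funext => x /=; rewrite actVK.
by rewrite tmap_id => ->; rewrite /tmap /dfun derive0.
Qed.

Lemma one_parameter_flow xi e (g : R^o -> G) :
  g 0 = lone G ->
  (forall s : R^o, `|s| < e -> cderiv g s (right_invariant xi (g s))) ->
  forall (m : R^o -> M) (a b : R), (forall s : R^o, a < s < b ->
    cderiv m s (dagger act xi (m s))) ->
  forall s h, a < s < b -> a < s + h < b -> `|h| < e -> m (s + h) = act (g h) (m s).
Proof.
move=> g0 dg m a b dm s h sab shab he.
have e0 : 0 < e by apply: le_lt_trans he.
(* [c] has zero velocity: differentiating g(t) c(t) = m(s + t), the term coming
   from g already accounts for the velocity of m. *)
pose c (t : R^o) := act (linv (g t)) (m (s + t)).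
pose a' := Num.max (- e) (a - s); pose b' := Num.min e (b - s).
have inJ t : (a' < t < b') = (`|t| < e) && (a < s + t < b).
  rewrite /a' /b' gt_max lt_min ltr_norml ltrBlDl ltrBrDl.
  by case: (- e < t); case: (a < s + t); case: (t < e); case: (s + t < b).
have dms (t : R^o) : a < s + t < b ->
    cderiv (fun t : R^o => m (s + t)) t (dagger act xi (m (s + t))).
  move=> /dm [cm dmt]; have ds : is_derive t 1 (fun t : R^o => s + t) (1 : R^o).
    by have := is_deriveD (is_derive_cst (s : R^o) t 1) (is_derive_id t (1 : R^o)); rewrite add0r.
  split.
    apply: (@continuous_comp _ _ _ (fun t : R^o => s + t) m) => //.
    by apply: differentiable_continuous; apply/derivable1_diffP; case: ds.
  have dd : differentiable (pchart (m (s + t)) \o m : R^o -> _) (s + t).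
    by apply/derivable1_diffP; case: dmt.
  have := is_derive_curve ds dd.
  by have [_ ->] := dmt.
have dc (t : R^o) : a' < t < b' -> cderiv c t 0.
  rewrite inJ => /andP[te tab].
  have dgi : cderiv (fun t => linv (g t)) t (tmap (@linv _ _ G) (g t)
      (right_invariant xi (g t))).
    by apply: cderiv_map (dg _ te) _; exact: smooth_map_on_diff (linv_smooth G) _.
  have dct := cderiv_map2 actS dgi (dms t tab).
  have := cderiv_map2 actS (dg _ te) dct.
  have -> : (fun t => act (g t) (act (linv (g t)) (m (s + t)))) = fun t => m (s + t).
    by apply/funext => t'; rewrite actKV.
  move=> h1; have h2 := dms t tab; have := cderiv_unique h1 h2.
  rewrite dagger_translate actKV => /eqP; rewrite -subr_eq0 addrAC subrr add0r => /eqP.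
  by move=> /tmap_act_inj z0; move: dct; rewrite z0.
have c0 : a' < 0 < b' by rewrite inJ normr0 e0 addr0.
have ch : a' < h < b' by rewrite inJ he.
have := cderiv0_const dc c0 ch; rewrite /c g0 addr0 => e1.
rewrite -[LHS](actKV (g h)) -e1; congr (act (g h) _).
by rewrite -{1}(act1 (m s)) actVK.
Qed.

(* The curve g only exists near 0, but independently of m, so that the
   translation for the time t is the N-th power of g (t / N), N large. *)
Lemma flow_is_translation xi (t : R) : exists k : G,
  forall (m : R^o -> M) (a b : R), a < 0 < b -> a < t < b ->
  (forall s : R^o, a < s < b -> cderiv m s (dagger act xi (m s))) ->
  m t = act k (m 0).
Proof.
have [e [g [e0 g0 dg]]] := local_one_parameter xi.
have [N [N0 hN]] : exists N : nat, (0 < N)%N /\ `|t / N%:R| < e.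
  exists (Num.trunc (`|t| / e)).+1; split=> //.
  rewrite normrM normfV normr_nat ltr_pdivrMr // mulrC -ltr_pdivrMr //.
  exact: truncnS_gt.
have NR : N%:R != 0 :> R by rewrite pnatr_eq0 -lt0n.
exists (iter N (lmul (g (t / N%:R))) (lone G)) => m a b ab0 abt dm.
have inab k : (k <= N)%N -> a < t * (k%:R / N%:R) < b.
  move=> kN; have k1 : 0 <= (k%:R / N%:R : R) <= 1.
    apply/andP; split; first by apply: divr_ge0; exact: ler0n.
    by rewrite ler_pdivrMr ?ltr0n // mul1r ler_nat.
  move: k1 ab0 abt; set q := _ / _ => /andP[q0 q1] /andP[a0 b0] /andP[at_ tb].
  have [t0|/ltW t0] := leP 0 t.
    have h1 : 0 <= t * q by exact: mulr_ge0.
    have h2 : t * q <= t by exact: ler_piMr.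
    apply/andP; split; lra.
  have h1 : t * q <= 0 by exact: mulr_le0_ge0.
  have h2 : t <= t * q by exact: ler_niMr.
  apply/andP; split; lra.
have key k : (k <= N)%N -> m (t * (k%:R / N%:R)) =
    act (iter k (lmul (g (t / N%:R))) (lone G)) (m 0).
  elim: k => [|k IH] kN; first by rewrite mul0r mulr0 act1.
  have e1 : t * (k.+1%:R / N%:R) = t * (k%:R / N%:R) + t / N%:R.
    by rewrite -natr1 mulrDl mulrDr mul1r.
  rewrite e1 (one_parameter_flow g0 dg dm) //; last 2 first.
  - by apply: inab; exact: ltnW.
  - by rewrite -e1; exact: inab.
  by rewrite /= actM IH // ltnW.
by have := key N (leqnn N); rewrite divff // mulr1.
Qed.

End Action.
End OneParameter.

(** * Families of subspaces *)

Section MatrixProductRule.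
Context {R : realType} {V : normedModType R}.

Lemma differentiable_mulmx m n l (f : V -> 'M[R]_(m, n)) (g : V -> 'M[R]_(n, l)) x :
  differentiable f x -> differentiable g x ->
  differentiable (fun y => f y *m g y) x.
Proof.
move=> df dg; apply: differentiable_mx => i j.
rewrite (_ : (fun y => _) = fun y => \sum_k f y i k * g y k j : R^o).
  apply: (@differentiable_bigsum _ _ R^o) => k.
  by apply: differentiableM; exact: differentiable_mx_coord.
by apply/funext => y; rewrite mxE.
Qed.

Lemma derive_mulmx m n l (f : V -> 'M[R]_(m, n)) (g : V -> 'M[R]_(n, l)) x v :
  differentiable f x -> differentiable g x ->
  'D_v (fun y => f y *m g y) x = 'D_v f x *m g x + f x *m 'D_v g x.
Proof.
move=> df dg; apply/matrixP => i j.
rewrite derive_mxE; last exact/diff_derivable/differentiable_mulmx.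
have df' k : derivable (fun y => f y i k : R^o) x v.
  exact/diff_derivable/differentiable_mx_coord.
have dg' k : derivable (fun y => g y k j : R^o) x v.
  exact/diff_derivable/differentiable_mx_coord.
have -> : (fun y => (f y *m g y) i j : R^o) =
    \sum_k ((fun y => f y i k : R^o) * (fun y => g y k j : R^o)).
  by apply/funext => y; rewrite mxE fct_sumE.
rewrite derive_sum; last by move=> k; exact: derivableM.
rewrite !mxE -big_split; apply: eq_bigr => k _ /=.
rewrite (deriveM (df' k) (dg' k)) -!derive_mxE; try exact/diff_derivable.
by rewrite addrC; congr (_ + _); exact: mulrC.
Qed.

End MatrixProductRule.

Section ParallelSubspaces.
Context {R : realType} {p : nat} {S : manifold R p}.

Lemma dfun0_locally_constant m n (h : S -> 'M[R]_(m, n)) (U : set S) : open U ->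
  (forall x, U x -> mdiff h x) -> (forall x u, U x -> dfun h x u = 0) ->
  forall x, U x -> \forall y \near x, h y = h x.
Proof.
move=> oU dh h0 x Ux; pose c := pchart x.
have ac : atlas S c by exact: pchart_atlas.
have cx : cdom c x by exact: pchart_dom.
have : nbhs (c x) (c @` (cdom c `&` U)).
  by apply: open_nbhs_nbhs; split; [exact: chart_img_open|exists x].
move=> /nbhs_ballP [r /= r0 hr].
have dhc y : ball (c x) r y -> differentiable (h \o cinv c) y.
  by move=> /hr [z [cz Uz] <-]; apply/(mdiff_chart h ac cz)/dh.
(* The hypothesis at z is expressed in [pchart z], which changes with z; the transition map carries
   the vanishing over to the fixed chart c. *)
have dhc0 y v : ball (c x) r y -> 'D_v (h \o cinv c) y = 0.
  move=> /hr [z [cz Uz] <-].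
  have pz := pchart_dom z; have az := pchart_atlas z.
  have dt := transition_diff ac az cz pz.
  have dhz : differentiable (h \o cinv (pchart z)) ((pchart z \o cinv c) (c z)).
    by rewrite /= cfunK //; exact: dh.
  have := derive_chain v dt dhz.
  rewrite [X in _ = 'D__ _ X]/= cfunK // => e.
  apply: etrans (etrans e (h0 z _ Uz)).
  apply: near_eq_derive.
  by apply: filterS (near_chart_comp h pz cz) => w ->.
have := derive0_const dhc dhc0 => hc.
have n1 : \forall y \near x, ball (c x) r (c y).
  apply: (cfun_cont cx).
  by apply: open_nbhs_nbhs; split; [exact: ball_open|exact: ballxx].
apply: filterS2 n1 (cdom_nbhs cx) => y yr cy.
by have := hc _ yr; rewrite /= !cfunK.
Qed.

Lemma vspace_row_space d q (W : {vspace 'rV[R]_d}) : \dim W = q ->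
  exists2 L : 'M[R]_(q, d), row_free L &
    forall v, v \in W <-> exists c : 'rV_q, v = c *m L.
Proof.
move=> <-; pose L : 'M[R]_(\dim W, d) := \matrix_i tnth (vbasis W) i.
have LE (c : 'rV_(\dim W)) : c *m L = \sum_i c 0 i *: (vbasis W)`_i.
  by rewrite mulmx_sum_row; apply: eq_bigr => i _; rewrite rowK (tnth_nth 0).
exists L => [|v].
  apply/row_freeP; exists (pinvmx L); apply: mulmxVp.
  rewrite -kermx_eq0; apply/eqP/row_matrixP => i; rewrite row0.
  have : row i (kermx L) *m L = 0 by rewrite -row_mul mulmx_ker row0.
  rewrite LE => e; apply/rowP => j; rewrite [RHS]mxE.
  have /freeP := basis_free (vbasisP W); apply; exact: e.
split=> [vW|[c ->]].
  exists (\row_i coord (vbasis W) i v); rewrite LE [LHS](coord_vbasis vW).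
  by apply: eq_bigr => i _; rewrite mxE.
rewrite LE memv_suml // => i _; rewrite memvZ // vbasis_mem //.
by rewrite mem_nth // size_tuple.
Qed.

(* Near [x0], [L y] is the frame of [F y] normalized by [L y *m P = 1]. Any tuple
   Z of sections of F satisfies Z = (Z P) L; if Z y = L y and dZ takes its values
   in F y, that is dZ = C L, then differentiation gives C L = C L P L + dL, whence
   dL = 0. *)
Theorem stable_subspaces_locally_constant d (F : S -> set 'rV[R]_d) :
  constant_rank F -> (forall x, F x `<=` next_filtration F x) ->
  forall x, \forall y \near x, F y = F x.
Proof.
move=> [q hq] hF x0.
have /choice[L_ hL] : forall x, exists L : 'M[R]_(q, d), row_free L /\
    forall v, F x v <-> exists c : 'rV_q, v = c *m L.
  move=> x; have [W [dW ->]] := hq x; have [L fL WL] := vspace_row_space dW.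
  by exists L.
(* The q sections extending the rows of T are stacked into one matrix; rows lying in F y are then
   expressed by a left factor C of [L_ y]. *)
have sections (x : S) (T : 'M[R]_(q, d)) : (forall i, F x (row i T)) ->
    exists Z : S -> 'M[R]_(q, d), [/\ smooth_fun Z, Z x = T,
      (forall y, exists C : 'M[R]_q, Z y = C *m L_ y) &
      (forall u, exists C : 'M[R]_q, dfun Z x u = C *m L_ x)].
  move=> hT.
  have /choice[X hX] : forall i, exists X : S -> 'rV[R]_d,
      [/\ smooth_fun X, forall y, F y (X y),
        forall u : 'rV[R]_p, F x (dfun X x u) & row i T = X x].
    by move=> i; exact: hF (hT i).
  pose Z y : 'M[R]_(q, d) := \matrix_i X i y.
  have sZ : smooth_fun Z.
    apply: (smooth_mx openT) => i j.
    have [sX _ _ _] := hX i; have := smooth_mxE 0 j openT sX.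
    by apply: smooth_fun_on_ext openT _ => y _; rewrite mxE.
  have mem (y : S) (B : 'M[R]_(q, d)) : (forall i, F y (row i B)) ->
      exists C : 'M[R]_q, B = C *m L_ y.
    move=> hB; have /choice[c hc] : forall i, exists c : 'rV[R]_q,
        row i B = c *m L_ y by move=> i; apply/(hL y).2.
    exists (\matrix_i c i); apply/row_matrixP => i.
    by rewrite row_mul rowK.
  exists Z; split=> //.
  - by apply/row_matrixP => i; rewrite rowK; have [] := hX i.
  - by move=> y; apply: mem => i; rewrite rowK; have [] := hX i.
  - move=> u; apply: mem => i.
    have dZ : mdiff Z x by exact: smooth_mdiff sZ I.
    have <- : dfun (fun y => row i (Z y)) x u = row i (dfun Z x u).
      exact: (dfun_lin (row i) u dZ).
    rewrite (_ : (fun y => _) = X i); first by have [] := hX i.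
    by apply/funext => y; rewrite rowK.
have rowF x i : F x (row i (L_ x)).
  by apply/(hL x).2; exists (delta_mx 0 i); rewrite rowE.
have [X [sX X0 XL _]] := sections x0 (L_ x0) (rowF x0).
(* A right inverse of [L_ x0], so that N is the identity at x0 and invertible nearby. *)
pose P := pinvmx (L_ x0); pose N y := X y *m P.
have sN : smooth_fun N by apply: smooth_mulmx openT sX (smooth_cst _ _).
have N0 : N x0 \in unitmx by rewrite /N X0 mulmxVp ?unitmx1 //; have [] := hL x0.
have nN : nbhs x0 [set y | N y \in unitmx] by exact: (near_unitmx openT sN).
move: nN; rewrite nbhsE => -[U [oU Ux0] uU].
pose L y := invmx (N y) *m X y.
have sL : smooth_fun_on U L.
  apply: smooth_mulmx => //; last exact: smooth_fun_on_sub sX.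
  by apply: smooth_invmx => //; exact: smooth_fun_on_sub sN.
have LP y : U y -> L y *m P = 1%:M.
  by move=> /uU Uy; rewrite /L -mulmxA -/(N y) mulVmx.
(* The square factor T is invertible because T ([L_ y] P) = [L y] P = 1; thus [L y] is again a basis
   of F y. *)
have LL y : U y -> exists2 T : 'M[R]_q, T \in unitmx & L y = T *m L_ y.
  move=> Uy; have [C XC] := XL y; exists (invmx (N y) *m C).
    have := LP y Uy; rewrite /L XC [invmx _ *m (C *m _)]mulmxA -mulmxA.
    by move=> /mulmx1_unit[].
  by rewrite /L XC mulmxA.
have FL y v : U y -> F y v <-> exists c : 'rV_q, v = c *m L y.
  move=> Uy; have [T uT ->] := LL y Uy; split.
    move=> /(hL y).2 [c ->]; exists (c *m invmx T).
    by rewrite mulmxA mulmxKV.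
  by move=> [c ->]; apply/(hL y).2; exists (c *m T); rewrite mulmxA.
have dL y u : U y -> dfun L y u = 0.
  move=> Uy.
  have [|Z [sZ Zy ZL dZ]] := sections y (L y).
    by move=> i; apply/(FL y _ Uy); exists (delta_mx 0 i); rewrite rowE.
  have mL : mdiff L y by exact: smooth_mdiff sL Uy.
  have mZ : mdiff Z y by exact: smooth_mdiff sZ I.
  have e : \forall z \near y, Z z = Z z *m P *m L z.
    apply: filterS (open_nbhs_nbhs (conj oU Uy)) => z Uz.
    have [C ->] := ZL z; have [T uT LT] := LL z Uz.
    have -> : C *m L_ z = C *m invmx T *m L z by rewrite LT mulmxA mulmxKV.
    by rewrite -(mulmxA _ (L z)) LP // mulmx1.
  have mZP : mdiff (fun z => Z z *m P) y.
    by apply: differentiable_mulmx mZ _; exact: differentiable_cst.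
  have dZP : dfun (fun z => Z z *m P) y u = dfun Z y u *m P.
    have := derive_mulmx u mZ (differentiable_cst P (pchart y y)).
    by rewrite derive_cst mulmx0 addr0.
  have := dfun_near u e; rewrite [in RHS]/dfun.
  have -> := derive_mulmx u mZP mL.
  rewrite /= cfunK; last exact: pchart_dom.
  rewrite -/(dfun L y u) -/(dfun (fun z => Z z *m P) y u) dZP Zy LP // mul1mx.
  have [C dZC] := dZ u; have [T uT LT] := LL y Uy.
  have {}dZC : dfun Z y u = C *m invmx T *m L y by rewrite dZC LT mulmxA mulmxKV.
  rewrite dZC -(mulmxA _ (L y)) LP // mulmx1 => /esym/eqP.
  by rewrite -subr_eq0 addrAC subrr add0r => /eqP.
have := dfun0_locally_constant oU (fun y Uy => smooth_mdiff sL Uy) dL Ux0.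
move=> Lc; apply: filterS2 (open_nbhs_nbhs (conj oU Ux0)) Lc => y Uy Ly.
apply/seteqP; split=> v /FL h.
  by apply/FL => //; rewrite -Ly; exact: h.
by apply/FL => //; rewrite Ly; exact: h.
Qed.

End ParallelSubspaces.

(** * Sections of A as functions with values in g *)

Section SmoothSections.
Context {R : realType} {p r d : nat} {S : manifold R p}.
Variables (A : lie_algebroid S r) (om : forall x, 'Hom(A x, 'rV[R]_d)).
Hypothesis om_smooth : forall e, frames A e -> forall i : 'I_r,
  smooth_fun_on (fdom e) (fun x => om x (tnth (fvec e x) i)).
Hypothesis om_inj : forall x, injective (om x).

Lemma frame_expand (e : frame r A) x (a : A x) : fdom e x ->
  a = \sum_i coord (fvec e x) i a *: tnth (fvec e x) i.
Proof.
move=> ex; rewrite [LHS](coord_basis (fbasis ex) (memvf a)).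
by apply: eq_bigr => i _; rewrite (tnth_nth 0).
Qed.

Lemma smooth_sec_om (X : section A) :
  smooth_sec X -> smooth_fun (fun x => om x (X x)).
Proof.
move=> sX; apply: smooth_fun_on_local => x _.
have [e [fe ex]] := frames_cover A x; exists (fdom e) => //.
have oe := fdom_open e.
have s : smooth_fun_on (fdom e) (fun y =>
    \sum_i coord (fvec e y) i (X y) *: om y (tnth (fvec e y) i)).
  apply: smooth_sum => // i _; apply: smoothZ => //; last exact: om_smooth.
  by have := sX e fe i; rewrite setIT.
apply: smooth_fun_on_ext s => // y ey.
rewrite [in RHS](frame_expand (X y) ey) linear_sum.
by apply: eq_bigr => i _; rewrite linearZ.
Qed.

(** In a frame, [om] is a matrix [Om] with independent rows at x. For P a right inverse of [Om x],
    the product N = Om P is invertible near x, and the coordinates of X are (om X) P N^-1, a smooth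
    expression. *)
Lemma om_smooth_sec (X : section A) :
  smooth_fun (fun x => om x (X x)) -> smooth_sec X.
Proof.
move=> sX e fe i; rewrite setIT; have oe := fdom_open e.
apply: smooth_fun_on_local => x ex.
pose Om y : 'M[R]_(r, d) := \matrix_i om y (tnth (fvec e y) i).
have sOm : smooth_fun_on (fdom e) Om.
  apply: smooth_mx => // k l; have := smooth_mxE 0 l oe (om_smooth fe k).
  by apply: smooth_fun_on_ext => // y _; rewrite mxE.
pose a y : 'rV[R]_r := \row_k coord (fvec e y) k (X y).
have aE (b : 'rV[R]_r) y : b *m Om y = om y (\sum_k b 0 k *: tnth (fvec e y) k).
  rewrite mulmx_sum_row linear_sum; apply: eq_bigr => k _.
  by rewrite linearZ rowK.
have omX y : fdom e y -> om y (X y) = a y *m Om y.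
  move=> ey; rewrite aE [in LHS](frame_expand (X y) ey); congr (om y _).
  by apply: eq_bigr => k _; rewrite mxE.
have fOm : row_free (Om x).
  rewrite -kermx_eq0; apply/eqP/row_matrixP => k; rewrite row0.
  have : row k (kermx (Om x)) *m Om x = 0 by rewrite -row_mul mulmx_ker row0.
  rewrite aE -[RHS](linear0 (om x)) => /om_inj b0; apply/rowP => l.
  rewrite [RHS]mxE; have /freeP := basis_free (fbasis ex); apply.
  by rewrite -[RHS]b0; apply: eq_bigr => j _; rewrite (tnth_nth 0).
pose P := pinvmx (Om x); pose N y := Om y *m P.
have sN : smooth_fun_on (fdom e) N.
  by apply: smooth_mulmx => //; exact: smooth_cst.
have N1 : N x \in unitmx by rewrite /N mulmxVp ?unitmx1.
have nN : nbhs x [set y | N y \in unitmx] by exact: (near_unitmx oe sN).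
move: nN; rewrite nbhsE => -[U [oU Ux] uU].
exists (fdom e `&` U) => //; have oD : open (fdom e `&` U) by exact: openI.
have s : smooth_fun_on (fdom e `&` U) (fun y => om y (X y) *m P *m invmx (N y)).
  apply: smooth_mulmx => //.
    apply: smooth_mulmx => //; last exact: smooth_cst.
    exact: smooth_fun_on_sub sX.
  apply: smooth_invmx => //; first by move=> y [_ /uU].
  by apply: smooth_fun_on_sub sN => y [].
have := smooth_mxE 0 i oD s; apply: smooth_fun_on_ext => // y [ey Uy].
by rewrite omX // -(mulmxA _ (Om y)) -/(N y) mulmxK ?mxE //; exact: uU.
Qed.

Lemma smooth_asharp (X : section A) : smooth_sec X -> smooth_vfield (asharp X).
Proof.
move=> sX; apply: smooth_vfield_local => x _.
have [e [fe ex]] := frames_cover A x; exists (fdom e) => //.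
have oe := fdom_open e.
have s : smooth_vfield_on (fdom e) (fun y =>
    \sum_i coord (fvec e y) i (X y) *: anchor A y (tnth (fvec e y) i)).
  apply: smooth_vfield_sum => // i; apply: smooth_vfieldZ => //; last exact: anchor_smooth.
  by have := sX e fe i; rewrite setIT.
apply: smooth_vfield_ext s => // y ey.
rewrite /asharp [in RHS](frame_expand (X y) ey) linear_sum.
by apply: eq_bigr => i _; rewrite linearZ.
Qed.

Lemma om_invK x (a : A x) : (om x)^-1%VF (om x a) = a.
Proof. by rewrite lker0_lfunK //; apply/lker0P; exact: om_inj. Qed.

End SmoothSections.

(** * The subalgebroid of constant fibre W *)

Section ConstantSubbundle.
Context {R : realType} {d p r : nat} (G : lie_group R d) {S : manifold R p}.
Variables (A : lie_algebroid S r) (om : forall x, 'Hom(A x, 'rV[R]_d)).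
Hypothesis hform : algebroid_form G om.
Hypothesis om_inj : forall x, injective (om x).
(** W is the intersection of all fibres of A, seen in g through [om]; the two hypotheses on W are
    the two inclusions. *)
Variable W : {vspace 'rV[R]_d}.
Hypothesis W_range : forall v, v \in W -> forall x, range (om x) v.
Hypothesis W_max : forall v, (forall x, range (om x) v) -> v \in W.

Let om_smooth := hform.1.
Let om_abr := hform.2.

Lemma om_inv_on v x : v \in W -> om x ((om x)^-1%VF v) = v.
Proof. by move=> /W_range/(_ x)[a _ <-]; rewrite om_invK. Qed.

Definition lift_sec (h : S -> 'rV[R]_d) : section A := fun x => (om x)^-1%VF (h x).

Lemma om_lift h x : (forall y, h y \in W) -> om x (lift_sec h x) = h x.
Proof. by move=> hW; exact: om_inv_on. Qed.

Lemma lift_smooth h : (forall y, h y \in W) -> smooth_fun h ->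
  smooth_sec (lift_sec h).
Proof.
move=> hW sh; apply: (om_smooth_sec om_smooth om_inj).
by rewrite (_ : (fun x => _) = h) //; apply/funext => x; exact: om_lift.
Qed.

Lemma om_abr_lift h g x : (forall y, h y \in W) -> (forall y, g y \in W) ->
  smooth_fun h -> smooth_fun g ->
  om x (abr (lift_sec h) (lift_sec g) x) =
    dfun g x (asharp (lift_sec h) x) - dfun h x (asharp (lift_sec g) x) +
    lbr G (h x) (g x).
Proof.
move=> hW gW sh sg; rewrite om_abr; [|exact: lift_smooth..].
have e k : (forall y, k y \in W) -> (fun y => om y (lift_sec k y)) = k.
  by move=> kW; apply/funext => y; exact: om_lift.
by rewrite (om_lift x hW) (om_lift x gW) (e _ hW) (e _ gW).
Qed.

Lemma om_abr_const xi eta x : xi \in W -> eta \in W ->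
  om x (abr (lift_sec (fun=> xi)) (lift_sec (fun=> eta)) x) = lbr G xi eta.
Proof.
move=> xW eW; rewrite om_abr_lift //; [|exact: smooth_cst..].
by rewrite !dfun_cst subrr add0r.
Qed.

Lemma W_subalgebra : lie_subalgebra G W.
Proof.
move=> xi eta xW eW; apply: W_max => x.
by exists (abr (lift_sec (fun=> xi)) (lift_sec (fun=> eta)) x) => //; exact: om_abr_const.
Qed.

Lemma const_sharpE xi : const_sharp om xi = asharp (lift_sec (fun=> xi)).
Proof. by []. Qed.

Lemma const_sharp_smooth xi : xi \in W -> smooth_vfield (const_sharp om xi).
Proof.
by move=> xW; apply: smooth_asharp; apply: lift_smooth => //; exact: smooth_cst.
Qed.

Lemma const_sharp_action : infinitesimal_action G W (const_sharp om).
Proof.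
split=> [|||xi eta xW eW x]; first exact: W_subalgebra.
- exact: const_sharp_smooth.
- by move=> t xi eta _ _ x; rewrite /const_sharp !linearP.
rewrite !const_sharpE -anchor_abr; [|apply: lift_smooth => //; exact: smooth_cst..].
congr (anchor A x _); apply: (om_inj (x := x)).
by rewrite om_abr_const // om_lift // => _; exact: W_subalgebra.
Qed.

(** Projecting onto W leaves h unchanged, and a linear map commutes with the derivative. *)
Lemma dfun_in (h : S -> 'rV[R]_d) x u : (forall y, h y \in W) -> mdiff h x ->
  dfun h x u \in W.
Proof.
move=> hW dh.
have <- : dfun (fun y => projv W (h y)) x u = dfun h x u.
  by congr (dfun _ x u); apply/funext => y; rewrite projv_id.
pose L : {linear 'rV[R]_d -> 'rV[R]_d} := fun_of_lfun (projv W).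
by rewrite -[fun _ => _]/(fun y => L (h y)) (dfun_lin L u dh) memv_proj.
Qed.

(** The fibre is W as a vector space of its own, so that membership in W is carried by the type; q
    is its dimension in the form of the length of [vbasis fullv]. *)
Let F : vectType R := subvs_of W.
Let q := \dim (fullv : {vspace F}).

Let Bframe : frame q (fun _ : S => F) :=
  @Frame R p S q (fun=> F) setT (fun=> vbasis fullv) openT
    (fun x _ => vbasisP fullv).

Let Bcover x : exists e, [set Bframe] e /\ fdom e x.
Proof. by exists Bframe. Qed.

Let Bcompat e e' : [set Bframe] e -> [set Bframe] e' -> forall i j : 'I_q,
  smooth_fun_on (W := R^o) (fdom e `&` fdom e')
    (fun x => coord (fvec e x) i (tnth (fvec e' x) j)).
Proof. by move=> -> -> i j /=; exact: (@smooth_cst _ _ _ R^o). Qed.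

Definition const_bundle : vbundle S q := VBundle Bcover Bcompat.
Local Notation B := const_bundle.

Definition sec_val (X : section B) : S -> 'rV[R]_d := fun x => vsval (X x).

Lemma sec_val_in X x : sec_val X x \in W. Proof. exact: subvsP. Qed.

(** The global frame is constant, so coordinates in the frame and entries in g are linear
    combinations of each other with constant coefficients. *)
Lemma smooth_sec_val X : smooth_sec X <-> smooth_fun (sec_val X).
Proof.
split=> sX.
  pose b (i : 'I_q) : 'rV[R]_d := vsval (tnth (vbasis (fullv : {vspace F})) i).
  have s : smooth_fun_on setT (fun x => \sum_i coord (vbasis fullv) i (X x) *: b i).
    have := @smooth_sum R p S 'rV[R]_d setT 'I_q (index_enum 'I_q) xpredT
      (fun i x => coord (vbasis fullv) i (X x) *: b i) openT.
    apply => i _.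
    apply: smoothZ; [exact: openT| |exact: smooth_cst].
    by have := sX Bframe erefl i; rewrite setIT.
  apply: smooth_fun_on_ext openT _ s => x _.
  rewrite /sec_val [in RHS](coord_vbasis (memvf (X x))) linear_sum.
  by apply: eq_bigr => i _; rewrite /b linearZ (tnth_nth 0).
move=> _ -> i /=; rewrite setIT.
have s : smooth_fun_on (W := R^o) setT (fun x => \sum_j sec_val X x 0 j *
    coord (vbasis (fullv : {vspace F})) i (vsproj W (delta_mx 0 j))).
  apply: (@smooth_sum _ _ _ R^o) => [|j _]; first exact: openT.
  apply: (@smoothZ _ _ _ R^o); [exact: openT|exact: smooth_mxE openT sX|].
  exact: (@smooth_cst _ _ _ R^o).
apply: smooth_fun_on_ext openT _ s => x _.
rewrite -[X x in RHS]vsvalK [vsval (X x)]row_sum_delta !linear_sum.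
by apply: eq_bigr => j _; rewrite !linearZ.
Qed.

Definition const_incl x : 'Hom(F, A x) := ((om x)^-1 \o linfun vsval)%VF.

Lemma const_inclE x (b : F) : const_incl x b = (om x)^-1%VF (vsval b).
Proof. by rewrite /const_incl comp_lfunE lfunE. Qed.

Lemma om_incl x (b : F) : om x (const_incl x b) = vsval b.
Proof. by rewrite const_inclE om_inv_on // subvsP. Qed.

Definition incl_sec (X : section B) : section A := fun x => const_incl x (X x).

Lemma incl_secE X : incl_sec X = lift_sec (sec_val X).
Proof.
by apply: functional_extensionality_dep => x; rewrite /incl_sec const_inclE.
Qed.

Lemma incl_sec_smooth X : smooth_sec X -> smooth_sec (incl_sec X).
Proof.
move=> /smooth_sec_val sX; rewrite incl_secE; apply: lift_smooth => //.
exact: sec_val_in.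
Qed.

(* The bracket of A, transported: the algebroid axioms then come for free, without
   the bilinearity of the bracket on all of g or the Jacobi identity for it. *)
Definition const_abr (X Y : section B) : section B :=
  fun x => vsproj W (om x (abr (incl_sec X) (incl_sec Y) x)).

Lemma om_abr_incl X Y x : smooth_sec X -> smooth_sec Y ->
  om x (abr (incl_sec X) (incl_sec Y) x) =
    dfun (sec_val Y) x (asharp (incl_sec X) x) -
    dfun (sec_val X) x (asharp (incl_sec Y) x) + lbr G (sec_val X x) (sec_val Y x).
Proof.
move=> /smooth_sec_val sX /smooth_sec_val sY; rewrite !incl_secE.
by apply: om_abr_lift => // y; exact: sec_val_in.
Qed.

Lemma sec_val_abr X Y : smooth_sec X -> smooth_sec Y ->
  sec_val (const_abr X Y) = fun x => om x (abr (incl_sec X) (incl_sec Y) x).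
Proof.
move=> sX sY; apply/funext => x; rewrite /sec_val /const_abr vsprojK //.
rewrite om_abr_incl //; apply: rpredD; first apply: rpredB.
- apply: dfun_in; first exact: sec_val_in.
  by apply: smooth_mdiff; [exact/smooth_sec_val|].
- apply: dfun_in; first exact: sec_val_in.
  by apply: smooth_mdiff; [exact/smooth_sec_val|].
- by apply: W_subalgebra; exact: sec_val_in.
Qed.

Lemma incl_abr X Y x : smooth_sec X -> smooth_sec Y ->
  const_incl x (const_abr X Y x) = abr (incl_sec X) (incl_sec Y) x.
Proof.
move=> sX sY; apply: (om_inj (x := x)); rewrite om_incl.
by have /funeqP/(_ x) := sec_val_abr sX sY.
Qed.

Lemma incl_abr_sec X Y : smooth_sec X -> smooth_sec Y ->
  incl_sec (const_abr X Y) = abr (incl_sec X) (incl_sec Y).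
Proof.
move=> sX sY; apply: functional_extensionality_dep => x.
exact: incl_abr.
Qed.

Lemma const_incl_inj x : injective (const_incl x).
Proof.
move=> a b /(congr1 (om x)); rewrite !om_incl => ab; exact: val_inj.
Qed.

Definition const_anchor x : 'Hom(B x, 'rV[R]_p) := (anchor A x \o const_incl x)%VF.

Lemma const_anchorE x b : const_anchor x b = anchor A x (const_incl x b).
Proof. by rewrite comp_lfunE. Qed.

Lemma const_anchor_sec X :
  (fun x => const_anchor x (X x)) = asharp (incl_sec X).
Proof. by apply/funext => x; rewrite const_anchorE. Qed.

(** * The algebroid axioms, verified in A through the inclusion *)

Let Banchor_smooth e : frames B e -> forall i : 'I_q,
  smooth_vfield_on (fdom e) (fun x => const_anchor x (tnth (fvec e x) i)).
Proof.
move=> -> i /=; rewrite (const_anchor_sec (fun=> tnth (vbasis fullv) i)).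
apply: smooth_asharp; apply: incl_sec_smooth; apply/smooth_sec_val.
exact: smooth_cst.
Qed.

Let Babr_smooth X Y : smooth_sec X -> smooth_sec Y -> smooth_sec (const_abr X Y).
Proof.
move=> sX sY; apply/smooth_sec_val; rewrite sec_val_abr //.
apply: (smooth_sec_om om_smooth).
by apply: abr_smooth; exact: incl_sec_smooth.
Qed.

Lemma incl_secP t X Y :
  incl_sec (fun y => t *: X y + Y y) = fun y => t *: incl_sec X y + incl_sec Y y.
Proof. by apply: functional_extensionality_dep => y; rewrite /incl_sec linearP. Qed.

Lemma incl_secZ (h : S -> R^o) X :
  incl_sec (fun y => h y *: X y) = fun y => h y *: incl_sec X y.
Proof. by apply: functional_extensionality_dep => y; rewrite /incl_sec linearZ. Qed.

Lemma smooth_secP (t : R) (X Y : section B) : smooth_sec X -> smooth_sec Y ->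
  smooth_sec (fun y => t *: X y + Y y).
Proof.
move=> /smooth_sec_val sX /smooth_sec_val sY; apply/smooth_sec_val.
have := smoothD openT (smoothZ openT (@smooth_cst _ _ _ R^o _ (t : R^o)) sX) sY.
by apply: smooth_fun_on_ext openT _.
Qed.

Lemma smooth_secZ (h : S -> R^o) (X : section B) : smooth_fun h -> smooth_sec X ->
  smooth_sec (fun y => h y *: X y).
Proof.
move=> sh /smooth_sec_val sX; apply/smooth_sec_val.
have := smoothZ openT sh sX.
by apply: smooth_fun_on_ext openT _.
Qed.

Let Babr_linear (t : R) X Y Z :
  smooth_sec X -> smooth_sec Y -> smooth_sec Z -> forall x,
  const_abr (fun y => t *: X y + Y y) Z x = t *: const_abr X Z x + const_abr Y Z x.
Proof.
move=> sX sY sZ x; apply: (const_incl_inj (x := x)); rewrite [RHS]linearP /=.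
rewrite !incl_abr //; last exact: smooth_secP.
by rewrite incl_secP abr_linear //; exact: incl_sec_smooth.
Qed.

Let Babr_anti X Y : smooth_sec X -> smooth_sec Y -> forall x,
  const_abr X Y x = - const_abr Y X x.
Proof.
move=> sX sY x; apply: (const_incl_inj (x := x)); rewrite [RHS]linearN /= !incl_abr //.
by apply: abr_anti; exact: incl_sec_smooth.
Qed.

Let Babr_jacobi X Y Z : smooth_sec X -> smooth_sec Y -> smooth_sec Z ->
  forall x, const_abr X (const_abr Y Z) x + const_abr Y (const_abr Z X) x +
    const_abr Z (const_abr X Y) x = 0.
Proof.
move=> sX sY sZ x; apply: (const_incl_inj (x := x)); rewrite !linearD linear0 /=.
rewrite !incl_abr //; try exact: Babr_smooth.
by rewrite !incl_abr_sec //; apply: abr_jacobi; exact: incl_sec_smooth.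
Qed.

Let Babr_leibniz (h : S -> R^o) X Y :
  smooth_fun h -> smooth_sec X -> smooth_sec Y -> forall x,
  const_abr X (fun y => h y *: Y y) x =
    h x *: const_abr X Y x + dfun h x (const_anchor x (X x)) *: Y x.
Proof.
move=> sh sX sY x; apply: (const_incl_inj (x := x)).
rewrite linearD !linearZ /= !incl_abr //; last exact: smooth_secZ.
rewrite incl_secZ (abr_leibniz sh (incl_sec_smooth sX) (incl_sec_smooth sY)).
by rewrite const_anchorE.
Qed.

Let Banchor_abr X Y : smooth_sec X -> smooth_sec Y -> forall x,
  const_anchor x (const_abr X Y x) =
    vbr (fun y => const_anchor y (X y)) (fun y => const_anchor y (Y y)) x.
Proof.
move=> sX sY x; rewrite const_anchorE incl_abr // !const_anchor_sec.
by apply: anchor_abr; exact: incl_sec_smooth.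
Qed.

Definition const_algebroid : lie_algebroid S q :=
  LieAlgebroid Banchor_smooth Babr_smooth Babr_linear Babr_anti Babr_jacobi
    Babr_leibniz Banchor_abr.

Lemma const_subalgebroid : subalgebroid (B := const_algebroid) const_incl.
Proof.
split.
- exact: const_incl_inj.
- move=> _ -> i /=.
  apply: (incl_sec_smooth (X := fun=> tnth (vbasis fullv) i)).
  by apply/smooth_sec_val; exact: smooth_cst.
- by move=> x b /=; rewrite const_anchorE.
- by move=> X Y sX sY x; exact: incl_abr.
Qed.

Lemma const_incl_range x :
  [set om x (const_incl x b) | b in [set: F]] = [set v | v \in W].
Proof.
apply/seteqP; split=> [_ [b _ <-]|v /= vW]; first by rewrite /= om_incl subvsP.
by exists (vsproj W v) => //; rewrite om_incl vsprojK.
Qed.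

(** For smooth X the derivative already lies in W, and [vsproj] changes its type only. *)
Definition const_nab (U : vfield S) (X : section B) : section B :=
  fun x => vsproj W (dfun (sec_val X) x (U x)).

Lemma sec_val_nab U X : smooth_sec X ->
  sec_val (const_nab U X) = fun x => dfun (sec_val X) x (U x).
Proof.
move=> /smooth_sec_val sX; apply/funext => x; rewrite /sec_val /const_nab vsprojK //.
apply: dfun_in; first exact: sec_val_in.
exact: smooth_mdiff sX I.
Qed.

Lemma om_const_nab U X x : smooth_sec X ->
  om x (const_incl x (const_nab U X x)) =
    dfun (fun y => om y (const_incl y (X y))) x (U x).
Proof.
move=> sX; rewrite om_incl.
have /funeqP/(_ x) := sec_val_nab U sX; rewrite /sec_val => ->.
have -> // : (fun y => om y (const_incl y (X y))) = sec_val X.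
by apply/funext => y; rewrite om_incl.
Qed.

End ConstantSubbundle.

(** * Leibniz rule for a bracket that is bilinear on W *)

Section BilinearRule.
Context {R : realType} {V : normedModType R} {m n l : nat}.
Variable beta : 'rV[R]_m -> 'rV[R]_n -> 'rV[R]_l.
Hypothesis beta_l : forall v, linear (beta ^~ v).
Hypothesis beta_r : forall u, linear (beta u).

Lemma derive_bilinear (f : V -> 'rV[R]_m) (g : V -> 'rV[R]_n) x v :
  differentiable f x -> differentiable g x ->
  differentiable (fun y => beta (f y) (g y)) x /\
  'D_v (fun y => beta (f y) (g y)) x =
    beta ('D_v f x) (g x) + beta (f x) ('D_v g x).
Proof.
move=> df dg.
pose br u : {linear 'rV[R]_n -> 'rV[R]_l} :=
  HB.pack (beta u) (GRing.isLinear.Build _ _ _ _ _ (beta_r u)).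
pose bl w : {linear 'rV[R]_m -> 'rV[R]_l} :=
  HB.pack (beta ^~ w) (GRing.isLinear.Build _ _ _ _ _ (beta_l w)).
have expand u w : beta u w = \sum_i u 0 i *: br (delta_mx 0 i) w.
  rewrite -[LHS]/(bl w u) [in LHS](row_sum_delta u) linear_sum.
  by apply: eq_bigr => i _; rewrite linearZ.
have df' i : differentiable (fun y => f y 0 i : R^o) x.
  exact: differentiable_mx_coord.
have dg' i : differentiable (fun y => br (delta_mx 0 i) (g y)) x.
  exact: (differentiable_comp dg (differentiable_linmx (br (delta_mx 0 i)) (g x))).
have ds i := is_diff_scaler_fun (df' i) (dg' i).
have -> : (fun y => beta (f y) (g y)) =
    \sum_i (fun y => f y 0 i *: br (delta_mx 0 i) (g y)).
  by apply/funext => y; rewrite expand fct_sumE.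
split; first by apply: differentiable_sum => i; case: (ds i).
rewrite derive_sum; last by move=> i; apply: diff_derivable; case: (ds i).
rewrite (expand ('D_v f x)) (expand (f x)) -big_split; apply: eq_bigr => i _ /=.
rewrite (derive_scaler_fun v (df' i) (dg' i)) addrC.
rewrite (derive_mxE 0 i (diff_derivable df : derivable f x v)); congr (_ + _).
by congr (_ *: _); exact: (derive_linmx (br (delta_mx 0 i)) v dg).
Qed.

End BilinearRule.

Section BilinearOnSubspace.
Context {R : realType} {d p : nat} {S : manifold R p} (W : {vspace 'rV[R]_d}).
Variable br : 'rV[R]_d -> 'rV[R]_d -> 'rV[R]_d.
Hypothesis br_linear : forall (t : R) xi xi' eta, xi \in W -> xi' \in W ->
  eta \in W -> br (t *: xi + xi') eta = t *: br xi eta + br xi' eta.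
Hypothesis br_anti : forall xi eta, xi \in W -> eta \in W -> br xi eta = - br eta xi.

(** Composing both arguments with the projection onto W extends [br] from W to a bilinear map on the
    whole space, with the same values on W; linearity in the second argument comes from
    antisymmetry. *)
Lemma dfun_bilinear_on (h g : S -> 'rV[R]_d) x u : (forall y, h y \in W) ->
  (forall y, g y \in W) -> mdiff h x -> mdiff g x ->
  mdiff (fun y => br (h y) (g y)) x /\
  dfun (fun y => br (h y) (g y)) x u = br (dfun h x u) (g x) + br (h x) (dfun g x u).
Proof.
move=> hW gW dh dg; pose beta v w := br (projv W v) (projv W w).
have beta_l w : linear (beta ^~ w).
  by move=> t v v'; rewrite /beta linearP br_linear // memv_proj.
have beta_r v : linear (beta v).
  move=> t w w'; rewrite /beta linearP br_anti ?rpredD ?rpredZ ?memv_proj //.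
  rewrite br_linear ?memv_proj // opprD -scalerN.
  by rewrite -!(br_anti (memv_proj W v)) ?memv_proj.
have bE v w : v \in W -> w \in W -> beta v w = br v w.
  by move=> vW wW; rewrite /beta !projv_id.
have [db e] := @derive_bilinear _ _ _ _ _ _ beta_l beta_r _ _ _ u dh dg.
have fE : (fun y => beta (h y) (g y)) = fun y => br (h y) (g y).
  by apply/funext => y; exact: bE.
have {}db : mdiff (fun y => beta (h y) (g y)) x by exact: db.
have {}e : dfun (fun y => beta (h y) (g y)) x u =
    beta (dfun h x u) (g (cinv (pchart x) (pchart x x))) +
    beta (h (cinv (pchart x) (pchart x x))) (dfun g x u) by exact: e.
rewrite fE in db e; split=> //.
rewrite e cfunK; last exact: pchart_dom.
by congr (_ + _); apply: bE => //; exact: dfun_in.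
Qed.

End BilinearOnSubspace.

(** * The flat Cartan connection *)

Section TwistedAction.
Context {R : realType} {d p r : nat} (G : lie_group R d) {S : manifold R p}.
Variables (A : lie_algebroid S r) (om : forall x, 'Hom(A x, 'rV[R]_d)).
Hypothesis hform : algebroid_form G om.
Hypothesis om_inj : forall x, injective (om x).
Variable W : {vspace 'rV[R]_d}.
Hypothesis W_range : forall v, v \in W -> forall x, range (om x) v.
Hypothesis W_max : forall v, (forall x, range (om x) v) -> v \in W.

Local Notation B := (const_algebroid hform om_inj W_range W_max).
Local Notation nab := (@const_nab R d p S W).
Local Notation lift := (lift_sec om).

Lemma lift_secP t (xi eta : 'rV[R]_d) :
  lift (fun=> t *: xi + eta) = fun y => t *: lift (fun=> xi) y + lift (fun=> eta) y.
Proof.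
by apply: functional_extensionality_dep => y; rewrite /lift_sec linearP.
Qed.

Lemma const_lift_smooth xi : xi \in W -> smooth_sec (lift (fun=> xi)).
Proof.
by move=> xW; apply: (lift_smooth hform om_inj W_range) => //; exact: smooth_cst.
Qed.

(** On constant sections the bracket of A takes the constant value [lbr], so linearity is inherited
    from A; x is the point at which the sections are evaluated. *)
Lemma lbr_linear (x : S) t xi xi' eta : xi \in W -> xi' \in W -> eta \in W ->
  lbr G (t *: xi + xi') eta = t *: lbr G xi eta + lbr G xi' eta.
Proof.
move=> xW x'W eW.
rewrite -!(om_abr_const hform om_inj W_range x) // ?rpredD ?rpredZ //.
rewrite lift_secP abr_linear; [|exact: const_lift_smooth..].
by rewrite linearP.
Qed.

Lemma lbr_anti (x : S) xi eta : xi \in W -> eta \in W ->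
  lbr G xi eta = - lbr G eta xi.
Proof.
move=> xW eW; rewrite -!(om_abr_const hform om_inj W_range x) //.
by rewrite abr_anti; [rewrite linearN|exact: const_lift_smooth..].
Qed.

Lemma dfun_lbr (h g : S -> 'rV[R]_d) x u : (forall y, h y \in W) ->
  (forall y, g y \in W) -> mdiff h x -> mdiff g x ->
  mdiff (fun y => lbr G (h y) (g y)) x /\
  dfun (fun y => lbr G (h y) (g y)) x u =
    lbr G (dfun h x u) (g x) + lbr G (h x) (dfun g x u).
Proof. exact: dfun_bilinear_on (lbr_linear x) (lbr_anti x) _ _ _ _. Qed.

Lemma nab_connection : is_connection (A := B) nab.
Proof.
have md X x : smooth_sec (A := B) X -> mdiff (sec_val X) x.
  by move=> /smooth_sec_val sX; exact: smooth_mdiff sX I.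
split=> [U X sU sX|h U V X sh sU sV sX x|U X Y sU sX sY x|h U X sh sU sX x].
- apply/smooth_sec_val; rewrite sec_val_nab //.
  by apply: (smooth_dfun openT) => //; exact/smooth_sec_val.
- by rewrite /const_nab dfun_dirD ?dfun_dirZ ?linearP //; exact: md.
- rewrite /const_nab -linearD; congr (vsproj W _).
  by rewrite -dfunD //; exact: md.
rewrite /const_nab; have dh := smooth_mdiff sh (I : setT x).
have -> : sec_val (fun y => h y *: X y) = fun y => h y *: sec_val X y.
  by apply/funext => y; rewrite /sec_val linearZ.
rewrite dfunZ //; last exact: md.
by rewrite linearD !linearZ /= /sec_val vsvalK.
Qed.

Lemma nab_flat : is_flat (A := B) nab.
Proof.
move=> U V X sU sV sX x; rewrite /const_nab -!linearB.
rewrite !sec_val_nab //.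
have /smooth_sec_val sX' := sX.
by rewrite dfun_flat // subrr linear0.
Qed.

Lemma vbr_anti (U V : vfield S) x : vbr U V x = - vbr V U x.
Proof. by rewrite /vbr opprB. Qed.

Local Notation sharp X := (asharp (A := A) (incl_sec om X)).

Lemma sec_val_abrE X Y : smooth_sec (A := B) X -> smooth_sec (A := B) Y ->
  sec_val (const_abr om X Y) = fun x =>
    dfun (sec_val Y) x (sharp X x) - dfun (sec_val X) x (sharp Y x) +
    lbr G (sec_val X x) (sec_val Y x).
Proof.
move=> sX sY; rewrite (sec_val_abr hform om_inj W_range W_max) //.
by apply/funext => x; exact: (om_abr_incl hform om_inj W_range).
Qed.

Lemma nab_smooth U X : smooth_vfield U -> smooth_sec (A := B) X ->
  smooth_sec (A := B) (nab U X).
Proof. by move=> sU sX; have [h _ _ _] := nab_connection; exact: h. Qed.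

Lemma sharp_smooth X : smooth_sec (A := B) X -> smooth_vfield (sharp X).
Proof.
move=> sX; apply: smooth_asharp.
exact: (incl_sec_smooth hform om_inj W_range).
Qed.

Lemma sec_val_mdiff X x : smooth_sec (A := B) X -> mdiff (sec_val X) x.
Proof. by move=> /smooth_sec_val sX; exact: smooth_mdiff sX I. Qed.

Lemma nab_sec_abr U X Y x : smooth_vfield U -> smooth_sec (A := B) X ->
  smooth_sec (A := B) Y ->
  sec_val (nab U (const_abr om X Y)) x =
    dfun (fun y => dfun (sec_val Y) y (sharp X y)) x (U x) -
    dfun (fun y => dfun (sec_val X) y (sharp Y y)) x (U x) +
    (lbr G (dfun (sec_val X) x (U x)) (sec_val Y x) +
     lbr G (sec_val X x) (dfun (sec_val Y) x (U x))).
Proof.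
move=> sU sX sY; have sXY : smooth_sec (A := B) (const_abr om X Y).
  exact: (abr_smooth (l := B)).
rewrite sec_val_nab // sec_val_abrE //.
have sd Z T : smooth_sec (A := B) Z -> smooth_vfield T ->
    mdiff (fun y => dfun (sec_val Z) y (T y)) x.
  move=> /smooth_sec_val sZ sT.
  exact: smooth_mdiff (smooth_dfun openT sZ sT) I.
have [dl el] := dfun_lbr (U x) (sec_val_in X) (sec_val_in Y)
  (sec_val_mdiff x sX) (sec_val_mdiff x sY).
have d1 := sd Y (sharp X) sY (sharp_smooth sX).
have d2 := sd X (sharp Y) sX (sharp_smooth sY).
have dN : mdiff (fun y => - dfun (sec_val X) y (sharp Y y)) x.
  exact: differentiableN d2.
have dB : mdiff (fun y => dfun (sec_val Y) y (sharp X y) -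
    dfun (sec_val X) y (sharp Y y)) x by exact: mdiffD d1 dN.
rewrite (dfunD _ dB dl) (dfunD _ d1 dN) el; congr (_ + _ + _).
by rewrite /dfun -deriveN //; exact: diff_derivable d2.
Qed.

(** Written in g, each bracket of sections is a difference of derivatives along anchors plus a
    pointwise bracket. The pointwise parts cancel by the Leibniz rule. The iterated derivatives
    cancel once U is exchanged with #X and #Y by flatness, and the resulting derivatives along
    [#X, U] and [#Y, U] are those contributed by [nab_bar]. *)
Lemma nab_cartan : is_cartan (A := B) nab.
Proof.
move=> X Y U sX sY sU x; apply: (@val_inj _ _ (subvs_of W)).
have snX := nab_smooth sU sX; have snY := nab_smooth sU sY.
have flat Z T : smooth_sec (A := B) Z -> smooth_vfield T ->
    dfun (fun y => dfun (sec_val Z) y (T y)) x (U x) =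
    dfun (fun y => dfun (sec_val Z) y (U y)) x (T x) - dfun (sec_val Z) x (vbr T U x).
  move=> sZ sT; have /smooth_sec_val sZ' := sZ.
  rewrite vbr_anti dfun_dirN; last exact: sec_val_mdiff.
  by rewrite opprK -(dfun_flat x sZ' sU sT) addrC subrK.
(* Here a1, a2, a3 stand for U(#X(Y)), #X(U(Y)) and [#X, U](Y), and b1, b2, b3 for the same with X
   and Y exchanged; c1, c2 are the pointwise brackets, and e1, e2 the derivatives of Y along #(nab U
   X) and of X along #(nab U Y). *)
have alg (a1 a2 a3 b1 b2 b3 c1 c2 e1 e2 : 'rV[R]_d) :
    a1 = a2 - a3 -> b1 = b2 - b3 ->
    (a1 - b1 + (c1 + c2)) - (e1 - b2 + c1) - (a2 - e2 + c2) + (e1 + a3) - (e2 + b3)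
    = 0.
  by move=> -> ->; apply/rowP => i; rewrite !mxE; ring.
have barE Z : asharp (A := B) (nab U Z) x = sharp (nab U Z) x.
  exact: const_anchorE.
have barX Z T : smooth_sec (A := B) Z -> smooth_sec (A := B) T ->
    vsval (nab (nab_bar (A := B) nab Z U) T x) =
    dfun (sec_val T) x (sharp (nab U Z) x) + dfun (sec_val T) x (vbr (sharp Z) U x).
  move=> sZ sT; rewrite -[LHS]/(sec_val (nab _ T) x) sec_val_nab // /nab_bar barE.
  rewrite dfun_dirD; last exact: sec_val_mdiff.
  by rewrite (_ : asharp (A := B) Z = sharp Z) //; exact: const_anchor_sec.
have split5 (a1 a2 a3 a4 a5 : subvs_of W) : vsval (a1 - a2 - a3 + a4 - a5) =
    vsval a1 - vsval a2 - vsval a3 + vsval a4 - vsval a5 by [].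
have comb (a1 a2 a3 a4 a5 b1 b2 b3 b4 b5 : 'rV[R]_d) : a1 = b1 -> a2 = b2 ->
    a3 = b3 -> a4 = b4 -> a5 = b5 ->
    a1 - a2 - a3 + a4 - a5 = b1 - b2 - b3 + b4 - b5.
  by move=> -> -> -> -> ->.
have abrE Z T : smooth_sec (A := B) Z -> smooth_sec (A := B) T ->
    vsval (const_abr om Z T x) = dfun (sec_val T) x (sharp Z x) -
      dfun (sec_val Z) x (sharp T x) + lbr G (sec_val Z x) (sec_val T x).
  by move=> sZ sT; have := sec_val_abrE sZ sT; move=> /(congr1 (@^~ x)).
have nabE Z : smooth_sec (A := B) Z ->
    sec_val (nab U Z) = fun y => dfun (sec_val Z) y (U y).
  exact: sec_val_nab.
have E1 := nab_sec_abr x sU sX sY.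
have E2 := abrE _ _ snX sY; rewrite (nabE X sX) in E2.
have E3 := abrE _ _ sX snY; rewrite (nabE Y sY) in E3.
have E4 := barX X Y sX sY; have E5 := barX Y X sY sX.
apply: etrans (split5 _ _ _ _ _) _.
apply: etrans (comb _ _ _ _ _ _ _ _ _ _ E1 E2 E3 E4 E5) _.
apply: alg.
  exact: flat sY (sharp_smooth sX).
exact: flat sX (sharp_smooth sY).
Qed.

Lemma const_twisted : twisted_action (A := B) nab.
Proof. by split; [exact: nab_connection|exact: nab_flat|exact: nab_cartan]. Qed.

End TwistedAction.

(** * The pseudogroup *)

Section PseudogroupTranslations.
Context {R : realType} {p : nat} {S : manifold R p}.

(** The topological content of [local_transf], enough to transport open neighbourhoods along phi and
    back. *)
Definition open_embedding_on (D : set S) (phi : S -> S) :=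
  [/\ open D, open (phi @` D), forall x, D x -> {for x, continuous phi} &
    exists psi : S -> S, (forall x, D x -> psi (phi x) = x) /\
      forall y, (phi @` D) y -> {for y, continuous psi}].

Lemma local_transf_embedding D phi : local_transf D phi -> open_embedding_on D phi.
Proof.
move=> [oD oi [cphi _] [psi [K [cpsi _]]]]; split=> //.
by exists psi.
Qed.

Lemma open_preimage_on D phi V : open_embedding_on D phi -> open V ->
  open (D `&` phi @^-1` V).
Proof.
move=> [oD _ cphi _] oV; rewrite openE => x [Dx Vx]; rewrite /interior.
have h : nbhs x (phi @^-1` V) by apply: (cphi x Dx); exact: open_nbhs_nbhs.
by apply: filterS2 (open_nbhs_nbhs (conj oD Dx)) h => y.
Qed.

Lemma open_image_on D phi V : open_embedding_on D phi -> open V -> V `<=` D ->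
  open (phi @` V).
Proof.
move=> [oD oi cphi [psi [K cpsi]]] oV VD; rewrite openE => _ [x Vx <-].
rewrite /interior; have Dx := VD _ Vx; have iy : (phi @` D) (phi x) by exists x.
have h : nbhs (phi x) (psi @^-1` V).
  by apply: (cpsi _ iy); rewrite K //; exact: open_nbhs_nbhs.
apply: filterS2 (open_nbhs_nbhs (conj oi iy)) h => _ [z Dz <-].
by rewrite /preimage /= K // => Vz; exists z.
Qed.

(* The induction principle generated by Rocq has no hypothesis for the nested
   occurrence in [pg_local]. *)
Lemma pseudogroup_nested_ind (gen : set S -> (S -> S) -> Prop)
    (P : set S -> (S -> S) -> Prop) :
  (forall D phi, gen D phi -> P D phi) -> P setT id ->
  (forall D phi D' psi, pseudogroup gen D phi -> P D phi ->
     pseudogroup gen D' psi -> P D' psi -> P (D `&` phi @^-1` D') (psi \o phi)) ->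
  (forall D phi psi, pseudogroup gen D phi -> P D phi ->
     (forall x, D x -> psi (phi x) = x) -> P (phi @` D) psi) ->
  (forall D phi, local_transf D phi ->
     (forall x, D x -> exists (D' W : set S) (phi' : S -> S),
        [/\ P D' phi', open W, W x, W `<=` D `&` D'
          & forall y, W y -> phi y = phi' y]) -> P D phi) ->
  forall D phi, pseudogroup gen D phi -> P D phi.
Proof.
move=> hgen hid hcomp hinv hloc; fix IH 3 => D phi [].
- exact: hgen.
- exact: hid.
- by move=> {}D {}phi D' psi h h'; apply: hcomp => //; exact: IH.
- by move=> {}D {}phi psi h; apply: hinv => //; exact: IH.
move=> {}D {}phi tr h; apply: hloc => // x Dx.
case: (h x Dx) => D' [W [phi' [h' oW Wx WD e]]]; exists D', W, phi'.
by split=> //; exact: IH h'.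
Qed.

(** Plain induction suffices: for [pg_local] the conclusion is contained in the hypothesis that phi
    is a local transformation. For composites and inverses, the continuous inverse is composed or
    exchanged with the map. *)
Lemma pseudogroup_embedding gen D phi :
  (forall D' psi, gen D' psi -> open_embedding_on D' psi) ->
  pseudogroup gen D phi -> open_embedding_on D phi.
Proof.
move=> hgen; elim=> {D phi}.
- exact: hgen.
- split; [exact: openT|by rewrite image_id; exact: openT|by move=> x _; exact: cvg_id|].
  by exists id; split=> // y _; exact: cvg_id.
- move=> D phi D' psi _ hphi _ hpsi.
  have oD : open (D `&` phi @^-1` D').
    by apply: open_preimage_on => //; case: hpsi.
  have [_ _ cphi [phi' [K cphi']]] := hphi.
  have [_ _ cpsi [psi' [K' cpsi']]] := hpsi.
  split=> //.
  + rewrite -image_comp; apply: open_image_on hpsi _ _.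
      by apply: open_image_on hphi oD _; exact: subIsetl.
    by move=> _ [x [_ D'x] <-].
  + move=> x [Dx D'x]; apply: continuous_comp; first exact: cphi.
    exact: cpsi.
  + exists (phi' \o psi'); split=> [x [Dx D'x] /=|_ [x [Dx D'x] <-]].
      by rewrite K' // K.
    apply: continuous_comp; first by apply: cpsi'; exists (phi x).
    by rewrite /= K' //; apply: cphi'; exists x.
- move=> D phi psi _ [oD oi cphi [psi' [K cpsi]]] K2.
  have KD : psi @` (phi @` D) = D.
    apply/seteqP; split=> [_ [_ [x Dx <-] <-]|x Dx]; first by rewrite K2.
    by exists (phi x); [exists x|rewrite K2].
  split=> //; first by rewrite KD.
  (* The given psi is prescribed on the image of D only; since the image is open, psi has there the
     germs of the continuous inverse psi'. *)
  + move=> y iy; have e : \forall z \near y, psi' z = psi z.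
      apply: filterS (open_nbhs_nbhs (conj oi iy)) => _ [x Dx <-].
      by rewrite K // K2.
    rewrite /prop_for /continuous_at -(nbhs_singleton e).
    by apply: cvg_trans (cpsi y iy); apply: near_eq_cvg; apply: filterS e => z ->.
  + exists phi; split=> [_ [x Dx <-]|y]; first by rewrite K2.
    by rewrite KD; exact: cphi.
- by move=> D phi /local_transf_embedding.
Qed.

(** Composition multiplies the group elements and inversion inverts them. Gluing may join pieces
    with different g, so the property that passes through the induction is the local one. *)
Lemma pseudogroup_translations {d n : nat} (G : lie_group R d) {M : manifold R n}
    (act : G -> M -> M) (f : S -> M) gen D phi : klein_geometry act ->
  (forall D' psi, gen D' psi -> open_embedding_on D' psi) ->
  (forall D' psi, gen D' psi ->
    exists g, forall y, D' y -> f (psi y) = act g (f y)) ->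
  pseudogroup gen D phi ->
  forall x, D x -> exists (g : G) (W : set S),
    [/\ open W, W x, W `<=` D & forall y, W y -> f (phi y) = act g (f y)].
Proof.
move=> hact hgen hg; have [act1 actM _ _] := hact.
apply: (pseudogroup_nested_ind (P := fun D phi => forall x, D x ->
  exists (g : G) (W : set S), [/\ open W, W x, W `<=` D &
    forall y, W y -> f (phi y) = act g (f y)])) => {D phi}.
- move=> D phi gD x Dx; have [g e] := hg _ _ gD; have [oD _ _ _] := hgen _ _ gD.
  exists g, D; split=> //; exact: subset_refl.
- move=> x _; exists (lone G), setT.
  by split=> //; exact: openT.
- move=> D phi D' psi pphi IH ppsi IH' x [Dx D'x].
  have [g [W [oW Wx WD e]]] := IH x Dx.
  have [g' [W' [oW' Wx' WD' e']]] := IH' (phi x) D'x.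
  exists (lmul g' g), (W `&` (D `&` phi @^-1` W')); split=> //.
  + apply: openI => //; apply: open_preimage_on => //.
    exact: pseudogroup_embedding pphi.
  + by move=> y [_ [Dy /WD']].
  + by move=> y [Wy [_ W'y]] /=; rewrite e' // e // actM.
- move=> D phi psi pphi IH K _ [x Dx <-].
  have [g [W [oW Wx WD e]]] := IH x Dx.
  exists (linv g), (phi @` W); split.
  + by apply: open_image_on oW WD; exact: pseudogroup_embedding pphi.
  + by exists x.
  + by move=> _ [y /WD Dy <-]; exists y.
  + by move=> _ [y Wy <-]; rewrite K ?e ?(actVK hact) //; exact: WD.
- move=> D phi _ IH x Dx; have [D' [W [phi' [IHp oW Wx WD e]]]] := IH x Dx.
  have [g [W' [oW' Wx' _ e']]] := IHp x (WD _ Wx).2.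
  exists g, (W `&` W'); split=> //; first exact: openI.
    by move=> y [/WD []].
  by move=> y [Wy W'y]; rewrite e // e'.
Qed.

End PseudogroupTranslations.

(** * The invariant filtration *)

Section Filtration.
Context {R : realType} {d p r : nat} {S : manifold R p}.
Variables (A : lie_algebroid S r) (om : forall x, 'Hom(A x, 'rV[R]_d)).

(** [filtration om j] iterates j.-1 times, so the indices 0 and 1 give the same family and the
    recursion starts at 1. *)
Lemma filtrationS k : (1 <= k)%N ->
  filtration om k.+1 = next_filtration (filtration om k).
Proof. by case: k. Qed.

Lemma filtration_range k x : filtration om k x `<=` range (om x).
Proof.
rewrite /filtration; elim: k.-1 x => [|j IH] x; first exact: subset_refl.
by move=> _ [X [_ FX _ ->]]; exact/IH/FX.
Qed.

(* A constant section of A^1 has zero derivative, hence belongs to every A^j. *)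
Lemma constant_in_filtration k v : (forall x, range (om x) v) ->
  forall x, filtration om k x v.
Proof.
rewrite /filtration; elim: k.-1 v => [//|j IH] v hv x.
exists (fun=> v); split=> //; [exact: smooth_cst|exact: IH|].
move=> u; rewrite dfun_cst; apply: IH => y.
by exists 0 => //=; rewrite linear0.
Qed.

End Filtration.

Theorem theorem3p8 (R : realType) (d n p r : nat)
  (G : lie_group R d) (M : manifold R n) (act : G -> M -> M)
  (hact : klein_geometry act)
  (S : manifold R p) (hS : connected [set: S])
  (A : lie_algebroid S r) (om : forall x : S, 'Hom(A x, 'rV[R]_d))
  (hom : infinitesimal_immersion act om)
  (hrank : forall j : nat, (1 <= j)%N -> constant_rank (filtration om j))
  (k : nat) (hk : (1 <= k)%N)
  (hstab : filtration om k.+1 = filtration om k) :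
  (exists (q : nat) (B : lie_algebroid S q) (j : forall x : S, 'Hom(B x, A x))
      (nab : vfield S -> section B -> section B),
    [/\ subalgebroid j,
        forall x, [set om x (j x b) | b in [set: B x]] = filtration om k x,
        forall U X, smooth_vfield U -> smooth_sec X -> forall x,
          om x (j x (nab U X x)) = dfun (fun y => om y (j y (X y))) x (U x)
      & twisted_action nab]) /\
  exists s : {vspace 'rV[R]_d},
    [/\ infinitesimal_action G s (const_sharp om),
        forall x, filtration om k x = [set xi | xi \in s],
        forall D : set S, open D -> connected D -> forall X : S -> 'rV[R]_d,
          parallel_section_on D (filtration om k) X <->
          exists2 xi, xi \in s & forall x, D x -> X x = xi
      & forall f : S -> M, immersion f -> log_derivative act f om ->
        forall (D : set S) (phi : S -> S),
          pseudogroup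
            (fun D' psi =>
               exists2 xi, xi \in s & local_flow (const_sharp om xi) D' psi)
            D phi ->
          forall x, D x -> exists (g : G) (W : set S),
            [/\ open W, W x, W `<=` D
              & forall y, W y -> f (phi y) = act g (f y)]].
Proof.
(* The point x0 provided by (I3) serves as base point: W will be the fibre at x0. *)
have [hform _ om_inj [x0 _] _] := hom.
pose F := filtration om k.
have Fnext : next_filtration F = F by rewrite -filtrationS.
have Floc : forall x, \forall y \near x, F y = F x.
  by apply: stable_subspaces_locally_constant (hrank k hk) _ => x; rewrite Fnext.
have Fconst x : F x = F x0.
  by apply: (locally_constant_connected openT hS) => // y _; exact: Floc.
have [q hq] := hrank k hk; have [W [_ FW0]] := hq x0.
have FW x : F x = [set v | v \in W] by rewrite Fconst.
have W_range v : v \in W -> forall x, range (om x) v.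
  by move=> vW x; apply: (@filtration_range _ _ _ _ _ _ om k); rewrite -/F FW.
have W_max v : (forall x, range (om x) v) -> v \in W.
  by move=> /(constant_in_filtration k)/(_ x0); rewrite -/F FW.
split.
  exists (\dim (fullv : {vspace subvs_of W})),
    (const_algebroid hform om_inj W_range W_max), (const_incl om W), (@const_nab _ _ _ _ W).
  split.
  - exact: const_subalgebroid.
  - by move=> x; rewrite -/F FW; exact: const_incl_range.
  - by move=> U X _ sX x; exact: om_const_nab.
  - exact: const_twisted.
exists W; split.
- exact: const_sharp_action.
- exact: FW.
- move=> D oD cD X; split.
    (* A connected D may be empty, and then 0 serves as xi. *)
    move=> [sX FX dX]; have [[x Dx]|nD] := pselect (exists x, D x); last first.
      by exists 0; [exact: mem0v|move=> x Dx; case: nD; exists x].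
    exists (X x); first by have := FX x Dx; rewrite -/F FW.
    move=> y Dy; apply: (locally_constant_connected oD cD) => // z Dz.
    apply: (dfun0_locally_constant oD) => // [w Dw|w u Dw]; last exact: dX.
    exact: smooth_mdiff sX Dw.
  move=> [xi xiW Xxi]; have near_xi x : D x -> \forall y \near x, X y = xi.
    by move=> Dx; apply: filterS (open_nbhs_nbhs (conj oD Dx)).
  split.
  + by apply: smooth_fun_on_ext oD _ (smooth_cst D xi) => x Dx; rewrite Xxi.
  + by move=> x Dx; rewrite -/F FW Xxi.
  + by move=> x Dx u; rewrite (dfun_near u (near_xi x Dx)) dfun_cst.
move=> f [sf _] [_ hf] D phi; apply: pseudogroup_translations => //.
  by move=> D' psi [xi _ [tr _]]; exact: local_transf_embedding.
move=> D' psi [xi xiW [_ [t ht]]].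
(* Here g is fixed before y: it depends on xi and t only and serves the integral curves through all
   points of the domain. *)
have [g hg] := flow_is_translation hact xi t; exists g => y Dy.
have [a [b [gam [ab0 abt dgam <- <-]]]] := ht y Dy.
apply: (hg (f \o gam) a b ab0 abt) => s sab.
have dg : cderiv gam s (const_sharp om xi (gam s)) by exact: dgam.
have -> : dagger act xi ((f \o gam) s) = tmap f (gam s) (const_sharp om xi (gam s)).
  by rewrite hf (om_inv_on om_inj W_range).
apply: cderiv_map => //; exact: smooth_map_on_diff sf I.
Qed.
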